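(* Let $\mathbf b=\Bbbk\mathrm B$ be a connected cocommutative linearized bimonoid in $(\mathsf{Sp},\cdot)$ and let $\mathbf p$ be a positive comonoid. Then the maps $$\mu_{S,T}\bigl((b\otimes p_{(X)})\otimes(b'\otimes p_{(Y)})\bigr)=\mu^{\mathbf b}_{X,Y}(b\otimes b')\otimes p_{(X\sqcup Y)}$$ (for $I=S\sqcup T$, $X\vdash S$, $Y\vdash T$, $b\in\mathbf b[X]$, $b'\in\mathbf b[Y]$) and $$\Delta_{S,T}(b\otimes p_{(X)})=\sum_{(p_{(X)})}\bigl(b|^{\downarrow}_{X_S}\otimes p_{(X_S)}\bigr)\otimes\bigl(b|^{\downarrow}_{X_T}\otimes p_{(X_T)}\bigr)$$ (for $I=S\sqcup T$, $X\vdash I$, $b\in\mathrm B[X]$, extended linearly) afford the species $\mathbf b\circ\mathbf p$ the structure of a bimonoid in $(\mathsf{Sp},\cdot)$.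
   Context: Fix a field $\Bbbk$. A (vector) species is a functor from finite sets with bijections to $\Bbbk$-vector spaces; $\mathsf{Sp}$ is the category of species. A set species is a functor from finite sets with bijections to sets. $I=S\sqcup T$ denotes an ordered decomposition into disjoint, possibly empty subsets; $X\vdash I$ denotes an unordered partition of $I$ into nonempty blocks ($\emptyset$ has only the empty partition). A species $\mathbf p$ is connected if $\mathbf p[\emptyset]\cong\Bbbk$ and positive if $\mathbf p[\emptyset]=0$. Cauchy product: $(\mathbf p\cdot\mathbf q)[I]=\bigoplus_{S\sqcup T=I}\mathbf p[S]\otimes\mathbf q[T]$, giving a braided monoidal category $(\mathsf{Sp},\cdot)$ with trivial braiding $u\otimes v\mapsto v\otimes u$ and unit $\mathbf 1$ ($\mathbf 1[\emptyset]=\Bbbk$, zero otherwise). Monoids, comonoids, bimonoids, Hopf monoids are taken in this category; they are given by natural (in bijections) maps $\mu_{S,T}:\mathbf b[S]\otimes\mathbf b[T]\to\mathbf b[S\sqcup T]$ and $\Delta_{S,T}:\mathbf b[S\sqcup T]\to\mathbf b[S]\otimes\mathbf b[T]$ with unit and counit. For connected species the unit and counit are the evident identifications with $\Bbbk$ in $\emptyset$. A positive comonoid is a positive species $\mathbf p$ with natural coassociative maps $\Delta^{\mathbf p}_{S,T}:\mathbf p[S\sqcup T]\to\mathbf p[S]\otimes\mathbf p[T]$ for $S,T$ nonempty (no counit). Substitution with $\mathbf p$ positive: $(\mathbf b\circ\mathbf p)[I]=\bigoplus_{X\vdash I}\mathbf b[X]\otimes\mathbf p(X)$, where $\mathbf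 p(X)=\bigotimes_{A\in X}\mathbf p[A]$ (unordered tensor product), and $(\mathbf b\circ\mathbf p)[\emptyset]=\mathbf b[\emptyset]$. Write $p_{(X)}=\bigotimes_{A\in X}p_A$ for a simple tensor in $\mathbf p(X)$; given $p_{(X)}$ and $p_{(Y)}$ with $X\vdash S$, $Y\vdash T$, $p_{(X\sqcup Y)}=p_{(X)}\otimes p_{(Y)}$. A linearized bimonoid is a bimonoid $\mathbf b=\Bbbk\mathrm B$ (with $\mathrm B$ a set species, $\mathbf b[I]$ having basis $\mathrm B[I]$) whose maps $\mu_{S,T}$ and $\Delta_{S,T}$ are linearizations of set maps $\mathrm B[S]\times\mathrm B[T]\to\mathrm B[S\sqcup T]$ and $\mathrm B[S\sqcup T]\to\mathrm B[S]\times\mathrm B[T]$. If it is cocommutative, there are restriction maps $\rho^I_U:\mathrm B[I]\to\mathrm B[U]$, $b\mapsto b|_U$, for $U\subseteq I$ (natural, with $\rho^I_I=\mathrm{id}$, $\rho^V_U\rho^I_V=\rho^I_U$) such that $\Delta_{S,T}(b)=b|_S\otimes b|_T$ for $b\in\mathrm B[S\sqcup T]$. For $X\vdash I$ and $T\subseteq I$ put $X^T=\{A\in X: A\cap T\ne\emptyset\}$ and $X_T=\{A\cap T: A\in X,\ A\cap T\neq\emptyset\}\vdash T$. The bijection $X^T\to X_T$, $A\mapsto A\cap T$, induces $\sigma^{X^T}_{X_T}:\mathbf b[X^T]\to\mathbf b[X_T]$; put $b|^{\downarrow}_{X_T}=\sigma^{X^T}_{X_T}(b|_{X^T})$ for $b\in\mathrm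 B[X]$. For $X\vdash I=S\sqcup T$, the notation $\sum_{(p_{(X)})}p_{(X_S)}\otimes p_{(X_T)}\in\mathbf p(X_S)\otimes\mathbf p(X_T)$ denotes the image of $p_{(X)}$ obtained by applying to each factor $p_A$ the map $\Delta^{\mathbf p}_{A\cap S,A\cap T}$ if both $A\cap S,A\cap T$ are nonempty, leaving $p_A$ unchanged otherwise, and then collecting the factors on subsets of $S$ before those on subsets of $T$. *)

(* Defs.v *)
From HB Require Import structures.
From mathcomp Require Import all_boot all_order all_algebra.
From mathcomp Require Import generic_quotient ring_quotient boolp freeg.
Set Implicit Arguments.
Unset Strict Implicit.
Unset Printing Implicit Defensive.
Import GRing.Theory.
Local Open Scope ring_scope.
Local Open Scope quotient_scope.

Section Linear.
Variables (k : fieldType) (U V : lmodType k) (f : U -> V).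
Definition mklin (Hf : linear f) : {linear U -> V} :=
  HB.pack f (GRing.isLinear.Build k U V *:%R f Hf).
Lemma mklinE (Hf : linear f) x : mklin Hf x = f x. Proof. by []. Qed.
End Linear.

Section FreeLift.
Variables (k : fieldType) (G : choiceType) (W : lmodType k) (f : G -> W).
Fact fglift_linear : linear (fglift f : {freeg G / k} -> W).
Proof.
pose F : {additive {freeg G / k} -> W} :=
  HB.pack (fglift f) (GRing.isZmodMorphism.Build _ _ (fglift f) (lift_is_additive f)).
move=> a u v; rewrite -[fglift f]/(F : _ -> _) raddfD; congr (_ + _).
have Eu := freeg_sumE u; rewrite -Eu scaler_sumr !(raddf_sum F) scaler_sumr.
apply: eq_bigr => x _.
have -> : a *: << coeff x u *g x >> = << a * coeff x u *g x >> :> {freeg G / k}.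
  by apply/eqP/freeg_eqP => y; rewrite coeffZ !coeffU mulrA.
by rewrite /= !liftU scalerA.
Qed.
Definition flift : {linear {freeg G / k} -> W} := mklin fglift_linear.
Lemma fliftE x : flift << x >> = f x.
Proof. by rewrite mklinE liftU scale1r. Qed.
Lemma free_ind (P : {freeg G / k} -> Prop) :
  P 0 -> (forall a u v, P u -> P v -> P (a *: u + v)) ->
  (forall x, P << x >>) -> forall u, P u.
Proof.
move=> P0 PL PX u; rewrite -[u]freeg_sumE.
elim/big_ind: _ => // [x y Px Py|x _].
  by rewrite -[x]scale1r; apply: PL.
have -> : << coeff x u *g x >> = coeff x u *: << x >> + 0 :> {freeg G / k}.
  by apply/eqP/freeg_eqP => y; rewrite addr0 coeffZ !coeffU mul1r.
exact: PL.
Qed.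
End FreeLift.

(* The vector space generated by G subject to the relations r = 0 for r in R. *)
Section Presented.
Variables (k : fieldType) (G : choiceType) (R : {freeg G / k} -> Prop).

Definition relspan : {pred {freeg G / k}} := fun v =>
  `[< forall N : {freeg G / k} -> Prop, (forall r, R r -> N r) -> N 0 ->
      (forall a u w, N u -> N w -> N (a *: u + w)) -> N v >].

Lemma relspan_in r : R r -> r \in relspan.
Proof. by move=> Rr; apply/asboolP => N NR _ _; apply: NR. Qed.

Fact relspan_zmod : zmod_closed relspan.
Proof.
split=> [|u v /asboolP Hu /asboolP Hv]; apply/asboolP => N NR N0 NL //.
by rewrite addrC -scaleN1r; apply: (NL); [exact: (Hv N NR N0 NL)|exact: (Hu N NR N0 NL)].
Qed.
HB.instance Definition _ := GRing.isZmodClosed.Build _ relspan relspan_zmod.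

Lemma relspanZ a u : u \in relspan -> a *: u \in relspan.
Proof.
move=> /asboolP Hu; apply/asboolP => N NR N0 NL.
by rewrite -[_ *: _]addr0; apply: (NL) => //; exact: Hu.
Qed.

Local Notation Q := (Quotient.quot relspan).
Definition presented := Q.
HB.instance Definition _ := GRing.Zmodule.on presented.

Definition ppi (u : {freeg G / k}) : presented := \pi_Q u.
Definition prep (x : presented) : {freeg G / k} := @repr _ Q x.
Lemma prepK x : ppi (prep x) = x. Proof. exact: reprK. Qed.
Lemma ppi_eq u v : (u - v \in relspan) = (ppi u == ppi v).
Proof. exact: Quotient.idealrBE. Qed.
Lemma ppiD u v : ppi (u + v) = ppi u + ppi v.
Proof. exact: (raddfD (\pi_Q)). Qed.

Definition pscale (a : k) (x : presented) : presented := ppi (a *: prep x).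

Lemma pscale_ppi a u : pscale a (ppi u) = ppi (a *: u).
Proof.
by apply/eqP; rewrite -ppi_eq -scalerBr relspanZ // ppi_eq prepK.
Qed.

Fact pscaleA a b x : pscale a (pscale b x) = pscale (a * b) x.
Proof. by rewrite -[x]prepK !pscale_ppi scalerA. Qed.
Fact pscale1 : left_id 1 pscale.
Proof. by move=> x; rewrite -[x]prepK !pscale_ppi scale1r. Qed.
Fact pscaleDr : right_distributive pscale +%R.
Proof.
by move=> a x y; rewrite -[x]prepK -[y]prepK -ppiD !pscale_ppi -ppiD scalerDr.
Qed.
Fact pscaleDl x : {morph pscale^~ x : a b / a + b}.
Proof. by move=> a b; rewrite -[x]prepK !pscale_ppi -ppiD scalerDl. Qed.
HB.instance Definition _ := GRing.Zmodule_isLmodule.Build k presented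
  pscaleA pscale1 pscaleDr pscaleDl.

Fact ppi_linear : linear ppi.
Proof. by move=> a u v; rewrite ppiD -pscale_ppi. Qed.
Definition ppiL : {linear {freeg G / k} -> presented} := mklin ppi_linear.

Lemma ppiLE u : ppiL u = ppi u. Proof. by []. Qed.

Definition pgen (x : G) : presented := ppi << x >>.

Lemma ppi_rel r : R r -> ppi r = 0.
Proof.
move=> Rr; rewrite -(raddf0 ppiL); apply/eqP.
by rewrite -[_ == _]ppi_eq subr0 relspan_in.
Qed.

Lemma presented_ind (P : presented -> Prop) :
  P 0 -> (forall a u v, P u -> P v -> P (a *: u + v)) ->
  (forall x, P (pgen x)) -> forall u, P u.
Proof.
move=> P0 PL PX u; rewrite -[u]prepK.
elim/free_ind: (prep u) => [|a v w Pv Pw|x]; last exact: PX.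
  by rewrite -[ppi _]/(ppiL 0) raddf0.
by rewrite ppi_linear; apply: PL.
Qed.

Section Lift.
Variables (W : lmodType k) (f : G -> W).
Hypothesis fR : forall r, R r -> flift f r = 0.
Definition plift_fun (x : presented) : W := flift f (prep x).
Lemma plift_ppi u : plift_fun (ppi u) = flift f u.
Proof.
apply/eqP; rewrite /plift_fun -subr_eq0 -raddfB; apply/eqP.
have : prep (ppi u) - u \in relspan by rewrite ppi_eq prepK.
move=> /asboolP/(_ (fun w => flift f w = 0)); apply=> //; first exact: raddf0.
by move=> a v w Hv Hw; rewrite linearP Hv Hw scaler0 addr0.
Qed.
Fact plift_linear : linear plift_fun.
Proof.
move=> a x y; rewrite -[x]prepK -[y]prepK -ppi_linear !plift_ppi.
exact: linearP.
Qed.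
Definition plift : {linear presented -> W} := mklin plift_linear.
Lemma pliftE x : plift (pgen x) = f x.
Proof. by rewrite mklinE plift_ppi fliftE. Qed.
End Lift.
End Presented.
Arguments plift : simpl never.
Arguments flift : simpl never.

Section Tensor2.
Variables (k : fieldType) (V W : lmodType k).

Variant tens2_rel : {freeg (V * W)%type / k} -> Prop :=
| Tens2L a v v' w :
    tens2_rel (<< (a *: v + v', w) >> - (a *: << (v, w) >> + << (v', w) >>))
| Tens2R a v w w' :
    tens2_rel (<< (v, a *: w + w') >> - (a *: << (v, w) >> + << (v, w') >>)).

Definition tens2 : lmodType k := presented tens2_rel.
Definition tpure2 (v : V) (w : W) : tens2 := pgen tens2_rel (v, w).

Definition bilin (Z : lmodType k) (f : V -> W -> Z) : Prop :=
  (forall w, linear (f^~ w)) /\ (forall v, linear (f v)).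

Lemma tpure2_bilin : bilin tpure2.
Proof.
split=> [w a v v'|v a w w']; apply: subr0_eq.
  by have := ppi_rel (Tens2L a v v' w); rewrite -ppiLE linearB linearP.
by have := ppi_rel (Tens2R a v w w'); rewrite -ppiLE linearB linearP.
Qed.

Section Lift.
Variables (Z : lmodType k) (f : V -> W -> Z) (Hf : bilin f).
Fact lift2_rel r : tens2_rel r -> flift (fun vw => f vw.1 vw.2) r = 0.
Proof.
by case=> *; rewrite linearB linearP !fliftE /= ?(Hf.1, Hf.2) subrr.
Qed.
Definition lift2 : {linear tens2 -> Z} := plift lift2_rel.
Lemma lift2E v w : lift2 (tpure2 v w) = f v w.
Proof. exact: pliftE. Qed.
End Lift.

Lemma tens2_ind (P : tens2 -> Prop) :
  (forall a u v, P u -> P v -> P (a *: u + v)) ->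
  (forall v w, P (tpure2 v w)) -> forall u, P u.
Proof.
move=> PL PP; have P0 : P 0.
  by have := PL (-1) _ _ (PP 0 0) (PP 0 0); rewrite scaleN1r addNr.
by apply: presented_ind => // -[v w]; apply: PP.
Qed.
End Tensor2.

Arguments lift2 : simpl never.

Notation "V \ox W" := (tens2 V W) (at level 40, left associativity) : type_scope.
Notation "v \ot w" := (tpure2 v w) (at level 40, left associativity) : ring_scope.

Section Tensor2Maps.
Variable k : fieldType.
Implicit Types V W Z : lmodType k.

Lemma tpure2l V W (w : W) : linear (fun v : V => v \ot w).
Proof. exact: (tpure2_bilin V W).1. Qed.
Lemma tpure2r V W (v : V) : linear (fun w : W => v \ot w).
Proof. exact: (tpure2_bilin V W).2. Qed.

Lemma tens2_eq V W Z (f g : {linear V \ox W -> Z}) :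
  (forall v w, f (v \ot w) = g (v \ot w)) -> f =1 g.
Proof.
move=> fg; elim/tens2_ind => // a u v Hu Hv.
by rewrite !linearP Hu Hv.
Qed.

Section Map.
Variables (V V' W W' : lmodType k) (f : {linear V -> V'}) (g : {linear W -> W'}).
Fact tmap2_bilin : bilin (fun v w => f v \ot g w).
Proof.
split=> [w a v v'|v a w w'] /=; rewrite linearP.
  exact: tpure2l.
exact: tpure2r.
Qed.
Definition tmap2 : {linear V \ox W -> V' \ox W'} := lift2 tmap2_bilin.
End Map.

Section Swap.
Variables V W : lmodType k.
Fact tswap_bilin : bilin (fun (v : V) (w : W) => w \ot v).
Proof.
by split=> [w a v v'|v a w w'] /=; rewrite ?(tpure2l, tpure2r).
Qed.
Definition tswap : {linear V \ox W -> W \ox V} := lift2 tswap_bilin.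
End Swap.

Section Unitors.
Variable V : lmodType k.
Fact tlunit_bilin : bilin (fun (a : k^o) (v : V) => (a : k) *: v).
Proof.
split=> [v a b c|a b v w] /=; first by rewrite scalerDl scalerA.
by rewrite scalerDr !scalerA mulrC.
Qed.
Definition tlunit : {linear k^o \ox V -> V} := lift2 tlunit_bilin.
Definition trunit : {linear V \ox k^o -> V} :=
  mklin (linearP (tlunit \o tswap V k^o)).
End Unitors.

Fact lin_comb Z (a b : k) (x x' y y' : Z) :
  b *: (a *: x + x') + (a *: y + y') = a *: (b *: x + y) + (b *: x' + y').
Proof. by rewrite !scalerDr !scalerA mulrC addrACA. Qed.

Section Assoc.
Variables V W Z : lmodType k.
Fact tassoc_bilin0 (z : Z) : bilin (fun (v : V) (w : W) => v \ot (w \ot z)).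
Proof.
split=> [w a v v'|v a w w'] /=; first by rewrite tpure2l.
by rewrite tpure2l tpure2r.
Qed.
Fact tassoc_bilin : bilin (fun (t : V \ox W) (z : Z) => lift2 (tassoc_bilin0 z) t).
Proof.
split=> [z|t a z z']; first by move=> b u v; exact: linearP.
move: t; apply: tens2_ind => [b u v Hu Hv|v w]; last by rewrite !lift2E !tpure2r.
by rewrite !(linearP (lift2 _)) Hu Hv lin_comb.
Qed.
Definition tassoc : {linear (V \ox W) \ox Z -> V \ox (W \ox Z)} :=
  lift2 tassoc_bilin.
End Assoc.

Section Middle.
Variables V1 V2 W1 W2 : lmodType k.
Fact tmid_bilin0 (v1 : V1) (v2 : V2) :
  bilin (fun (w1 : W1) (w2 : W2) => (v1 \ot w1) \ot (v2 \ot w2)).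
Proof.
split=> [w a v v'|v a w w'] /=.
  by rewrite tpure2r tpure2l.
by rewrite !tpure2r.
Qed.
Fact tmid_bilin1 (s : W1 \ox W2) :
  bilin (fun (v1 : V1) (v2 : V2) => lift2 (tmid_bilin0 v1 v2) s).
Proof.
split=> [w a v v'|v a w w']; cbv beta.
  move: s; apply: tens2_ind => [b u t Hu Ht|x y]; last by rewrite !lift2E !tpure2l.
  by rewrite !(linearP (lift2 _)) Hu Ht lin_comb.
move: s; apply: tens2_ind => [b u t Hu Ht|x y].
  by rewrite !(linearP (lift2 _)) Hu Ht lin_comb.
by rewrite !lift2E tpure2l tpure2r.
Qed.
Fact tmid_bilin : bilin (fun (t : V1 \ox V2) (s : W1 \ox W2) => lift2 (tmid_bilin1 s) t).
Proof.
split=> [s|t a s s']; first by move=> b u v; exact: linearP.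
move: t; apply: tens2_ind => [b u v Hu Hv|v w]; last by rewrite !lift2E linearP.
by rewrite !(linearP (lift2 _)) Hu Hv lin_comb.
Qed.
Definition tmid :
  {linear (V1 \ox V2) \ox (W1 \ox W2) -> (V1 \ox W1) \ox (V2 \ox W2)} :=
  lift2 tmid_bilin.
End Middle.
End Tensor2Maps.

Section Tensor.
Variables (k : fieldType) (I : finType) (V : I -> lmodType k).

Variant tens_rel : {freeg (forall i, V i) / k} -> Prop :=
| TensRel (x : forall i, V i) i a (v v' : V i) :
    tens_rel (<< dfwith x (a *: v + v') >>
              - (a *: << dfwith x v >> + << dfwith x v' >>)).

Definition tens : lmodType k := presented tens_rel.
Definition tpure (x : forall i, V i) : tens := pgen tens_rel x.

Definition multilin (Z : lmodType k) (f : (forall i, V i) -> Z) : Prop :=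
  forall (x : forall i, V i) i, linear (fun v : V i => f (dfwith x v)).

Lemma tpure_multilin : multilin tpure.
Proof.
move=> x i a v v'; apply: subr0_eq.
by have := ppi_rel (TensRel x a v v'); rewrite -ppiLE linearB linearP.
Qed.

Section Lift.
Variables (Z : lmodType k) (f : (forall i, V i) -> Z) (Hf : multilin f).
Fact tlift_rel r : tens_rel r -> flift f r = 0.
Proof. by case=> *; rewrite linearB linearP !fliftE /= Hf subrr. Qed.
Definition tlift : {linear tens -> Z} := plift tlift_rel.
Lemma tliftE x : tlift (tpure x) = f x.
Proof. exact: pliftE. Qed.
End Lift.

Lemma tens_eq (Z : lmodType k) (f g : {linear tens -> Z}) :
  (forall x, f (tpure x) = g (tpure x)) -> f =1 g.
Proof.
move=> fg; elim/presented_ind => // [|a u v Hu Hv]; first by rewrite !raddf0.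
by rewrite !linearP Hu Hv.
Qed.
End Tensor.
Arguments tlift : simpl never.

Section TensorMap.
Variables (k : fieldType) (I J : finType).
Variables (V : I -> lmodType k) (W : J -> lmodType k).
Variables (g : J -> I) (h : forall j, {linear V (g j) -> W j}).
Hypothesis bij_g : bijective g.
Fact tmap_multilin :
  multilin (fun x : forall i, V i => tpure (fun j => h j (x (g j)))).
Proof.
case: bij_g => g' gK g'K x i; move: (g'K i); move: (g' i) => j; case: _ /.
have E (v : V (g j)) : (fun j' => h j' (dfwith x v (g j'))) =
    dfwith (fun j' => h j' (x (g j'))) (h j v).
  apply: functional_extensionality_dep => j'.
  have [e|ne] := eqVneq j j'.
    by case: _ / e; rewrite !dfwith_in.
  by rewrite !dfwith_out //; apply: contra ne => /eqP /(can_inj gK) ->.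
by move=> a v v'; rewrite !E linearP tpure_multilin.
Qed.
Definition tmap : {linear tens V -> tens W} := tlift tmap_multilin.
Lemma tmapE x : tmap (tpure x) = tpure (fun j => h j (x (g j))).
Proof. exact: tliftE. Qed.
End TensorMap.

(* The index type being finite, the direct sum is the product. *)
Section DSum.
Variables (k : fieldType) (I : finType) (V : I -> lmodType k).
Definition dsum := forall i, V i.
HB.instance Definition _ := Choice.on dsum.
Definition dsum0 : dsum := fun=> 0.
Definition dsumN (x : dsum) : dsum := fun i => - x i.
Definition dsumD (x y : dsum) : dsum := fun i => x i + y i.
Definition dsumZ a (x : dsum) : dsum := fun i => a *: x i.
Local Ltac dsum_tac :=
  move=> *; apply: functional_extensionality_dep => ?;
  rewrite /dsumD /dsumN /dsumZ /dsum0.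
Fact dsumA : associative dsumD. Proof. by dsum_tac; rewrite addrA. Qed.
Fact dsumC : commutative dsumD. Proof. by dsum_tac; rewrite addrC. Qed.
Fact dsum0D : left_id dsum0 dsumD. Proof. by dsum_tac; rewrite add0r. Qed.
Fact dsumND : left_inverse dsum0 dsumN dsumD.
Proof. by dsum_tac; rewrite addNr. Qed.
HB.instance Definition _ := GRing.isZmodule.Build dsum dsumA dsumC dsum0D dsumND.
Fact dsumZA a b x : dsumZ a (dsumZ b x) = dsumZ (a * b) x.
Proof. by dsum_tac; rewrite scalerA. Qed.
Fact dsumZ1 : left_id 1 dsumZ. Proof. by dsum_tac; rewrite scale1r. Qed.
Fact dsumZDr : right_distributive dsumZ +%R.
Proof. by dsum_tac; exact: scalerDr. Qed.
Fact dsumZDl x : {morph dsumZ^~ x : a b / a + b}.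
Proof. by dsum_tac; exact: scalerDl. Qed.
HB.instance Definition _ := GRing.Zmodule_isLmodule.Build k dsum
  dsumZA dsumZ1 dsumZDr dsumZDl.

Definition dinj i (v : V i) : dsum := dfwith (fun j => 0 : V j) v.
End DSum.

(* The finite sets are the subsets A : {set T} of finite types T, so that the
   subsets of A, and the partitions of A, are again of the form {set T} and
   {set {set T}}.  A bijection from A : {set T} to B : {set U} is given by a
   partial map f : T -> option U (a total one need not exist: U may be empty
   when A and B are); partial maps which agree on A give the same bijection. *)
Section Bijections.
Implicit Types T U W : finType.

Definition is_bij T U (f : T -> option U) (A : {set T}) (B : {set U}) : Prop :=
  {in A &, injective f} /\ f @: A = Some @: B.

Definition pimset T U (f : T -> option U) (C : {set T}) : {set U} :=
  [set y | Some y \in f @: C].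

Definition pblock_map T U (f : T -> option U) (C : {set T}) : option {set U} :=
  Some (pimset f C).

Lemma is_bij_fun T U (f : T -> option U) A B x :
  is_bij f A B -> x \in A -> exists2 y, y \in B & f x = Some y.
Proof.
case=> _ fAB xA; have : f x \in f @: A by apply: imset_f.
by rewrite fAB => /imsetP[y yB ->]; exists y.
Qed.

Lemma is_bij_surj T U (f : T -> option U) A B y :
  is_bij f A B -> y \in B -> exists2 x, x \in A & f x = Some y.
Proof.
case=> _ fAB yB; have : Some y \in f @: A by rewrite fAB imset_f.
by case/imsetP=> x xA ->; exists x.
Qed.

Lemma is_bijI T U (f : T -> option U) (A : {set T}) (B : {set U}) :
  {in A &, injective f} ->
  (forall x, x \in A -> exists2 y, y \in B & f x = Some y) ->
  (forall y, y \in B -> exists2 x, x \in A & f x = Some y) -> is_bij f A B.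
Proof.
move=> fI fA fB; split=> //; apply/setP => o; apply/imsetP/imsetP => -[].
  by move=> x /fA[y yB ->] ->; exists y.
by move=> y /fB[x xA <-] ->; exists x.
Qed.

Lemma is_bij_id T (A : {set T}) : is_bij Some A A.
Proof. by split=> // x y _ _ []. Qed.

Lemma is_bij_comp T U W (f : T -> option U) (g : U -> option W) A B C :
  is_bij f A B -> is_bij g B C -> is_bij (pcomp g f) A C.
Proof.
move=> Hf Hg; apply: is_bijI => [x x' xA x'A|x xA|z zC].
- have [y yB fx] := is_bij_fun Hf xA; have [y' y'B fx'] := is_bij_fun Hf x'A.
  rewrite /pcomp fx fx' /= => e; apply: (Hf.1) => //.
  by rewrite fx fx'; congr Some; apply: (Hg.1).
- have [y yB fx] := is_bij_fun Hf xA; have [z zC gy] := is_bij_fun Hg yB.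
  by exists z => //; rewrite /pcomp fx.
- have [y yB gy] := is_bij_surj Hg zC; have [x xA fx] := is_bij_surj Hf yB.
  by exists x => //; rewrite /pcomp fx.
Qed.

Lemma pimsetP T U (f : T -> option U) (C : {set T}) y :
  reflect (exists2 x, x \in C & f x = Some y) (y \in pimset f C).
Proof.
rewrite inE; apply: (iffP imsetP) => -[x xC e]; by exists x.
Qed.

Lemma is_bij_sub T U (f : T -> option U) (A : {set T}) (B : {set U}) (C : {set T}) :
  is_bij f A B -> C \subset A -> is_bij f C (pimset f C).
Proof.
move=> Hf /subsetP CA; apply: is_bijI => [x y xC yC|x xC|y /pimsetP//].
  by apply: (Hf.1); apply: CA.
have [y yB fx] := is_bij_fun Hf (CA _ xC).
by exists y => //; apply/pimsetP; exists x.
Qed.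

Lemma pimset_sub T U (f : T -> option U) (A : {set T}) (B : {set U}) (C : {set T}) :
  is_bij f A B -> C \subset A -> pimset f C \subset B.
Proof.
move=> Hf /subsetP CA; apply/subsetP => y /pimsetP[x /CA xA fx].
by have [y' y'B] := is_bij_fun Hf xA; rewrite fx => -[->].
Qed.

Lemma pimset_inj T U (f : T -> option U) (A : {set T}) (B : {set U}) (C D : {set T}) :
  is_bij f A B -> C \subset A -> D \subset A -> pimset f C = pimset f D -> C = D.
Proof.
move=> Hf; wlog: C D / forall C D : {set T}, C \subset A -> D \subset A ->
  pimset f C = pimset f D -> C \subset D.
  apply=> {C D} C D /subsetP CA /subsetP DA e; apply/subsetP => x xC.
  have [y yB fx] := is_bij_fun Hf (CA _ xC).
  have /pimsetP[x' x'D fx'] : y \in pimset f D by rewrite -e; apply/pimsetP; exists x.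
  by rewrite (Hf.1 _ _ (CA _ xC) (DA _ x'D)) // fx fx'.
by move=> H CA DA e; apply/eqP; rewrite eqEsubset (H C D) ?(H D C).
Qed.

Lemma pimset_id T (C : {set T}) : pimset Some C = C.
Proof. by apply/setP => x; apply/pimsetP/idP => [[y yC [<-]]|xC]; last exists x. Qed.

Lemma pimset_comp T U W (f : T -> option U) (g : U -> option W) (C : {set T}) :
  pimset (pcomp g f) C = pimset g (pimset f C).
Proof.
apply/setP => z; apply/pimsetP/pimsetP => [[x xC]|[y /pimsetP[x xC fx] gy]].
  rewrite /pcomp; case fx: (f x) => [y|] //= gy.
  by exists y => //; apply/pimsetP; exists x.
by exists x; rewrite // /pcomp fx.
Qed.

Lemma pimset_ext T U (f g : T -> option U) (C : {set T}) :
  {in C, f =1 g} -> pimset f C = pimset g C.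
Proof.
by move=> fg; apply/setP => y; apply/pimsetP/pimsetP => -[x xC fx]; exists x;
  rewrite // ?fg // -fg.
Qed.

Definition blockbij T U (f : T -> option U) (X : {set {set T}}) (Y : {set {set U}}) :=
  is_bij (pblock_map f) X Y /\ {in X, forall C, is_bij f C (pimset f C)}.

Lemma blockbij_id T (X : {set {set T}}) : blockbij Some X X.
Proof.
split=> [|C _]; last by rewrite pimset_id; apply: is_bij_id.
by apply: is_bijI => [C D _ _|C CX|C CX]; rewrite /pblock_map ?pimset_id;
  [case | exists C | exists C; rewrite ?pimset_id].
Qed.

Definition comap_part T U (f : T -> option U) (A : {set T}) (Y : {set {set U}}) :=
  [set C : {set T} | (C \subset A) && (pimset f C \in Y)].

Section CoMap.
Variables (T U : finType) (f : T -> option U) (A : {set T}) (B : {set U}).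
Hypothesis Hf : is_bij f A B.
Variable Y : {set {set U}}.
Hypothesis HY : partition Y B.

Definition preset (D : {set U}) : {set T} := [set x in A | f x \in Some @: D].
Lemma preset_sub D : preset D \subset A.
Proof. by apply/subsetP => x; rewrite inE => /andP[]. Qed.
Lemma presetK (D : {set U}) : D \subset B -> pimset f (preset D) = D.
Proof.
move=> /subsetP DB; apply/setP => y; apply/pimsetP/idP => [[x]|yD].
  by rewrite inE => /andP[_ /imsetP[y' y'D ->]] [<-].
have [x xA fx] := is_bij_surj Hf (DB _ yD).
by exists x; rewrite // inE xA fx imset_f.
Qed.

Lemma partS (D : {set U}) : D \in Y -> D \subset B.
Proof. by case/and3P: HY => /eqP <- _ _ DY; apply: bigcup_sup. Qed.

Lemma comap_partition : partition (comap_part f A Y) A.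
Proof.
have [/eqP cY /trivIsetP tY n0] := and3P HY.
apply/and3P; split.
- rewrite eqEsubset; apply/andP; split.
    by apply/bigcupsP => C; rewrite inE => /andP[].
  apply/subsetP => x xA; have [y yB fx] := is_bij_fun Hf xA.
  have : y \in cover Y by rewrite cY.
  case/bigcupP => D DY yD; apply/bigcupP; exists (preset D).
    by rewrite inE preset_sub presetK ?partS.
  by rewrite inE xA fx imset_f.
- apply/trivIsetP => C D; rewrite !inE => /andP[CA CY] /andP[DA DY] CD.
  have ne : pimset f C != pimset f D.
    by apply: contra CD => /eqP /(pimset_inj Hf CA DA) ->.
  rewrite -setI_eq0; apply/eqP/setP => x; rewrite !inE; apply/negP => /andP[xC xD].
  have [y yB fx] := is_bij_fun Hf (subsetP CA _ xC).
  have /pred0P/(_ y)/= := tY _ _ CY DY ne.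
  suff [-> ->] : y \in pimset f C /\ y \in pimset f D by [].
  by split; apply/pimsetP; exists x.
- rewrite inE sub0set /=; suff -> : pimset f set0 = set0 by [].
  by apply/setP => y; rewrite [RHS]inE; apply/pimsetP => -[x]; rewrite inE.
Qed.

Lemma comap_blockbij : blockbij f (comap_part f A Y) Y.
Proof.
split; last by move=> C; rewrite inE => /andP[CA _]; apply: is_bij_sub Hf CA.
apply: is_bijI => [C D|C|D DY].
- rewrite !inE => /andP[CA _] /andP[DA _] [e]; exact: pimset_inj Hf CA DA e.
- by rewrite inE => /andP[_ CY]; exists (pimset f C).
- exists (preset D); last by rewrite /pblock_map presetK ?partS.
  by rewrite inE preset_sub presetK ?partS.
Qed.
End CoMap.

Lemma comap_id T (A : {set T}) X : partition X A -> comap_part Some A X = X.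
Proof.
move=> HX; apply/setP => C; rewrite inE pimset_id andbC.
by case CX: (C \in X); rewrite //= (partS HX).
Qed.

Lemma comap_comp T U W (f : T -> option U) (g : U -> option W) A B Z :
  is_bij f A B -> comap_part (pcomp g f) A Z = comap_part f A (comap_part g B Z).
Proof.
move=> Hf; apply/setP => C; rewrite !inE pimset_comp.
by case CA: (C \subset A); rewrite //= (pimset_sub Hf CA).
Qed.

Lemma comap_ext T U (f g : T -> option U) (A : {set T}) Y :
  {in A, f =1 g} -> comap_part f A Y = comap_part g A Y.
Proof.
move=> fg; apply/setP => C; rewrite !inE.
case CA: (C \subset A) => //=; rewrite (@pimset_ext _ _ f g) // => x xC.
by apply: fg; apply: (subsetP CA).
Qed.
End Bijections.

Definition decomp (T : finType) (I S R : {set T}) : bool :=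
  (S :|: R == I) && [disjoint S & R].

Section Species.
Variable k : fieldType.

Record species := Species {
  sp_obj : forall T : finType, {set T} -> lmodType k;
  sp_map : forall (T U : finType) (f : T -> option U) A B,
    is_bij f A B -> {linear sp_obj A -> sp_obj B};
  sp_ext : forall (T U : finType) (f g : T -> option U) A B
    (Hf : is_bij f A B) (Hg : is_bij g A B),
    {in A, f =1 g} -> sp_map Hf =1 sp_map Hg;
  sp_id : forall (T : finType) (A : {set T}) (H : is_bij Some A A),
    sp_map H =1 id;
  sp_comp : forall (T U W : finType) (f : T -> option U) (g : U -> option W)
    A B C (Hf : is_bij f A B) (Hg : is_bij g B C) (Hgf : is_bij (pcomp g f) A C),
    sp_map Hgf =1 sp_map Hg \o sp_map Hf }.

Record set_species := SetSpecies {
  ss_obj : forall T : finType, {set T} -> Type;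
  ss_map : forall (T U : finType) (f : T -> option U) A B,
    is_bij f A B -> ss_obj A -> ss_obj B;
  ss_ext : forall (T U : finType) (f g : T -> option U) A B
    (Hf : is_bij f A B) (Hg : is_bij g A B),
    {in A, f =1 g} -> ss_map Hf =1 ss_map Hg;
  ss_id : forall (T : finType) (A : {set T}) (H : is_bij Some A A),
    ss_map H =1 id;
  ss_comp : forall (T U W : finType) (f : T -> option U) (g : U -> option W)
    A B C (Hf : is_bij f A B) (Hg : is_bij g B C) (Hgf : is_bij (pcomp g f) A C),
    ss_map Hgf =1 ss_map Hg \o ss_map Hf }.
End Species.

Notation "p @@ A" := (sp_obj p A) (at level 30, no associativity).
Notation "B @@s A" := (ss_obj B A) (at level 30, no associativity).

Section Linearization.
Variables (k : fieldType) (B : set_species).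
Definition lin_obj (T : finType) (A : {set T}) : lmodType k :=
  {freeg {classic B @@s A} / k}.
Definition lin_gen (T : finType) (A : {set T}) (b : B @@s A) : lin_obj A :=
  << (b : {classic B @@s A}) >>.
Definition lin_map (T U : finType) (f : T -> option U) A C (Hf : is_bij f A C) :
  {linear lin_obj A -> lin_obj C} :=
  flift (fun b : {classic B @@s A} => lin_gen (ss_map Hf b)).
Lemma lin_eq (T : finType) (A : {set T}) (W : lmodType k)
  (f g : {linear lin_obj A -> W}) : (forall b, f (lin_gen b) = g (lin_gen b)) -> f =1 g.
Proof.
move=> fg; apply: free_ind => [|a u v Hu Hv|x]; first by rewrite !raddf0.
  by rewrite !linearP Hu Hv.
exact: fg.
Qed.
Lemma lin_mapE (T U : finType) (f : T -> option U) A C (Hf : is_bij f A C) b :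
  lin_map Hf (lin_gen b) = lin_gen (ss_map Hf b).
Proof. exact: fliftE. Qed.
Fact lin_ext (T U : finType) (f g : T -> option U) A C
    (Hf : is_bij f A C) (Hg : is_bij g A C) :
    {in A, f =1 g} -> lin_map Hf =1 lin_map Hg.
Proof. by move=> fg; apply: lin_eq => b; rewrite !lin_mapE (ss_ext Hf Hg). Qed.
Fact lin_id (T : finType) (A : {set T}) (H : is_bij Some A A) :
    lin_map H =1 id.
Proof. by apply: (@lin_eq _ _ _ _ idfun) => b; rewrite lin_mapE ss_id. Qed.
Fact lin_comp (T U W : finType) (f : T -> option U) (g : U -> option W)
    A C D (Hf : is_bij f A C) (Hg : is_bij g C D) (Hgf : is_bij (pcomp g f) A D) :
    lin_map Hgf =1 lin_map Hg \o lin_map Hf.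
Proof.
apply: (@lin_eq _ _ _ _ (lin_map Hg \o lin_map Hf)) => b.
by rewrite -[RHS]/(lin_map Hg (lin_map Hf (lin_gen b))) !lin_mapE (ss_comp Hf Hg).
Qed.
Definition lin : species k := Species lin_ext lin_id lin_comp.
Definition basis (T : finType) (A : {set T}) (e : B @@s A) : lin @@ A := lin_gen e.
End Linearization.

Section Substitution.
Variable k : fieldType.

Section BlockTensor.
Variable p : species k.

Definition ptens (T : finType) (X : {set {set T}}) : lmodType k :=
  tens (fun C : {C : {set T} | C \in X} => p @@ (val C)).

(* The simple tensor p_(X).  The family x is total for convenience, but only its
   values on the blocks of X matter; thus p_(X), p_(Y) and the tensor
   p_(X :|: Y) = p_(X) (x) p_(Y), for disjoint X and Y, come from one family x. *)
Definition ppure (T : finType) (X : {set {set T}}) (x : forall C : {set T}, p @@ C) :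
  ptens X := tpure (fun C : {C : {set T} | C \in X} => x (val C)).

Section Map.
Variables (T U : finType) (f : T -> option U).
Variables (X : {set {set T}}) (Y : {set {set U}}) (H : blockbij f X Y).
Fact blk_ex (D : {D : {set U} | D \in Y}) :
  exists C : {C : {set T} | C \in X}, pimset f (val C) == val D.
Proof.
have [C CX [e]] := is_bij_surj H.1 (valP D).
by exists (exist _ C CX); apply/eqP.
Qed.
Definition blk D := xchoose (blk_ex D).
Lemma blkP D : pimset f (val (blk D)) = val D.
Proof. by apply/eqP; apply: (xchooseP (blk_ex D)). Qed.
Lemma blkE D (C : {C : {set T} | C \in X}) : pimset f (val C) = val D -> C = blk D.
Proof.
move=> e; apply: val_inj; apply: (H.1.1 _ _ (valP C) (valP (blk D))).
by congr Some; rewrite [RHS]blkP; exact: e.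
Qed.
Fact blk_bij D : is_bij f (val (blk D)) (val D).
Proof. by have := H.2 _ (valP (blk D)); rewrite blkP. Qed.
Fact blk_bijective : bijective blk.
Proof.
have imY (C : {C : {set T} | C \in X}) : pimset f (val C) \in Y.
  by have [D DY [->]] := is_bij_fun H.1 (valP C).
exists (fun C => exist _ (pimset f (val C)) (imY C)) => [D|C].
  by apply: val_inj; rewrite /= blkP.
by apply/esym/blkE.
Qed.
Definition ptens_map : {linear ptens X -> ptens Y} :=
  @tmap k _ _ (fun C => p @@ (val C)) (fun D => p @@ (val D)) blk
    (fun D => sp_map p (blk_bij D)) blk_bijective.
Lemma ptens_mapE x :
  ptens_map (tpure x) = tpure (fun D => sp_map p (blk_bij D) (x (blk D))).
Proof. exact: tmapE. Qed.
End Map.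

Lemma sp_map_dep (T U : finType) (X : {set {set T}}) (D : {set U})
  (x : forall C : {C : {set T} | C \in X}, p @@ (val C))
  (C C' : {C : {set T} | C \in X}) (f f' : T -> option U)
  (H : is_bij f (val C) D) (H' : is_bij f' (val C') D) :
  C = C' -> {in val C, f =1 f'} -> sp_map p H (x C) = sp_map p H' (x C').
Proof. by move=> e; case: C' / e H' => H' ff; apply: sp_ext. Qed.

Lemma ptens_map_ext (T U : finType) (f g : T -> option U) X Y
  (Hf : blockbij f X Y) (Hg : blockbij g X Y) :
  {in X, forall C, {in C : {set T}, f =1 g}} -> ptens_map Hf =1 ptens_map Hg.
Proof.
move=> fg; apply: tens_eq => x; rewrite !ptens_mapE; congr tpure.
apply: functional_extensionality_dep => D; apply: sp_map_dep; last exact/fg/valP.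
by apply: blkE; rewrite -(@pimset_ext _ _ f) ?blkP //; apply/fg/valP.
Qed.

Lemma ptens_map_id (T : finType) (X : {set {set T}}) (H : blockbij Some X X) :
  ptens_map H =1 id.
Proof.
apply: (@tens_eq _ _ _ _ _ idfun) => x; rewrite ptens_mapE; congr tpure.
apply: functional_extensionality_dep => D.
rewrite (@sp_map_dep _ _ _ _ x (blk H D) D Some Some (blk_bij H D) (is_bij_id _)) //.
  exact: sp_id.
by apply/esym/blkE; rewrite pimset_id.
Qed.

Lemma ptens_map_comp (T U W : finType) (f : T -> option U) (g : U -> option W) X Y Z
  (Hf : blockbij f X Y) (Hg : blockbij g Y Z) (Hgf : blockbij (pcomp g f) X Z) :
  ptens_map Hgf =1 ptens_map Hg \o ptens_map Hf.
Proof.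
apply: (@tens_eq _ _ _ _ _ (ptens_map Hg \o ptens_map Hf)) => x.
rewrite -[RHS]/(ptens_map Hg (ptens_map Hf (tpure x))) !ptens_mapE; congr tpure.
apply: functional_extensionality_dep => E.
have H := is_bij_comp (blk_bij Hf (blk Hg E)) (blk_bij Hg E).
rewrite -[RHS](sp_comp (blk_bij Hf (blk Hg E)) (blk_bij Hg E) H).
apply: sp_map_dep => //; apply/esym/blkE.
by rewrite pimset_comp !blkP.
Qed.
End BlockTensor.

Variables (b p : species k).

Definition subst_term (T : finType) (X : {set {set T}}) : lmodType k :=
  b @@ X \ox ptens p X.
Definition subst_term_map (T U : finType) (f : T -> option U) X Y (H : blockbij f X Y) :
  {linear subst_term X -> subst_term Y} :=
  tmap2 (sp_map b H.1) (ptens_map p H).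

Definition parts (T : finType) (A : {set T}) := {X : {set {set T}} | partition X A}.

Definition subst_obj (T : finType) (A : {set T}) : lmodType k :=
  dsum (fun X : parts A => subst_term (val X)).

Definition comap (T U : finType) (f : T -> option U) A B (Hf : is_bij f A B)
  (Y : parts B) : parts A :=
  exist _ (comap_part f A (val Y)) (comap_partition Hf (valP Y)).

Section Map.
Variables (T U : finType) (f : T -> option U) (A : {set T}) (B : {set U}).
Variable Hf : is_bij f A B.
Definition subst_map_fun (w : subst_obj A) : subst_obj B :=
  fun Y => subst_term_map (comap_blockbij Hf (valP Y)) (w (comap Hf Y)).
Fact subst_map_linear : linear subst_map_fun.
Proof.
move=> a u v; apply: functional_extensionality_dep => Y.
exact: linearP.
Qed.
Definition subst_map : {linear subst_obj A -> subst_obj B} := mklin subst_map_linear.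
End Map.

Lemma subst_term_dep (T U : finType) (A : {set T}) (X X' : parts A)
  (w : subst_obj A) (Y : {set {set U}}) (f f' : T -> option U)
  (H : blockbij f (val X) Y) (H' : blockbij f' (val X') Y) :
  X = X' -> {in A, f =1 f'} ->
  subst_term_map H (w X) = subst_term_map H' (w X').
Proof.
move=> e; case: X' / e H' => H' ff; move: (w X).
have fC : {in val X, forall C, {in C : {set T}, f =1 f'}}.
  by move=> C CX x xC; apply/ff/(subsetP (partS (valP X) CX)).
apply: tens2_eq => v z; rewrite !lift2E; congr (_ \ot _); last exact: ptens_map_ext.
by apply: sp_ext => C CX; congr Some; apply/pimset_ext/fC.
Qed.

Fact subst_ext (T U : finType) (f g : T -> option U) A B
    (Hf : is_bij f A B) (Hg : is_bij g A B) :
    {in A, f =1 g} -> subst_map Hf =1 subst_map Hg.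
Proof.
move=> fg w; apply: functional_extensionality_dep => Y.
apply: (subst_term_dep (X := comap Hf Y) (X' := comap Hg Y)) => //.
by apply: val_inj; apply: comap_ext.
Qed.

Fact subst_id (T : finType) (A : {set T}) (H : is_bij Some A A) :
    subst_map H =1 id.
Proof.
move=> w; apply: functional_extensionality_dep => Y.
have HY : blockbij Some (val Y) (val Y).
  exact: blockbij_id.
rewrite [LHS](_ : _ = subst_term_map HY (w Y)).
  move: (w Y); apply: (@tens2_eq _ _ _ _ _ idfun) => v z; rewrite lift2E.
  congr (_ \ot _); last exact: ptens_map_id.
  rewrite -[RHS](sp_id (is_bij_id (val Y))); apply: sp_ext => C CY.
  by rewrite /pblock_map pimset_id.
apply: (subst_term_dep (X := comap H Y) (X' := Y)) => //.
by apply: val_inj; apply: comap_id (valP Y).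
Qed.

Fact subst_comp (T U W : finType) (f : T -> option U) (g : U -> option W)
    A B C (Hf : is_bij f A B) (Hg : is_bij g B C) (Hgf : is_bij (pcomp g f) A C) :
    subst_map Hgf =1 subst_map Hg \o subst_map Hf.
Proof.
move=> w; apply: functional_extensionality_dep => Z.
have Hb := comap_blockbij Hg (valP Z).
have Ha := comap_blockbij Hf (valP (comap Hg Z)).
have HZ : blockbij (pcomp g f) (val (comap Hf (comap Hg Z))) (val Z).
  split=> [|D DX]; last first.
    by rewrite pimset_comp; apply: is_bij_comp (Ha.2 _ DX) _; apply: (Hb.2);
       have [E EY [->]] := is_bij_fun Ha.1 DX.
  have [HI HE] := is_bij_comp Ha.1 Hb.1.
  have E : pblock_map (pcomp g f) =1 pcomp (pblock_map g) (pblock_map f).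
    by move=> D; rewrite /pblock_map pimset_comp.
  split; last by rewrite (eq_imset _ E).
  by move=> D D' DX D'X; rewrite !E; apply: HI.
pose Ma := subst_term_map (comap_blockbij Hf (valP (comap Hg Z))).
pose Mb := subst_term_map (comap_blockbij Hg (valP Z)).
rewrite [LHS](_ : _ = subst_term_map HZ (w (comap Hf (comap Hg Z)))).
  rewrite -[RHS]/(Mb (Ma (w (comap Hf (comap Hg Z))))).
  move: (w _); apply: (@tens2_eq _ _ _ _ _ (Mb \o Ma)) => v z.
  rewrite -[RHS]/(Mb (Ma (v \ot z))) !lift2E.
  congr (_ \ot _); last exact: ptens_map_comp.
  have H := is_bij_comp Ha.1 Hb.1.
  rewrite -[RHS](sp_comp (comap_blockbij Hf (valP (comap Hg Z))).1 (comap_blockbij Hg (valP Z)).1 H).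
  by apply: sp_ext => D DX; rewrite /pblock_map pimset_comp.
apply: (subst_term_dep (X := comap Hgf Z) (X' := comap Hf (comap Hg Z))) => //.
by apply: val_inj; apply: comap_comp Hf.
Qed.

Definition subst : species k := Species subst_ext subst_id subst_comp.

Definition subst_inj (T : finType) (A : {set T}) (X : {set {set T}})
  (HX : partition X A) (t : b @@ X \ox ptens p X) : subst @@ A :=
  @dinj k _ (fun Y : parts A => subst_term (val Y)) (exist _ X HX) t.
End Substitution.

Section Bimonoids.
Variable k : fieldType.

(* Bimonoids for the Cauchy product with the trivial braiding, given by their
   components.  The unit species lives on empty sets only, so bone and bcounit
   have one component for each empty set (set0 : {set T}). *)
Record bimonoid (h : species k) := Bimonoid {
  bmu : forall (T : finType) (I S R : {set T}),
    decomp I S R -> {linear h @@ S \ox h @@ R -> h @@ I};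
  bdelta : forall (T : finType) (I S R : {set T}),
    decomp I S R -> {linear h @@ I -> h @@ S \ox h @@ R};
  bone : forall T : finType, h @@ (set0 : {set T});
  bcounit : forall T : finType, {linear h @@ (set0 : {set T}) -> k^o};
  bmu_nat : forall (T U : finType) (f : T -> option U)
    (I S R : {set T}) (I' S' R' : {set U})
    (d : decomp I S R) (d' : decomp I' S' R')
    (HI : is_bij f I I') (HS : is_bij f S S') (HR : is_bij f R R') t,
    sp_map h HI (bmu d t) = bmu d' (tmap2 (sp_map h HS) (sp_map h HR) t);
  bdelta_nat : forall (T U : finType) (f : T -> option U)
    (I S R : {set T}) (I' S' R' : {set U})
    (d : decomp I S R) (d' : decomp I' S' R')
    (HI : is_bij f I I') (HS : is_bij f S S') (HR : is_bij f R R') x,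
    bdelta d' (sp_map h HI x) = tmap2 (sp_map h HS) (sp_map h HR) (bdelta d x);
  bone_nat : forall (T U : finType) (f : T -> option U)
    (H : is_bij f (set0 : {set T}) (set0 : {set U})),
    sp_map h H (bone T) = bone U;
  bcounit_nat : forall (T U : finType) (f : T -> option U)
    (H : is_bij f (set0 : {set T}) (set0 : {set U})) x,
    bcounit U (sp_map h H x) = bcounit T x;
  bmuA : forall (T : finType) (I S12 S23 S1 S2 S3 : {set T})
    (d12 : decomp S12 S1 S2) (d12_3 : decomp I S12 S3)
    (d23 : decomp S23 S2 S3) (d1_23 : decomp I S1 S23) t,
    bmu d12_3 (tmap2 (bmu d12) idfun t) =
    bmu d1_23 (tmap2 idfun (bmu d23) (tassoc _ _ _ t));
  bmu1l : forall (T : finType) (I : {set T}) (d : decomp I set0 I) x,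
    bmu d (bone T \ot x) = x;
  bmu1r : forall (T : finType) (I : {set T}) (d : decomp I I set0) x,
    bmu d (x \ot bone T) = x;
  bdeltaA : forall (T : finType) (I S12 S23 S1 S2 S3 : {set T})
    (d12 : decomp S12 S1 S2) (d12_3 : decomp I S12 S3)
    (d23 : decomp S23 S2 S3) (d1_23 : decomp I S1 S23) x,
    tassoc _ _ _ (tmap2 (bdelta d12) idfun (bdelta d12_3 x)) =
    tmap2 idfun (bdelta d23) (bdelta d1_23 x);
  bcounitl : forall (T : finType) (I : {set T}) (d : decomp I set0 I) x,
    tlunit _ (tmap2 (bcounit T) idfun (bdelta d x)) = x;
  bcounitr : forall (T : finType) (I : {set T}) (d : decomp I I set0) x,
    trunit _ (tmap2 idfun (bcounit T) (bdelta d x)) = x;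
  (* S = A |_| B and R = C |_| D, while S' = A |_| C and R' = B |_| D *)
  bmu_delta : forall (T : finType) (I S R S' R' A B C D : {set T})
    (d : decomp I S R) (d' : decomp I S' R')
    (dS : decomp S A B) (dR : decomp R C D)
    (dS' : decomp S' A C) (dR' : decomp R' B D) t,
    bdelta d' (bmu d t) =
    tmap2 (bmu dS') (bmu dR')
      (tmid _ _ _ _ (tmap2 (bdelta dS) (bdelta dR) t));
  bdelta_one : forall (T : finType) (d : decomp (set0 : {set T}) set0 set0),
    bdelta d (bone T) = bone T \ot bone T;
  bcounit_mu : forall (T : finType) (d : decomp (set0 : {set T}) set0 set0) x y,
    bcounit T (bmu d (x \ot y)) = bcounit T x * bcounit T y :> k;
  bcounit_one : forall T : finType, bcounit T (bone T) = 1 :> k }.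

Definition connected (h : species k) : Prop :=
  forall T : finType,
  exists f : {linear h @@ (set0 : {set T}) -> k^o}, bijective f.

Definition cocommutative (h : species k) (H : bimonoid h) : Prop :=
  forall (T : finType) (I S R : {set T}) (d : decomp I S R) (d' : decomp I R S) x,
  tswap _ _ (bdelta H d x) = bdelta H d' x.

Record pos_comonoid := PosComonoid {
  pc_sp :> species k;
  pc_pos : forall (T : finType) (x : pc_sp @@ (set0 : {set T})), x = 0;
  pc_delta : forall (T : finType) (I S R : {set T}),
    decomp I S R -> S != set0 -> R != set0 ->
    {linear pc_sp @@ I -> pc_sp @@ S \ox pc_sp @@ R};
  pc_nat : forall (T U : finType) (f : T -> option U)
    (I S R : {set T}) (I' S' R' : {set U})
    (d : decomp I S R) (S0 : S != set0) (R0 : R != set0)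
    (d' : decomp I' S' R') (S'0 : S' != set0) (R'0 : R' != set0)
    (HI : is_bij f I I') (HS : is_bij f S S') (HR : is_bij f R R') x,
    pc_delta d' S'0 R'0 (sp_map pc_sp HI x) =
    tmap2 (sp_map pc_sp HS) (sp_map pc_sp HR) (pc_delta d S0 R0 x);
  pc_deltaA : forall (T : finType) (I S12 S23 S1 S2 S3 : {set T})
    (d12 : decomp S12 S1 S2) (d12_3 : decomp I S12 S3)
    (d23 : decomp S23 S2 S3) (d1_23 : decomp I S1 S23)
    (n1 : S1 != set0) (n2 : S2 != set0) (n3 : S3 != set0)
    (n12 : S12 != set0) (n23 : S23 != set0) x,
    tassoc _ _ _ (tmap2 (pc_delta d12 n1 n2) idfun (pc_delta d12_3 n12 n3 x)) =
    tmap2 idfun (pc_delta d23 n2 n3) (pc_delta d1_23 n1 n23 x) }.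

Record linearized (B : set_species) (H : bimonoid (lin k B)) := Linearized {
  lmu : forall (T : finType) (I S R : {set T}),
    decomp I S R -> B @@s S * B @@s R -> B @@s I;
  ldelta : forall (T : finType) (I S R : {set T}),
    decomp I S R -> B @@s I -> B @@s S * B @@s R;
  lmuE : forall (T : finType) (I S R : {set T}) (d : decomp I S R) x y,
    bmu H d (basis k x \ot basis k y) = basis k (lmu d (x, y));
  ldeltaE : forall (T : finType) (I S R : {set T}) (d : decomp I S R) z,
    bdelta H d (basis k z) = basis k (ldelta d z).1 \ot basis k (ldelta d z).2 }.

Fact decomp_setD (T : finType) (I U : {set T}) : U \subset I -> decomp I U (I :\: U).
Proof.
move=> /subsetP UI; rewrite /decomp -setI_eq0; apply/andP; split; apply/eqP/setP => x.
  by rewrite !inE; have := UI x; case: (x \in U) => //= ->.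
by rewrite !inE; case: (x \in U).
Qed.

(* For cocommutative b the coproduct of e in B[I] is e|_S (x) e|_R, so that e|_U
   is the first component of its coproduct along I = U |_| (I :\: U). *)
Definition restr (B : set_species) (H : bimonoid (lin k B)) (L : linearized H)
  (T : finType) (I U : {set T}) (UI : U \subset I) (b : B @@s I) : B @@s U :=
  (ldelta L (decomp_setD UI) b).1.

Definition blocks_meet (T : finType) (X : {set {set T}}) (S : {set T}) :
  {set {set T}} := [set C in X | C :&: S != set0].
Definition blocks_trace (T : finType) (X : {set {set T}}) (S : {set T}) :
  {set {set T}} := [set C :&: S | C in blocks_meet X S].

Lemma blocks_meet_sub (T : finType) (X : {set {set T}}) S : blocks_meet X S \subset X.
Proof. by apply/subsetP => C; rewrite inE => /andP[]. Qed.

Lemma trace_bij (T : finType) (X : {set {set T}}) (I S : {set T}) :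
  partition X I ->
  is_bij (fun C => Some (C :&: S)) (blocks_meet X S) (blocks_trace X S).
Proof.
case/and3P=> _ /trivIsetP tX _; apply: is_bijI => [C D|C CX|_ /imsetP[C CX ->]].
- rewrite !inE => /andP[CX C0] /andP[DX _] [e]; apply/eqP; apply: contraR C0 => CD.
  have := tX _ _ CX DX CD; rewrite -setI_eq0 => /eqP CD0.
  by rewrite -[C :&: S]setIid {2}e setIACA CD0 set0I.
- by exists (C :&: S) => //; apply: imset_f.
- by exists C.
Qed.

Lemma trace_partition (T : finType) (X : {set {set T}}) (I S : {set T}) :
  partition X I -> S \subset I -> partition (blocks_trace X S) S.
Proof.
case/and3P=> /eqP cX /trivIsetP tX _ /subsetP SI; apply/and3P; split.
- rewrite eqEsubset; apply/andP; split.
    by apply/bigcupsP => _ /imsetP[C _ ->]; apply: subsetIr.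
  apply/subsetP => x xS; have : x \in cover X by rewrite cX SI.
  case/bigcupP => C CX xC; apply/bigcupP; exists (C :&: S); last by rewrite inE xC.
  apply: imset_f; rewrite inE CX; apply/set0Pn; exists x; by rewrite inE xC.
- apply/trivIsetP => _ _ /imsetP[C CX ->] /imsetP[D DX ->] ne.
  have {ne} CD : C != D by apply: contra ne => /eqP ->.
  move: CX DX; rewrite !inE => /andP[CX _] /andP[DX _].
  have := tX _ _ CX DX CD; rewrite -!setI_eq0 setIACA => /eqP ->.
  by rewrite set0I.
- by apply/imsetP => -[C]; rewrite inE => /andP[_ C0] e; rewrite -e eqxx in C0.
Qed.

(* e |-> the restriction of e to X^S = blocks_meet X S, transported along the
   bijection C |-> C :&: S to X_S = blocks_trace X S. *)
Definition down (B : set_species) (H : bimonoid (lin k B)) (L : linearized H)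
  (T : finType) (X : {set {set T}}) (I S : {set T}) (HX : partition X I)
  (b : B @@s X) : B @@s (blocks_trace X S) :=
  ss_map (trace_bij S HX) (restr L (blocks_meet_sub X S) b).

Fact decompl (T : finType) (I S R : {set T}) : decomp I S R -> S \subset I.
Proof. by case/andP=> /eqP <- _; apply: subsetUl. Qed.
Fact decompr (T : finType) (I S R : {set T}) : decomp I S R -> R \subset I.
Proof. by case/andP=> /eqP <- _; apply: subsetUr. Qed.

Lemma partition_union (T : finType) (I S R : {set T}) (X Y : {set {set T}}) :
  decomp I S R -> partition X S -> partition Y R -> partition (X :|: Y) I.
Proof.
case/andP=> /eqP <- dSR /and3P[/eqP cX /trivIsetP tX X0] /and3P[/eqP cY /trivIsetP tY Y0].
have dXY C D : C \in X -> D \in Y -> [disjoint C & D].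
  move=> CX DY; apply: disjointWl (disjointWr _ dSR).
    by rewrite -cX; apply: bigcup_sup.
  by rewrite -cY; apply: bigcup_sup.
apply/and3P; split.
- by rewrite /cover bigcup_setU -cX -cY.
- apply/trivIsetP => C D; rewrite !inE => /orP[CX|CY] /orP[DX|DY] ne; first exact: tX.
  + exact: dXY.
  + by rewrite disjoint_sym; apply: dXY.
  + exact: tY.
- by rewrite inE negb_or X0.
Qed.

Lemma decomp_union (T : finType) (I S R : {set T}) (X Y : {set {set T}}) :
  decomp I S R -> partition X S -> partition Y R -> decomp (X :|: Y) X Y.
Proof.
case/andP=> _ dSR HX HY; rewrite /decomp eqxx /= -setI_eq0; apply/eqP/setP => C.
rewrite !inE; apply/negP => /andP[CX CY].
have: C != set0 by apply: contraTneq CX => ->; have /and3P[] := HX.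
case/set0Pn => x xC; have /pred0P/(_ x)/negP := dSR; case; rewrite /=.
by rewrite (subsetP (partS HX CX)) // (subsetP (partS HY CY)).
Qed.

Lemma partition_set0 (T : finType) : partition (set0 : {set {set T}}) set0.
Proof.
apply/and3P; split; rewrite ?inE //; first by rewrite /cover big_set0.
by apply/trivIsetP => C D; rewrite inE.
Qed.

(* Sweedler notation for p_(X) |-> \sum p_(X_S) (x) p_(X_R): the families u, v
   record, for each block C of X, an expansion \sum_j u_j (x) v_j of the
   coproduct of x_C, with u_j in p[C :&: S] and v_j in p[C :&: R]; a block
   contained in S (or in R) contributes x_C itself, again written as a sum.
   Terms may be zero, so that one index set J serves all blocks. *)
Definition sweedler (p : pos_comonoid) (T : finType) (S R : {set T})
  (X : {set {set T}}) (x : forall C : {set T}, p @@ C)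
  (J : finType) (u v : forall C : {set T}, J -> p @@ C) : Prop :=
  forall C, C \in X ->
  [/\ forall (d : decomp C (C :&: S) (C :&: R))
        (S0 : C :&: S != set0) (R0 : C :&: R != set0),
        pc_delta p d S0 R0 (x C) = \sum_(j : J) u (C :&: S) j \ot v (C :&: R) j,
      C \subset S -> x C = \sum_(j : J) u C j
    & C \subset R -> x C = \sum_(j : J) v C j].

(* The family of those u_D (resp. v_D) selected by phi, one term for each block
   of X; D is a nonempty trace of exactly one block. *)
Definition sweedler_pick (p : species k) (T : finType) (X : {set {set T}}) (J : finType)
  (u : forall C : {set T}, J -> p @@ C)
  (phi : {ffun {C : {set T} | C \in X} -> J}) : forall D : {set T}, p @@ D :=
  fun D => if [pick C : {C : {set T} | C \in X} | D \subset val C] is Some C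
           then u D (phi C) else 0.
End Bimonoids.

Section SweedlerExists.
Variable k : fieldType.

Lemma tpure2_0 (V W : lmodType k) (v : V) : v \ot (0 : W) = 0.
Proof. exact: (raddf0 (mklin (@tpure2r k V W v))). Qed.

Lemma tens2_sum (V W : lmodType k) (t : V \ox W) :
  exists s : seq (V * W), t = \sum_(i <- s) i.1 \ot i.2.
Proof.
move: t; apply: tens2_ind => [a _ _ [s ->] [s' ->]|v w].
  exists ([seq (a *: i.1, i.2) | i <- s] ++ s').
  rewrite big_cat big_map /= scaler_sumr; congr (_ + _); apply: eq_bigr => i _.
  exact/esym/(linearZ_LR (mklin (@tpure2l k V W i.2))).
by exists [:: (v, w)]; rewrite big_seq1.
Qed.

Lemma sweedler_exists (p : pos_comonoid k) (T : finType) (I S R : {set T})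
  (X : {set {set T}}) (x : forall C : {set T}, p @@ C) :
  decomp I S R -> partition X I ->
  exists (J : finType) (u v : forall C : {set T}, J -> p @@ C), sweedler S R X x u v.
Proof.
move=> dI HX; have [_ /trivIsetP tX X0] := and3P HX.
have same (C D : {set T}) y : C \in X -> D \in X -> y \in C -> y \in D -> C = D.
  move=> CX DX yC yD; apply/eqP; apply: contraT => /(tX _ _ CX DX)/pred0P/(_ y).
  by rewrite /= yC yD.
have Xn0 C : C \in X -> exists y, y \in C.
  by move=> CX; apply/set0Pn; apply: contraNneq X0 => <-.
have ex_s (C : {set T}) : exists s : seq (p @@ (C :&: S) * p @@ (C :&: R)),
  forall d S0 R0, pc_delta p d S0 R0 (x C) = \sum_(i <- s) i.1 \ot i.2.
  case: (pselect (decomp C (C :&: S) (C :&: R) /\ C :&: S != set0 /\ C :&: R != set0)).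
    case=> d [S0 R0]; have [s Es] := tens2_sum (pc_delta p d S0 R0 (x C)).
    exists s => d' S0' R0'.
    by rewrite (bool_irrelevance d' d) (bool_irrelevance S0' S0) (bool_irrelevance R0' R0).
  by move=> n; exists [::] => d S0 R0; case: n.
pose s C := projT1 (cid (ex_s C)).
have sP C d S0 R0 : pc_delta p d S0 R0 (x C) = \sum_(i <- s C) i.1 \ot i.2.
  by rewrite /s; case: (cid _).
pose N := \max_(C : {set T}) size (s C).
have sN C : (size (s C) <= N.+1)%N by apply/leqW; apply: (leq_bigmax (F := fun D => size (s D))).
have ex_fam (Q : {set T}) (g : forall C : {set T}, 'I_N.+1 -> p @@ (C :&: Q)) :
  exists u : forall C : {set T}, 'I_N.+1 -> p @@ C,
    (forall C, C \in X -> C \subset Q -> forall j, u C j = if j == ord0 then x C else 0) /\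
    (forall C, C \in X -> ~~ (C \subset Q) -> C :&: Q != set0 -> forall j, u (C :&: Q) j = g C j).
  suff H D : exists y : 'I_N.+1 -> p @@ D,
    (D \in X -> D \subset Q -> forall j, y j = if j == ord0 then x D else 0) /\
    (forall C (e : C :&: Q = D), C \in X -> ~~ (C \subset Q) -> D != set0 ->
       forall j, y j = eq_rect _ (fun E => p @@ E : Type) (g C j) _ e).
    exists (fun D => projT1 (cid (H D))); split=> C CX.
      by case: (cid (H C)) => /= y [Hy _]; apply: Hy.
    by case: (cid (H (C :&: Q))) => /= y [_ Hy] CQ C0 j; rewrite (Hy C erefl).
  have [/andP[DX DQ]|nD] := boolP ((D \in X) && (D \subset Q)).
    exists (fun j => if j == ord0 then x D else 0); split=> // C e CX CQ D0.
    have [y yD] := Xn0 _ DX; have yC : y \in C by move: yD; rewrite -e inE => /andP[].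
    by case/negP: CQ; rewrite (same C D y).
  have [[C [e [CX [CQ D0]]]]|n] := pselect (exists C, C :&: Q = D /\ C \in X /\ ~~ (C \subset Q) /\ D != set0).
    subst D; exists (g C); split=> [DX DQ|C' e C'X C'Q _ j]; first by rewrite DX DQ in nD.
    have [y yD] := set0Pn _ D0; have CC : C' = C.
      move: (yD); rewrite -e inE => /andP[yC' _]; apply: (same _ _ y) => //.
      by move: yD; rewrite inE => /andP[].
    by subst C'; rewrite (eq_irrelevance e erefl).
  exists (fun=> 0); split=> [DX DQ|C e CX CQ D0]; first by rewrite DX DQ in nD.
  by case: n; exists C.
have [u [uS uC]] := ex_fam S (fun C j => (nth (0, 0) (s C) j).1).
have [v [vS vC]] := ex_fam R (fun C j => (nth (0, 0) (s C) j).2).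
have disj (C : {set T}) : C :&: S != set0 -> ~~ (C \subset R).
  case/set0Pn=> y; rewrite inE => /andP[yC yS]; apply/negP => /subsetP/(_ y yC) yR.
  by case/andP: dI => _ /pred0P/(_ y); rewrite /= yS yR.
have disj' (C : {set T}) : C :&: R != set0 -> ~~ (C \subset S).
  case/set0Pn=> y; rewrite inE => /andP[yC yS]; apply/negP => /subsetP/(_ y yC) yR.
  by case/andP: dI => _ /pred0P/(_ y); rewrite /= yS yR.
exists 'I_N.+1, u, v => C CX; split=> [d S0 R0|CS|CR].
- pose F j := (nth (0, 0) (s C) j).1 \ot (nth (0, 0) (s C) j).2.
  transitivity (\sum_(j < N.+1) F j); last first.
    by apply: eq_bigr => j _; rewrite uC ?vC // (disj, disj').
  rewrite sP (big_nth (0, 0)) -(big_mkord xpredT F).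
  rewrite [RHS](big_cat_nat (n := size (s C))) //=.
  rewrite [X in _ = _ + X]big_nat_cond [X in _ = _ + X]big1 ?addr0 // => j.
  by rewrite andbT /F => /andP[sj _]; rewrite nth_default //= tpure2_0.
- rewrite (bigD1 ord0) //= big1 ?addr0 => [|j j0]; rewrite uS //.
  by rewrite (negbTE j0).
- rewrite (bigD1 ord0) //= big1 ?addr0 => [|j j0]; rewrite vS //.
  by rewrite (negbTE j0).
Qed.
End SweedlerExists.

(* Main.v *)
From HB Require Import structures.
From mathcomp Require Import all_boot all_order all_algebra.
From mathcomp Require Import boolp freeg.
Require Import Defs.
Set Implicit Arguments.
Unset Strict Implicit.
Unset Printing Implicit Defensive.
Import GRing.Theory.
Local Open Scope ring_scope.

(** The product of b o p juxtaposes two decorated partitions and multiplies in b;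
    its axioms reduce to those of b by [subst_mu_pure].  The work lies in the
    coproduct, which cuts every block of a partition along S |_| R and restricts
    the structure on the set of blocks.

    On the side of b everything follows from three properties of restriction,
    which are the first tensor factors of axioms of b: it is transitive, natural
    and multiplicative ([restr_comp], [restr_nat], [restr_mu]).

    On the side of p the difficulty is that a block contained in S or in R is not
    cut at all.  It is removed by adjoining a group-like unit: [block_space] is the
    direct sum of k and of all the p[C], and [block_delta] cuts a block into two
    pieces of which any may be empty, an empty piece becoming the unit.  This
    operation is coassociative without exception ([block_deltaA]).

    The two sides are put together as follows.  Given X |- I, an element e of B[X]
    and one vector a_C of [block_space] for each block C, the trace on a subset S
    is the element [trace_tensor] of (b o p)[S] made of the restriction of e to the
    traces C :&: S and of the components of a_C in p[C :&: S]; blocks that miss S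
    contribute the scalar part of a_C.  It is multilinear in a.  Two multilinear
    functions g and h of families in P and Q have a tensor product [mten g h], the
    unique multilinear function of families in P (x) Q which sends the pure tensors
    u_C (x) v_C to g(u) (x) h(v).  The coproduct of a trace is then
    [mten] of the traces on the two sides, applied to the cut vectors a_C
    ([subst_delta_trace]).

    Hence each law of the coproduct compares two multilinear functions of families,
    which agree as soon as they agree on pure tensors ([mlin_eq]), and reduces to a
    law about one block: coassociativity to [block_deltaA], naturality to
    [block_map_delta], and the counit laws to the value of [block_delta] with one
    empty piece.  Compatibility with the product holds because traces commute with
    products ([trace_tensor_mu]) and each block is cut in the same way inside a
    factor and inside the product.  The Sweedler form of the coproduct is the
    expansion of a multilinear function of sums ([mlin_sum]). *)

Arguments tmap2 : simpl never.
Arguments tassoc : simpl never.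
Arguments tmid : simpl never.

Lemma disjointUl (K : finType) (A B C : {set K}) :
  [disjoint A :|: B & C] = [disjoint A & C] && [disjoint B & C].
Proof. by rewrite -!setI_eq0 setIUl setU_eq0. Qed.
Lemma disjointUr (K : finType) (A B C : {set K}) :
  [disjoint A & B :|: C] = [disjoint A & B] && [disjoint A & C].
Proof. by rewrite -!setI_eq0 setIUr setU_eq0. Qed.

(** * Linear maps between tensor products *)
Section LinearMaps.
Variable k : fieldType.

Lemma linear_eq (U V : lmodType k) (f g : U -> V) :
  linear f -> f =1 g -> linear g.
Proof. by move=> Hf fg a u v; rewrite -!fg Hf. Qed.

Lemma linear_id (V : lmodType k) : linear (fun v : V => v).
Proof. by []. Qed.
Lemma linear_comp (U V W : lmodType k) (f : {linear V -> W}) (F : U -> V) :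
  linear F -> linear (fun u => f (F u)).
Proof. by move=> HF a u v; rewrite HF linearP. Qed.
Lemma linear_otl (U V W : lmodType k) (w : W) (F : U -> V) :
  linear F -> linear (fun u => F u \ot w).
Proof. by move=> HF a u v; rewrite HF tpure2l. Qed.
Lemma linear_otr (U V W : lmodType k) (v : V) (F : U -> W) :
  linear F -> linear (fun u => v \ot F u).
Proof. by move=> HF a u u'; rewrite HF tpure2r. Qed.

Lemma tens2_eq_linear (V W Z : lmodType k) (F G : V \ox W -> Z) :
  linear F -> linear G -> (forall v w, F (v \ot w) = G (v \ot w)) -> F =1 G.
Proof. by move=> HF HG; apply: (@tens2_eq k V W Z (mklin HF) (mklin HG)). Qed.

Lemma lift2_ext (V W Z : lmodType k) (f g : V -> W -> Z) (Hf : bilin f) (Hg : bilin g) :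
  (forall v w, f v w = g v w) -> lift2 Hf =1 lift2 Hg.
Proof. by move=> fg; apply: tens2_eq => v w; rewrite !lift2E. Qed.

(** Tensors are combinations of pure ones, where the dependence on u is that of f. *)
Lemma lift2_linear_param (V W Z U : lmodType k) (f : U -> V -> W -> Z)
  (Hf : forall u, bilin (f u)) :
  (forall v w, linear (fun u => f u v w)) ->
  forall t, linear (fun u => lift2 (Hf u) t).
Proof.
move=> fL t a u u'; move: t; apply: tens2_ind => [c x y Hx Hy|v w].
  by rewrite !(linearP (lift2 _)) Hx Hy lin_comb.
by rewrite !lift2E; exact: fL.
Qed.

Lemma linear_at0 (U V : lmodType k) (f : U -> V) : linear f -> f 0 = 0.
Proof. by move=> Hf; exact: (raddf0 (mklin Hf)). Qed.

Lemma linear_atZ (U V : lmodType k) (f : U -> V) a u : linear f -> f (a *: u) = a *: f u.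
Proof. by move=> Hf; exact: (linearZ_LR (mklin Hf)). Qed.

Lemma linear_big_sum (U V : lmodType k) (f : U -> V) (I : Type) (r : seq I) (P : pred I) F :
  linear f -> f (\sum_(i <- r | P i) F i) = \sum_(i <- r | P i) f (F i).
Proof. by move=> Hf; exact: (raddf_sum (mklin Hf)). Qed.

Lemma tmap2E (V V' W W' : lmodType k) (f : {linear V -> V'}) (g : {linear W -> W'}) v w :
  tmap2 f g (v \ot w) = f v \ot g w.
Proof. exact: lift2E. Qed.
Lemma tmap2_idl (V W W' : lmodType k) (g : {linear W -> W'}) (v : V) w :
  tmap2 idfun g (v \ot w) = v \ot g w.
Proof. exact: tmap2E. Qed.
Lemma tmap2_idr (V V' W : lmodType k) (f : {linear V -> V'}) v (w : W) :
  tmap2 f idfun (v \ot w) = f v \ot w.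
Proof. exact: tmap2E. Qed.
Lemma tassocE (V W Z : lmodType k) (v : V) (w : W) (z : Z) :
  tassoc _ _ _ ((v \ot w) \ot z) = v \ot (w \ot z).
Proof. by rewrite /tassoc !lift2E. Qed.
Lemma tmidE (V1 V2 W1 W2 : lmodType k) (v1 : V1) (v2 : V2) (w1 : W1) (w2 : W2) :
  tmid _ _ _ _ ((v1 \ot v2) \ot (w1 \ot w2)) = (v1 \ot w1) \ot (v2 \ot w2).
Proof. by rewrite /tmid !lift2E. Qed.
Lemma tswapE (V W : lmodType k) (v : V) (w : W) : tswap _ _ (v \ot w) = w \ot v.
Proof. exact: lift2E. Qed.
Lemma tlunitE (V : lmodType k) (a : k^o) (v : V) : tlunit V (a \ot v) = (a : k) *: v.
Proof. exact: lift2E. Qed.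
Lemma trunitE (V : lmodType k) (a : k^o) (v : V) : trunit V (v \ot a) = (a : k) *: v.
Proof. by rewrite -[LHS]/(tlunit V (tswap _ _ (v \ot a))) tswapE tlunitE. Qed.
End LinearMaps.

(** Follows the shape of the function instead of rewriting with [linearP], which
    would unfold the quotients by which tensor products are defined. *)
Ltac prove_linear := repeat lazymatch goal with
  | |- linear (fun u => u) => exact: linear_id
  | |- linear (fun u => _ \ot _) => first [apply: linear_otl | apply: linear_otr]
  | |- linear (tpure2 _) => exact: tpure2r
  | |- linear id => exact: linear_id
  | |- linear (fun u => _) => apply: linear_comp
  | |- _ => exact: linearP
  end.

(** * Multilinear functions of families of vectors *)
Section Multilinear.
Variables (k : fieldType) (K : finType).

Definition upd (P : Type) (a : K -> P) (i : K) (u : P) : K -> P :=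
  fun j => if j == i then u else a j.

Lemma upd_id P (a : K -> P) i : upd a i (a i) = a.
Proof. by apply/funext => j; rewrite /upd; case: eqP => // ->. Qed.

Lemma upd_C P (a : K -> P) i j u v : i != j ->
  upd (upd a i u) j v = upd (upd a j v) i u.
Proof.
move=> ij; apply/funext => l; rewrite /upd; case: (eqVneq l j) => // ->.
by rewrite eq_sym (negbTE ij).
Qed.

(** Families are indexed by the whole of K although g only sees their coordinates
    in X: the families over all the sets X of blocks then have one type, and
    uniting or cutting blocks needs no transport. *)
Definition mlin (P Z : lmodType k) (X : {set K}) (g : (K -> P) -> Z) : Prop :=
  (forall a a', {in X, a =1 a'} -> g a = g a') /\
  (forall a i, i \in X -> linear (fun u => g (upd a i u))).

Lemma mlin_lin (P Z Z' : lmodType k) X (g : (K -> P) -> Z) (h : Z -> Z') :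
  linear h -> mlin X g -> mlin X (fun a => h (g a)).
Proof.
move=> hL [gE gL]; split=> [a a' aa'|a i iX c u v]; first by rewrite (gE a a').
by rewrite gL // hL.
Qed.

Lemma mlin_comp (P Q Z : lmodType k) X (g : (K -> P) -> Z) (h : K -> {linear Q -> P}) :
  mlin X g -> mlin X (fun a : K -> Q => g (fun i => h i (a i))).
Proof.
move=> [gE gL]; split=> [a a' aa'|a i iX].
  by apply: gE => j jX /=; rewrite aa'.
have E u : (fun j => h j (upd a i u j)) = upd (fun j => h j (a j)) i (h i u).
  by apply/funext => j; rewrite /upd; case: eqP => // ->.
by move=> c u v; rewrite !E linearP gL.
Qed.

(** Families are reindexed below along bijections of the blocks, along C |-> C :&: S
    and into unions.  All that matters is that each coordinate of a moves exactly
    one coordinate of phi a. *)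
Lemma mlin_pull (K' : finType) (P Z : lmodType k) (X : {set K}) (Y : {set K'})
  (g : (K' -> P) -> Z) (phi : (K -> P) -> K' -> P) :
  (forall (h : K' -> P) h', {in Y, h =1 h'} -> g h = g h') ->
  (forall h j, j \in Y -> linear (fun u => g (fun j' => if j' == j then u else h j'))) ->
  (forall a a', {in X, a =1 a'} -> {in Y, phi a =1 phi a'}) ->
  (forall a i, i \in X -> exists2 j, j \in Y &
     forall u, {in Y, phi (upd a i u) =1 fun j' => if j' == j then u else phi a j'}) ->
  mlin X (fun a => g (phi a)).
Proof.
move=> gE gL phiE phiU; split=> [a a' aa'|a i iX]; first exact/gE/phiE.
have [j jY E] := phiU a i iX.
by move=> c u v; rewrite !(gE _ _ (E _)) gL.
Qed.

Lemma mlin_scale (P Z : lmodType k) X (g : (K -> P) -> Z) (c : K -> k) (a : K -> P) :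
  mlin X g -> g (fun i => c i *: a i) = (\prod_(i in X) c i) *: g a.
Proof.
move=> [gE gL].
have H (s : seq K) : uniq s -> {subset s <= X} ->
    g (fun i => if i \in s then c i *: a i else a i) = (\prod_(i <- s) c i) *: g a.
  elim: s => [_ _|i s IHs /= /andP[iNs us] sX].
    by rewrite big_nil scale1r; apply: gE.
  have iX : i \in X by apply: sX; rewrite inE eqxx.
  rewrite big_cons -scalerA -IHs // => [|j js]; last by apply: sX; rewrite inE js orbT.
  set a' := fun j => if j \in s then _ else _.
  have a'i : a' i = a i by rewrite /a' (negbTE iNs).
  rewrite -[in RHS](upd_id a' i) a'i -(linear_atZ _ _ (gL _ i iX)).
  by apply: gE => j jX; rewrite /upd /a' inE; case: eqP => // ->.
have := H (enum X) (enum_uniq _) _; rewrite big_enum => <- => [|i]; last by rewrite mem_enum.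
by apply: gE => i iX; rewrite mem_enum iX.
Qed.
End Multilinear.

Section MultilinearTensor.
Variables (k : fieldType) (K : finType) (P Q : lmodType k).
Implicit Types (X : {set K}) (Z : lmodType k).

(** The coordinates of a family are made pure one after the other: F and G are
    linear in the coordinate being treated. *)
Lemma mlin_eq X Z (F G : (K -> P \ox Q) -> Z) : mlin X F -> mlin X G ->
  (forall a b, F (fun i => a i \ot b i) = G (fun i => a i \ot b i)) -> F =1 G.
Proof.
move=> [FE FL] [GE GL] FG t.
suff H s : uniq s -> {subset s <= X} -> forall (t : K -> P \ox Q) (a : K -> P) (b : K -> Q),
    {in X, forall i, i \notin s -> t i = a i \ot b i} -> F t = G t.
  apply: (H (enum X) _ _ _ (fun=> 0) (fun=> 0)); rewrite ?enum_uniq // => i.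
    by rewrite mem_enum.
  by move=> iX; rewrite mem_enum iX.
elim: s {t} => [_ _ t a b tE|i s IHs /= /andP[iNs us] sX t a b tE].
  by rewrite (FE t (fun i => a i \ot b i)) ?FG => [|i iX]; rewrite ?tE //;
    apply: GE => j jX; rewrite tE.
have iX : i \in X by apply: sX; rewrite inE eqxx.
rewrite -(upd_id t i); move: (t i); apply: tens2_ind => [c u v Hu Hv|u v].
  by rewrite FL // GL // Hu Hv.
apply: (IHs _ _ _ (upd a i u) (upd b i v)) => // [j js|j jX js].
  by apply: sX; rewrite inE js orbT.
rewrite /upd; case: (eqVneq j i) => // ji.
by apply: tE; rewrite // inE negb_or ji.
Qed.

Section Existence.
Variables (X : {set K}) (Z : lmodType k) (f : (K -> P) -> (K -> Q) -> Z).
Hypothesis fE : forall a a' b b', {in X, a =1 a'} -> {in X, b =1 b'} -> f a b = f a' b'.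
Hypothesis fL : forall a b i, i \in X -> bilin (fun u v => f (upd a i u) (upd b i v)).

(** Pairs of coordinates are turned into tensors one after the other.  At the stage
    s, the function F t a b reads the coordinates in s from t and the others still
    from a and b; being bilinear in each remaining pair, it lifts once more. *)
Lemma mlin_exists : exists2 F : (K -> P \ox Q) -> Z, mlin X F &
  forall a b, F (fun i => a i \ot b i) = f a b.
Proof.
suff [F [FE FL _ FP]] : exists F : (K -> P \ox Q) -> (K -> P) -> (K -> Q) -> Z,
  [/\ forall t t' a a' b b', {in enum X, t =1 t'} ->
        {in [predD X & enum X], a =1 a'} -> {in [predD X & enum X], b =1 b'} ->
        F t a b = F t' a' b',
      forall t a b i, i \in enum X -> linear (fun u => F (upd t i u) a b),
      forall t a b i, i \in X -> i \notin enum X ->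
        bilin (fun u v => F t (upd a i u) (upd b i v))
    & forall a b, F (fun i => a i \ot b i) a b = f a b].
  have nE i : (i \in [predD X & enum X]) = false by rewrite inE mem_enum /= andNb.
  exists (fun t => F t (fun=> 0) (fun=> 0)).
    split=> [t t' tt'|t i iX]; first by apply: FE => // i; rewrite mem_enum => /tt'.
    by apply: FL; rewrite mem_enum.
  by move=> a b; rewrite -FP; apply: FE => // i; rewrite nE.
have : {subset enum X <= X} by move=> i; rewrite mem_enum.
have := enum_uniq X; elim: (enum X) => [_ _|i s IHs /= /andP[iNs us] sX].
  exists (fun _ => f); split=> // [_ _ a a' b b' _ aa' bb'|t a b i iX _]; last exact: fL.
  by apply: fE => i iX; rewrite ?aa' ?bb' // inE.
have [//|j js|F [FE FL FB FP]] := IHs; first by apply: sX; rewrite inE js orbT.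
have iX : i \in X by apply: sX; rewrite inE eqxx.
have updE (R : Type) (a a' : K -> R) u :
    {in [predD X & (i :: s)], a =1 a'} -> {in [predD X & s], upd a i u =1 upd a' i u}.
  move=> aa' j; rewrite inE /= => /andP[js jX]; rewrite /upd; case: (eqVneq j i) => // ji.
  by apply: aa'; rewrite !inE negb_or ji js.
exists (fun t a b => lift2 (FB t a b i iX iNs) (t i)); split.
- move=> t t' a a' b b' tt' aa' bb'; rewrite (tt' i) ?inE ?eqxx //.
  apply: lift2_ext => u v; apply: FE; try exact: updE.
  by move=> j js; apply: tt'; rewrite inE js orbT.
- move=> t a b j; rewrite inE; case: (eqVneq j i) => [-> _|ji /= js].
    apply: (linear_eq (linearP (lift2 (FB t a b i iX iNs)))) => u.
    have -> : upd t i u i = u by rewrite /upd eqxx.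
    apply: lift2_ext => v w; apply: FE => // j' j's.
    by rewrite /upd; case: eqP j's => // ->; rewrite (negbTE iNs).
  have L u v : linear (fun w => F (upd t j w) (upd a i u) (upd b i v)) by exact: FL.
  apply: (linear_eq (lift2_linear_param (fun w => FB (upd t j w) a b i iX iNs) L (t i))).
  by move=> u; have -> : upd t j u i = t i by rewrite /upd eq_sym (negbTE ji).
- move=> t a b j jX; rewrite inE negb_or => /andP[ji js]; split=> w.
    apply: (lift2_linear_param (fun u => FB t (upd a j u) (upd b j w) i iX iNs)) => u v.
    apply: (linear_eq (proj1 (FB t (upd a i u) (upd b i v) j jX js) w)) => w'.
    by rewrite ![upd (upd _ _ _) j _]upd_C // eq_sym.
  apply: (lift2_linear_param (fun u => FB t (upd a j w) (upd b j u) i iX iNs)) => u v.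
  apply: (linear_eq (proj2 (FB t (upd a i u) (upd b i v) j jX js) w)) => w'.
  by rewrite ![upd (upd _ _ _) j _]upd_C // eq_sym.
- by move=> a b; rewrite lift2E !upd_id; exact: FP.
Qed.
End Existence.

Section Tensor.
Variables (X : {set K}) (Z Z' : lmodType k) (g : (K -> P) -> Z) (h : (K -> Q) -> Z').
Hypotheses (Hg : mlin X g) (Hh : mlin X h).

Fact mten_ex : exists F : (K -> P \ox Q) -> Z \ox Z', mlin X F /\
  forall a b, F (fun i => a i \ot b i) = g a \ot h b.
Proof.
have [||F FX FE] := @mlin_exists X _ (fun a b => g a \ot h b); last by exists F.
  by move=> a a' b b' aa' bb'; rewrite (Hg.1 _ _ aa') (Hh.1 _ _ bb').
move=> a b i iX; split=> u c v w; rewrite ?(Hg.2 a i iX) ?(Hh.2 b i iX).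
  exact: tpure2l.
exact: tpure2r.
Qed.
(** The tensor product of g and h, precomposed with the shuffle that separates the
    two factors of a tensor product of copies of P (x) Q. *)
Definition mten : (K -> P \ox Q) -> Z \ox Z' := projT1 (cid mten_ex).
Lemma mten_mlin : mlin X mten. Proof. exact: (projT2 (cid mten_ex)).1. Qed.
Lemma mtenE a b : mten (fun i => a i \ot b i) = g a \ot h b.
Proof. exact: (projT2 (cid mten_ex)).2. Qed.
End Tensor.
End MultilinearTensor.

Section MultilinearSum.
Variables (k : fieldType) (I J : finType) (P Z : lmodType k).

(** Coordinates are expanded one after the other. *)
Lemma mlin_sum (g : (I -> P) -> Z) (F : I -> J -> P) : mlin [set: I] g ->
  g (fun i => \sum_j F i j) = \sum_(phi : {ffun I -> J}) g (fun i => F i (phi i)).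
Proof.
move=> [_ gL].
(* If J is empty, both sides vanish unless I is empty too. *)
have [j0|noJ] := pickP (@predT J); last first.
  have [i0 _|noI] := pickP (@predT I); last first.
    rewrite (big_pred1 (finfun (fun i => False_rect J (notF (esym (noI i)))))).
      by congr g; apply/funext => i; have := noI i.
    by move=> phi; apply/esym/eqP/ffunP => i; have := noI i.
  rewrite big1 => [|phi _]; last by have := noJ (phi i0).
  set a := fun i => _; have a0 : a i0 = 0 by rewrite /a big1 // => j; have := noJ j.
  by rewrite -(upd_id a i0) a0; exact: (linear_at0 (gL a i0 (in_setT i0))).
move=> _.
(* A function phi is only used on s; it takes the dummy value j0 elsewhere, so that
   each choice on s is counted once. *)
pose Pf (s : seq I) := [pred f : {ffun I -> J} | [forall l, (l \in s) || (f l == j0)]].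
suff H s (y : I -> P) : uniq s ->
    g (fun i => if i \in s then \sum_j F i j else y i) =
    \sum_(phi in Pf s) g (fun i => if i \in s then F i (phi i) else y i).
  have := H (enum I) (fun=> 0) (enum_uniq _).
  rewrite (_ : (fun i => _) = (fun i => \sum_j F i j)); last first.
    by apply/funext => i; rewrite mem_enum.
  move=> ->; apply: eq_big => [phi|phi _].
    by apply/forallP => i; rewrite mem_enum inE.
  by congr g; apply/funext => i; rewrite mem_enum.
elim: s y => [|i s IHs] y /= => [_|/andP[/negbTE nis us]].
  rewrite (big_pred1 [ffun=> j0]) // => f.
  apply/forallP/eqP => [Df|-> l]; last by rewrite ffunE eqxx orbT.
  by apply/ffunP => l; rewrite ffunE; apply/eqP/Df.
transitivity (\sum_j g (fun l => if l \in s then \sum_j F l j else upd y i (F i j) l)).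
  set a := fun l => if l \in s then \sum_j F l j else y l.
  have -> : (fun l => if l \in i :: s then \sum_j F l j else y l) = upd a i (\sum_j F i j).
    by apply/funext => l; rewrite /upd /a inE; case: eqP => // ->.
  rewrite (linear_big_sum _ _ _ (gL a i (in_setT i))); apply: eq_bigr => j _; congr g.
  by apply/funext => l; rewrite /upd /a; case: eqP => // ->; rewrite nis.
rewrite [RHS](partition_big (fun f : {ffun I -> J} => f i) predT) //.
pose seti j (f : {ffun I -> J}) := [ffun l => if l == i then j else f l].
apply: eq_bigr => j _; rewrite IHs //.
rewrite [RHS](reindex_onto (seti j) (seti j0)) => [|f /andP[_ /eqP fi]]; last first.
  by apply/ffunP=> l; rewrite !ffunE; case: eqP => // ->.
apply: eq_big => [f|f _]; last first.
  congr g; apply/funext => l; rewrite /upd inE ffunE.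
  by case: eqP => // ->; rewrite nis.
rewrite !ffunE !eqxx andbT !inE; apply/forallP/andP => /= [Pff|[/forallP Pjf /eqP fij0] l].
  split; [apply/forallP | apply/eqP/ffunP] => l; have := Pff l; rewrite !ffunE ?inE.
    by case: (eqVneq l i).
  by case: (eqVneq l i) => //= ->; rewrite nis => /eqP ->.
have := Pjf l; rewrite ffunE inE; case: (eqVneq l i) => //= -> _.
by rewrite -fij0 !ffunE !eqxx orbT.
Qed.
End MultilinearSum.

(** * Tensors over the blocks of a partition *)
Section PureTensors.
Variables (k : fieldType) (p : species k) (T : finType).
Implicit Types (X Y : {set {set T}}) (C D : {set T}).
Local Notation fam := (forall C : {set T}, p @@ C).

Definition upd_fam (x : fam) C (u : p @@ C) : fam :=
  @dfwith _ (fun C : {set T} => p @@ C : Type) x C u.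

Lemma upd_famE (x : fam) C (u : p @@ C) : upd_fam x u C = u.
Proof. exact: dfwith_in. Qed.
Lemma upd_fam_neq (x : fam) C (u : p @@ C) D : D != C -> upd_fam x u D = x D.
Proof. by move=> DC; apply: dfwith_out; rewrite eq_sym. Qed.

(** The analogue of [mlin] for families whose coordinate C lies in p[C]. *)
Definition pmlin X (Z : lmodType k) (F : fam -> Z) : Prop :=
  (forall x y, (forall C, C \in X -> x C = y C) -> F x = F y) /\
  (forall x C, C \in X -> linear (fun u : p @@ C => F (upd_fam x u))).

Lemma ppure_ext X (x y : fam) : (forall C, C \in X -> x C = y C) -> ppure X x = ppure X y.
Proof.
move=> xy; congr tpure; apply: functional_extensionality_dep => -[C CX]; exact: xy.
Qed.

Lemma ppure_pmlin X : pmlin X (ppure X).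
Proof.
split=> [x y|x C CX]; first exact: ppure_ext.
pose C' : {C : {set T} | C \in X} := exist _ C CX.
pose x' (D : {C : {set T} | C \in X}) := x (val D).
apply: (linear_eq (@tpure_multilin k _ _ x' C')) => u; congr tpure.
apply: functional_extensionality_dep => D.
have [e|ne] := eqVneq C' D; first by case: D / e; rewrite dfwith_in upd_famE.
rewrite dfwith_out // upd_fam_neq //; apply: contra ne => /eqP e.
by apply/eqP/val_inj.
Qed.

Definition ext_fam X (x : forall C : {C : {set T} | C \in X}, p @@ (val C)) : fam :=
  fun C => match pselect (C \in X) with
           | left h => x (exist _ C h)
           | right _ => 0
           end.
Lemma ext_famE X (x : forall C : {C : {set T} | C \in X}, p @@ (val C))
  (C : {C : {set T} | C \in X}) :
  ext_fam x (val C) = x C.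
Proof.
case: C => C CX /=; rewrite /ext_fam; case: (pselect _) => [h|//].
by congr (x (exist _ C _)); apply: bool_irrelevance.
Qed.

Lemma tpureE X (x : forall C : {C : {set T} | C \in X}, p @@ (val C)) :
  tpure x = ppure X (ext_fam x).
Proof.
by congr tpure; apply: functional_extensionality_dep => C; rewrite ext_famE.
Qed.

Lemma ptens_eq X (Z : lmodType k) (f g : {linear ptens p X -> Z}) :
  (forall x, f (ppure X x) = g (ppure X x)) -> f =1 g.
Proof. by move=> fg; apply: tens_eq => x; rewrite tpureE. Qed.

Lemma ptens_ind X (R : ptens p X -> Prop) :
  (forall a u v, R u -> R v -> R (a *: u + v)) ->
  (forall x, R (ppure X x)) -> forall t, R t.
Proof.
move=> RL RP; have R0 : R 0.
  by have := RL (-1) _ _ (RP (fun=> 0)) (RP (fun=> 0)); rewrite scaleN1r addNr.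
apply: presented_ind => // x; have := RP (ext_fam x); rewrite -tpureE; exact.
Qed.

Section Lift.
Variables (X : {set {set T}}) (Z : lmodType k) (F : fam -> Z) (HF : pmlin X F).
Fact ptlift_mlin : multilin (fun x : (forall C : {C : {set T} | C \in X}, p @@ (val C)) =>
  F (ext_fam x)).
Proof.
move=> x C; apply: (linear_eq (HF.2 (ext_fam x) (val C) (valP C))) => u.
apply: HF.1 => D DX; rewrite -[D]/(val (exist (fun D => D \in X) D DX)) ext_famE.
move: (exist _ D DX) => {D DX} D.
have [e|ne] := eqVneq C D; first by case: D / e; rewrite dfwith_in upd_famE.
rewrite dfwith_out // upd_fam_neq ?ext_famE //; apply: contra ne => /eqP e.
by apply/eqP/esym/val_inj.
Qed.
Definition ptlift : {linear ptens p X -> Z} := tlift ptlift_mlin.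
Lemma ptliftE x : ptlift (ppure X x) = F x.
Proof.
rewrite [LHS]tliftE; apply: HF.1 => C CX.
by rewrite -[C]/(val (exist (fun D => D \in X) C CX)) ext_famE.
Qed.
End Lift.

Lemma ptlift_param X Y (Z : lmodType k) (F : fam -> fam -> Z)
  (HY : forall x, pmlin Y (F x)) :
  (forall y, pmlin X (F^~ y)) -> forall t, pmlin X (fun x => ptlift (HY x) t).
Proof.
move=> HX t; split=> [x x' xx'|x C CX].
  by move: t; apply: ptens_eq => y; rewrite !ptliftE; apply: (HX y).1.
move=> a u v; move: t; apply: ptens_ind => [c s t Hs Ht|y].
  by rewrite !(linearP (ptlift _)) Hs Ht lin_comb.
by rewrite !ptliftE; apply: (HX y).2.
Qed.

Section Lift2.
Variables (X Y : {set {set T}}) (Z : lmodType k) (F : fam -> fam -> Z).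
Hypotheses (HX : forall y, pmlin X (F^~ y)) (HY : forall x, pmlin Y (F x)).
Fact ptlift2_bilin : bilin (fun (s : ptens p X) (t : ptens p Y) =>
  ptlift (ptlift_param HY HX t) s).
Proof.
split=> [t|s]; first by move=> a u v; exact: linearP.
move=> a t t'; move: s; apply: ptens_ind => [c u v Hu Hv|x].
  by rewrite !(linearP (ptlift _)) Hu Hv lin_comb.
by rewrite !ptliftE linearP.
Qed.
Definition ptlift2 : {linear ptens p X \ox ptens p Y -> Z} := lift2 ptlift2_bilin.
Lemma ptlift2E x y : ptlift2 (ppure X x \ot ppure Y y) = F x y.
Proof. by rewrite /ptlift2 lift2E !ptliftE. Qed.
End Lift2.

Definition glue_fam X (x y : fam) : fam := fun C => if C \in X then x C else y C.

Section Product.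
Variables (X Y : {set {set T}}) (dXY : [disjoint X & Y]).
Fact pmul_pmlinl y : pmlin X (fun x => ppure (X :|: Y) (glue_fam X x y)).
Proof.
split=> [x x' xx'|x C CX].
  by apply: ppure_ext => C _; rewrite /glue_fam; case: ifP => // /xx'.
have CXY : C \in X :|: Y by rewrite inE CX.
apply: (linear_eq ((ppure_pmlin _).2 (glue_fam X x y) C CXY)) => u.
apply: ppure_ext => D _; rewrite /glue_fam; have [->|DC] := eqVneq D C.
  by rewrite CX !upd_famE.
by rewrite !upd_fam_neq.
Qed.
Fact pmul_pmlinr x : pmlin Y (fun y => ppure (X :|: Y) (glue_fam X x y)).
Proof.
split=> [y y' yy'|y C CY].
  by apply: ppure_ext => C; rewrite /glue_fam inE; case: (C \in X) => //= /yy'.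
have CXY : C \in X :|: Y by rewrite inE CY orbT.
apply: (linear_eq ((ppure_pmlin _).2 (glue_fam X x y) C CXY)) => u.
apply: ppure_ext => D _; rewrite /glue_fam; have [->|DC] := eqVneq D C.
  by rewrite (disjointFl dXY CY) !upd_famE.
by rewrite !upd_fam_neq.
Qed.
(** The identification of p(X) (x) p(Y) with p(X |_| Y). *)
Definition pmul : {linear ptens p X \ox ptens p Y -> ptens p (X :|: Y)} :=
  ptlift2 pmul_pmlinl pmul_pmlinr.
Lemma pmulE x y : pmul (ppure X x \ot ppure Y y) = ppure (X :|: Y) (glue_fam X x y).
Proof. exact: ptlift2E. Qed.
End Product.
End PureTensors.

(** * Direct sums over partitions *)
Section DirectSum.
Variable k : fieldType.

Section DSum.
Variables (I : finType) (V : I -> lmodType k).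
Lemma dinjE i (v : V i) : dinj v i = v.
Proof. exact: dfwith_in. Qed.
Lemma dinj_neq i (v : V i) j : j != i -> dinj v j = 0.
Proof. by move=> ji; apply: dfwith_out; rewrite eq_sym. Qed.
Fact dinj_linear i : linear (@dinj k I V i).
Proof.
move=> a u v; apply: functional_extensionality_dep => j.
rewrite -[RHS]/(a *: dinj u j + dinj v j).
have [->|ji] := eqVneq j i; first by rewrite !dinjE.
by rewrite !dinj_neq // scaler0 addr0.
Qed.
Definition dinjL i : {linear V i -> dsum V} := mklin (@dinj_linear i).
Fact dproj_linear i : linear (fun w : dsum V => w i).
Proof. by []. Qed.
Definition dproj i : {linear dsum V -> V i} := mklin (@dproj_linear i).
Lemma dsum_sumE (w : dsum V) : w = \sum_i dinj (w i).
Proof.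
apply: functional_extensionality_dep => j.
rewrite -[RHS]/(dproj j (\sum_i dinj (w i))).
rewrite (raddf_sum (dproj j)) (bigD1 j) //= big1 => [|i ij].
  by rewrite dinjE addr0.
by rewrite dinj_neq // eq_sym.
Qed.
Section Lift.
Variables (Z : lmodType k) (f : forall i, {linear V i -> Z}).
Fact dlift_linear : linear (fun w : dsum V => \sum_i f i (w i)).
Proof.
move=> a u v; rewrite scaler_sumr -big_split /=; apply: eq_bigr => i _.
by rewrite -[(a *: u + v) i]/(a *: u i + v i) linearP.
Qed.
Definition dlift : {linear dsum V -> Z} := mklin dlift_linear.
Lemma dliftE i (v : V i) : dlift (dinj v) = f i v.
Proof.
rewrite -[LHS]/(\sum_j f j (dinj v j)) (bigD1 i) //= dinjE big1 ?addr0 // => j ji.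
by rewrite dinj_neq // raddf0.
Qed.
End Lift.
Lemma dsum_eq (Z : lmodType k) (f g : {linear dsum V -> Z}) :
  (forall i v, f (dinj v) = g (@dinj k I V i v)) -> f =1 g.
Proof. by move=> fg w; rewrite [w]dsum_sumE !raddf_sum; apply: eq_bigr => i _; apply: fg. Qed.
End DSum.

Variables (b p : species k) (T : finType).
Implicit Types (A : {set T}) (X : {set {set T}}).

Fact subst_inj_linear A X (HX : partition X A) : linear (@subst_inj k b p T A X HX).
Proof. exact: (@dinj_linear _ _ (exist _ X HX)). Qed.
Definition subst_injL A X (HX : partition X A) :
  {linear b @@ X \ox ptens p X -> subst b p @@ A} := mklin (subst_inj_linear HX).

Lemma subst_eq A (Z : lmodType k) (f g : {linear subst b p @@ A -> Z}) :
  (forall X (HX : partition X A) v x,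
     f (subst_inj HX (v \ot ppure X x)) = g (subst_inj HX (v \ot ppure X x))) ->
  f =1 g.
Proof.
move=> fg; apply: dsum_eq => -[X HX].
apply: (@tens2_eq _ _ _ _ (f \o subst_injL HX) (g \o subst_injL HX)) => v t.
pose h : {linear ptens p X -> subst b p @@ A} := subst_injL HX \o mklin (@tpure2r k _ _ v).
by move: t; apply: (@ptens_eq _ _ _ _ _ (f \o h) (g \o h)) => x; apply: fg.
Qed.

End DirectSum.

(** * The coproduct of a positive comonoid on one block *)
Section TensorFunctoriality.
Variable k : fieldType.

Lemma tmap2_square (V V1 V2 V' W W1 W2 W' : lmodType k)
  (f1 : {linear V -> V1}) (f1' : {linear V1 -> V'})
  (f2 : {linear V -> V2}) (f2' : {linear V2 -> V'})
  (g1 : {linear W -> W1}) (g1' : {linear W1 -> W'})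
  (g2 : {linear W -> W2}) (g2' : {linear W2 -> W'}) :
  (forall v, f1' (f1 v) = f2' (f2 v)) -> (forall w, g1' (g1 w) = g2' (g2 w)) ->
  forall t, tmap2 f1' g1' (tmap2 f1 g1 t) = tmap2 f2' g2' (tmap2 f2 g2 t).
Proof.
move=> ff gg; apply: tens2_eq_linear => [||v w]; [by prove_linear | by prove_linear |].
by rewrite !tmap2E ff gg.
Qed.

Lemma tassoc_nat (V V' W W' Z Z' : lmodType k)
  (f : {linear V -> V'}) (g : {linear W -> W'}) (h : {linear Z -> Z'}) t :
  tassoc _ _ _ (tmap2 (tmap2 f g) h t) = tmap2 f (tmap2 g h) (tassoc _ _ _ t).
Proof.
move: t; apply: tens2_eq_linear => [||t z]; [by prove_linear | by prove_linear |].
rewrite tmap2E; move: t; apply: tens2_eq_linear => [||v w]; [by prove_linear | by prove_linear |].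
by rewrite tmap2E !tassocE !tmap2E.
Qed.
End TensorFunctoriality.

Section BlockCoproduct.
Variables (k : fieldType) (p : pos_comonoid k).

Section Def.
Variable T : finType.
Implicit Types A B C D : {set T}.

(** The direct sum of k and of all the p[C] serves as a common home for the blocks
    and for their pieces: a piece that is empty becomes the unit of k, and pieces
    that lie in equal sets are compared without transport. *)
Definition block_summand (o : option {set T}) : lmodType k :=
  if o is Some D then p @@ D else k^o.
Definition block_space : lmodType k := dsum block_summand.
Local Notation P := block_space.

Definition block_one : P := @dinj k _ block_summand None (1 : k).
Definition block_in D : {linear p @@ D -> P} := @dinjL k _ block_summand (Some D).
Definition block_const : {linear P -> k^o} := @dproj k _ block_summand None.
Definition block_comp D : {linear P -> p @@ D} := @dproj k _ block_summand (Some D).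

Lemma block_const_one : block_const block_one = 1 :> k.
Proof. exact: (@dinjE k _ block_summand None). Qed.
Lemma block_const_in D y : block_const (block_in D y) = 0.
Proof. exact: (@dinj_neq k _ block_summand (Some D) y None). Qed.
Lemma block_comp_one D : block_comp D block_one = 0.
Proof. exact: (@dinj_neq k _ block_summand None (1 : k) (Some D)). Qed.
Lemma block_comp_in D y : block_comp D (block_in D y) = y.
Proof. exact: (@dinjE k _ block_summand (Some D)). Qed.
Lemma block_comp_in_neq D D' y : D' != D -> block_comp D' (block_in D y) = 0.
Proof.
move=> ne; apply: (@dinj_neq k _ block_summand (Some D) y (Some D')).
by apply: contra ne => /eqP[->].
Qed.
Lemma block_space_eq (a b : P) :
  block_const a = block_const b -> (forall D, block_comp D a = block_comp D b) -> a = b.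
Proof.
move=> ec ep; apply: functional_extensionality_dep => -[D|]; [exact: ep | exact: ec].
Qed.

Fact decompU A B : [disjoint A & B] -> decomp (A :|: B) A B.
Proof. by rewrite /decomp eqxx. Qed.

(** The coproduct of a block whose pieces on the two sides are A and B.  An empty
    piece is replaced by the unit, which is group-like: 1 |-> 1 (x) 1.  When A and B
    are nonempty and overlap, the value 0 is arbitrary. *)
Definition block_delta_fun A B (a : P) : P \ox P :=
  match pselect (A != set0), pselect (B != set0), pselect [disjoint A & B] with
  | left nA, left nB, left dAB =>
      tmap2 (block_in A) (block_in B) (pc_delta p (decompU dAB) nA nB (block_comp (A :|: B) a))
  | left nA, left nB, right _ => 0
  | left nA, right _, _ => block_in A (block_comp A a) \ot block_one
  | right _, left nB, _ => block_one \ot block_in B (block_comp B a)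
  | right _, right _, _ => (block_const a : k) *: (block_one \ot block_one)
  end.
Fact block_delta_linear A B : linear (block_delta_fun A B).
Proof.
move=> c a a'; rewrite /block_delta_fun; case: pselect => nA; case: pselect => nB;
  last first.
- by rewrite linearP scalerDl scalerA.
- by rewrite !linearP tpure2r.
- by rewrite !linearP tpure2l.
- by case: pselect => dAB; rewrite ?linearP // scaler0 addr0.
Qed.
Definition block_delta A B : {linear P -> P \ox P} := mklin (@block_delta_linear A B).

Lemma block_delta00 a :
  block_delta set0 set0 a = (block_const a : k) *: (block_one \ot block_one).
Proof.
by rewrite /block_delta mklinE /block_delta_fun; case: pselect => [h|_]; [by case/negP: (h)|].
Qed.
Lemma block_delta0l B a : B != set0 ->
  block_delta set0 B a = block_one \ot block_in B (block_comp B a).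
Proof.
by move=> nB; rewrite /block_delta mklinE /block_delta_fun; case: pselect => [h|_];
  [by case/negP: (h)|case: pselect].
Qed.
Lemma block_delta0r A a : A != set0 ->
  block_delta A set0 a = block_in A (block_comp A a) \ot block_one.
Proof.
by move=> nA; rewrite /block_delta mklinE /block_delta_fun; case: pselect => // nA';
  case: pselect => // h; case/negP: (h).
Qed.
(** D need only be equal to A :|: B as a set, so that any description of the block
    can be used. *)
Lemma block_delta_neq0 A B D (d : decomp D A B) (nA : A != set0) (nB : B != set0) a :
  block_delta A B a = tmap2 (block_in A) (block_in B) (pc_delta p d nA nB (block_comp D a)).
Proof.
have [/eqP eD dAB] := andP d; case: D / eD d => d.
rewrite /block_delta mklinE /block_delta_fun; case: pselect => // nA'; case: pselect => // nB'.
case: pselect => // dAB'; congr (tmap2 _ _ (pc_delta _ _ _ _ _)); exact: bool_irrelevance.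
Qed.

(** When no piece is empty this is the coassociativity of p.  When one is, the
    unit stands for it, and the two sides perform the same cut between the two
    other pieces. *)
Lemma block_deltaA A B C a : [disjoint A & B] -> [disjoint A & C] -> [disjoint B & C] ->
  tassoc _ _ _ (tmap2 (block_delta A B) idfun (block_delta (A :|: B) C a)) =
  tmap2 idfun (block_delta B C) (block_delta A (B :|: C) a).
Proof.
move=> dAB dAC dBC.
have [->|nA] := eqVneq A set0; have [->|nB] := eqVneq B set0; rewrite ?(set0U, setU0).
- have [->|nC] := eqVneq C set0.
    rewrite !block_delta00; move: (block_const a : k) => c.
    rewrite (linear_atZ c (block_one \ot block_one)
      (linear_comp _ (linear_comp _ (@linear_id _ _)))).
    rewrite (linear_atZ c (block_one \ot block_one) (linear_comp _ (@linear_id _ _))).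
    by rewrite !tmap2E !block_delta00 block_const_one scale1r tassocE.
  rewrite !block_delta0l // !tmap2E !block_delta00 !block_delta0l //.
  by rewrite block_const_one block_comp_in scale1r tassocE.
- have [->|nC] := eqVneq C set0; rewrite ?(set0U, setU0).
    rewrite !(block_delta0r, block_delta0l) // !tmap2E !(block_delta0r, block_delta0l) //.
    by rewrite !block_comp_in tassocE.
  have d := decompU dBC; rewrite (block_delta_neq0 d nB nC) block_delta0l; last first.
    by case/set0Pn: nB => x xB; apply/set0Pn; exists x; rewrite inE xB.
  rewrite tmap2E (block_delta_neq0 d nB nC) block_comp_in.
  move: (pc_delta _ _ _ _ _); apply: tens2_eq_linear => [||y z];
    [by prove_linear | by prove_linear |].
  by rewrite !tmap2E block_delta0l // block_comp_in tassocE.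
- have [->|nC] := eqVneq C set0; rewrite ?(set0U, setU0).
    rewrite !block_delta0r // !tmap2E block_delta00 block_delta0r //.
    by rewrite !block_comp_in block_const_one scale1r tassocE.
  have d := decompU dAC; rewrite (block_delta_neq0 d nA nC).
  move: (pc_delta _ _ _ _ _); apply: tens2_eq_linear => [||y z];
    [by prove_linear | by prove_linear |].
  by rewrite !tmap2E block_delta0r // block_delta0l // !block_comp_in tassocE.
have nAB : A :|: B != set0.
  by case/set0Pn: nB => x xB; apply/set0Pn; exists x; rewrite inE xB orbT.
have d := decompU dAB.
have [->|nC] := eqVneq C set0; rewrite ?(set0U, setU0).
  rewrite block_delta0r // tmap2E !(block_delta_neq0 d nA nB) block_comp_in.
  move: (pc_delta _ _ _ _ _); apply: tens2_eq_linear => [||y z];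
    [by prove_linear | by prove_linear |].
  by rewrite !tmap2E block_delta0r // block_comp_in tassocE.
have nBC : B :|: C != set0.
  by case/set0Pn: nB => x xB; apply/set0Pn; exists x; rewrite inE xB.
have d' := decompU dBC.
have d1 : decomp (A :|: B :|: C) (A :|: B) C by apply: decompU; rewrite disjointUl dAC.
have d2 : decomp (A :|: B :|: C) A (B :|: C).
  by rewrite -setUA; apply: decompU; rewrite disjointUr dAB.
rewrite (block_delta_neq0 d1 nAB nC) (block_delta_neq0 d2 nA nBC).
have /(congr1 (tmap2 (block_in A) (tmap2 (block_in B) (block_in C)))) :=
  pc_deltaA d d1 d' d2 nA nB nC nAB nBC (block_comp (A :|: B :|: C) a).
rewrite -tassoc_nat.
rewrite (tmap2_square (f2 := block_in (A :|: B)) (f2' := block_delta A B)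
  (g2 := block_in C) (g2' := idfun)) //.
  rewrite (tmap2_square (f2 := block_in A) (f2' := idfun)
    (g2 := block_in (B :|: C)) (g2' := block_delta B C)) //.
  by move=> w; rewrite (block_delta_neq0 d' nB nC) block_comp_in.
by move=> v; rewrite (block_delta_neq0 d nA nB) block_comp_in.
Qed.
End Def.
End BlockCoproduct.
Arguments block_const {k p T} : simpl never.
Arguments block_comp {k p T} D : simpl never.
Arguments block_in {k p T} D : simpl never.
Arguments block_one {k p T} : simpl never.
Arguments block_delta {k p T} A B : simpl never.

(** * Transport of a block along a bijection *)
Section BlockTransport.
Variables (k : fieldType) (p : pos_comonoid k) (T U : finType) (f : T -> option U).
Variables (I : {set T}) (I' : {set U}) (Hf : is_bij f I I').
Local Notation PT := (block_space p T).
Local Notation PU := (block_space p U).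

Lemma preset_bij (D : {set U}) : D \subset I' -> is_bij f (preset f I D) D.
Proof.
by move=> DI; rewrite -{2}(presetK Hf DI); apply: is_bij_sub Hf _; apply: preset_sub.
Qed.

Lemma bij_pimset (D : {set T}) (D' : {set U}) : is_bij f D D' -> D' = pimset f D.
Proof.
by case=> _ e; apply/setP => y; rewrite inE e mem_imset // => ? ? [].
Qed.

Lemma pimset_preset (D : {set T}) : D \subset I -> preset f I (pimset f D) = D.
Proof.
move=> DI; apply: (pimset_inj Hf) => //; first exact: preset_sub.
by rewrite (presetK Hf) // (pimset_sub Hf).
Qed.

Lemma pimset_eq0 (D : {set T}) : D \subset I -> (pimset f D == set0) = (D == set0).
Proof.
have p0 : pimset f set0 = set0 by apply/setP => y; rewrite inE imset0 !inE.
move=> DI; apply/eqP/eqP => [e|->]; rewrite ?p0 //.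
by apply: (pimset_inj Hf); rewrite ?sub0set // p0.
Qed.

Lemma pimsetU (A B : {set T}) : pimset f (A :|: B) = pimset f A :|: pimset f B.
Proof. by apply/setP => y; rewrite !inE imsetU inE. Qed.

Lemma pimsetI (A B : {set T}) : A \subset I -> B \subset I ->
  pimset f (A :&: B) = pimset f A :&: pimset f B.
Proof.
move=> AI BI; apply/setP => y; rewrite [RHS]inE; apply/pimsetP/andP => [[x]|].
  by rewrite inE => /andP[xA xB] fx; split; apply/pimsetP; exists x.
case=> /pimsetP[x xA fx] /pimsetP[z zB fz]; exists x => //.
rewrite inE xA /=; suff -> : x = z by [].
by apply: (Hf.1 _ _ (subsetP AI _ xA) (subsetP BI _ zB)); rewrite fx fz.
Qed.

Lemma pimset_disjoint (A B : {set T}) : A \subset I -> B \subset I ->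
  [disjoint A & B] -> [disjoint pimset f A & pimset f B].
Proof.
move=> AI BI; rewrite -!setI_eq0 -pimsetI // pimset_eq0 //.
by apply: subset_trans AI; apply: subsetIl.
Qed.

(** f is known to be a bijection on the subsets of I only, hence the value 0 on the
    components that do not come from such a subset. *)
Definition block_map_fun (a : PT) : PU := fun o =>
  match o with
  | None => block_const a
  | Some D => match pselect (D \subset I') with
              | left h => sp_map p (preset_bij h) (block_comp (preset f I D) a)
              | right _ => 0
              end
  end.
Fact block_map_linear : linear block_map_fun.
Proof.
move=> c u v; apply: functional_extensionality_dep => -[D|]; last first.
  rewrite -[LHS]/(block_const (c *: u + v)).
  by rewrite -[RHS]/(c *: block_const u + block_const v) linearP.
rewrite -[RHS]/(c *: block_map_fun u (Some D) + block_map_fun v (Some D)) /block_map_fun.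
by case: pselect => h; rewrite ?linearP // scaler0 addr0.
Qed.
Definition block_map : {linear PT -> PU} := mklin block_map_linear.

Lemma block_const_map a : block_const (block_map a) = block_const a. Proof. by []. Qed.

Lemma sp_map_block_comp (D D' : {set T}) (E : {set U}) (H : is_bij f D E) (H' : is_bij f D' E) a :
  D = D' -> sp_map p H (block_comp D a) = sp_map p H' (block_comp D' a).
Proof. by move=> e; subst D'; apply: sp_ext. Qed.

Lemma block_comp_map (D : {set T}) (D' : {set U}) (H : is_bij f D D') a : D \subset I ->
  block_comp D' (block_map a) = sp_map p H (block_comp D a).
Proof.
move=> DI; have eD := bij_pimset H.
have D'I : D' \subset I' by rewrite eD (pimset_sub Hf).
rewrite -[LHS]/(block_map_fun a (Some D')) /block_map_fun; case: pselect => // h.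
by apply: sp_map_block_comp; rewrite eD pimset_preset.
Qed.

Lemma block_map_one : block_map (block_one : PT) = (block_one : PU).
Proof.
apply: block_space_eq => [|D]; first by rewrite block_const_map !block_const_one.
rewrite block_comp_one -[LHS]/(block_map_fun ((block_one : PT)) (Some D)) /block_map_fun.
by case: pselect => // h; rewrite block_comp_one raddf0.
Qed.

Lemma block_map_in (D : {set T}) (D' : {set U}) (H : is_bij f D D') y : D \subset I ->
  block_map (block_in D y) = block_in D' (sp_map p H y).
Proof.
move=> DI; apply: block_space_eq => [|E]; first by rewrite block_const_map !block_const_in.
have [->|ne] := eqVneq E D'; first by rewrite (block_comp_map H) // !block_comp_in.
rewrite block_comp_in_neq // -[LHS]/(block_map_fun (block_in D y) (Some E)) /block_map_fun.
case: pselect => // h; rewrite block_comp_in_neq ?raddf0 //.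
by apply: contra ne => /eqP e; rewrite (bij_pimset H) -e (presetK Hf).
Qed.

Lemma block_map_delta (A B : {set T}) a : A \subset I -> B \subset I -> [disjoint A & B] ->
  tmap2 block_map block_map (block_delta A B a) =
  block_delta (pimset f A) (pimset f B) (block_map a).
Proof.
move=> AI BI dAB.
have HA := is_bij_sub Hf AI; have HB := is_bij_sub Hf BI.
have p0 : pimset f set0 = set0 by apply/eqP; rewrite pimset_eq0 ?sub0set.
have [A0|nA] := eqVneq A set0; have [B0|nB] := eqVneq B set0.
- subst A B; rewrite !p0 !block_delta00 block_const_map.
  rewrite (linear_atZ (block_const a : k) ((block_one : PT) \ot (block_one : PT))
    (linear_comp (tmap2 _ _) (@linear_id _ _))).
  by rewrite tmap2E block_map_one.
- subst A; rewrite p0 !block_delta0l ?pimset_eq0 // tmap2E block_map_one.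
  by rewrite (block_map_in HB) // (block_comp_map HB).
- subst B; rewrite p0 !block_delta0r ?pimset_eq0 // tmap2E block_map_one.
  by rewrite (block_map_in HA) // (block_comp_map HA).
have d := decompU dAB; have d' := decompU (pimset_disjoint AI BI dAB).
have nA' : pimset f A != set0 by rewrite pimset_eq0.
have nB' : pimset f B != set0 by rewrite pimset_eq0.
have ABI : A :|: B \subset I by rewrite subUset AI.
have HAB : is_bij f (A :|: B) (pimset f A :|: pimset f B).
  by rewrite -pimsetU; apply: is_bij_sub Hf _.
rewrite (block_delta_neq0 d nA nB) (block_delta_neq0 d' nA' nB') (block_comp_map HAB) //.
rewrite (pc_nat d nA nB d' nA' nB' HAB HA HB).
by apply: tmap2_square => v; rewrite (block_map_in HA, block_map_in HB).
Qed.
End BlockTransport.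

(** * Restriction in a linearized bimonoid *)
Section SetTheoreticRestriction.
Variables (k : fieldType) (B : set_species).

Definition basis_coord (T : finType) (A : {set T}) (e : B @@s A) : {linear lin k B @@ A -> k^o} :=
  flift (fun e' : {classic B @@s A} => (e' == (e : {classic B @@s A}))%:R : k^o).

Lemma basis_coordE (T : finType) (A : {set T}) (e e' : B @@s A) :
  basis_coord e (basis k e') = ((e' : {classic B @@s A}) == e)%:R.
Proof. exact: fliftE. Qed.

Lemma basis_coord_eq1 (T : finType) (A : {set T}) (e e' : B @@s A) (c : k) :
  c * basis_coord e (basis k e') = 1 -> e' = e.
Proof.
rewrite basis_coordE; case: eqP => // _ /eqP.
by rewrite mulr0 eq_sym oner_eq0.
Qed.

Lemma basis_coord1 (T : finType) (A : {set T}) (e : B @@s A) : basis_coord e (basis k e) = 1.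
Proof. by rewrite basis_coordE eqxx. Qed.

Lemma basis_inj (T : finType) (A : {set T}) : injective (@basis k B T A).
Proof.
move=> e e' ee'; apply: (@basis_coord_eq1 _ _ _ _ 1).
by rewrite ee' mul1r basis_coord1.
Qed.

Lemma basis2_inj (T : finType) (A C : {set T}) (x x' : B @@s A) (y y' : B @@s C) :
  basis k x \ot basis k y = basis k x' \ot basis k y' -> x = x' /\ y = y'.
Proof.
move=> /(congr1 (fun t => tlunit _ (tmap2 (basis_coord x') (basis_coord y') t))).
rewrite !tmap2E !tlunitE !basis_coord1 -[_ *: _]/(_ * _) scale1r => E; split.
  by apply: (@basis_coord_eq1 _ _ _ _ (basis_coord y' (basis k y))); rewrite mulrC.
exact: basis_coord_eq1 E.
Qed.

Lemma basis3_inj (T : finType) (A C D : {set T}) (x x' : B @@s A) (y y' : B @@s C)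
    (z z' : B @@s D) :
  basis k x \ot (basis k y \ot basis k z) = basis k x' \ot (basis k y' \ot basis k z') ->
  x = x'.
Proof.
pose F : {linear _ -> k^o} := tlunit k^o \o tmap2 (basis_coord y') (basis_coord z').
have FE u v : F (basis k u \ot basis k v) = (basis_coord y' (basis k u) : k) *: basis_coord z' (basis k v).
  by rewrite -[LHS]/(tlunit k^o (tmap2 (basis_coord y') (basis_coord z') _)) tmap2E tlunitE.
move=> /(congr1 (fun t => tlunit _ (tmap2 (basis_coord x') F t))).
rewrite !tmap2E !tlunitE !FE !basis_coord1 !scale1r -[_ *: _]/(_ * _) mulrC => E.
exact: basis_coord_eq1 E.
Qed.

Lemma sp_map_basis (T U : finType) (f : T -> option U) A C (H : is_bij f A C) e :
  sp_map (lin k B) H (basis k e) = basis k (ss_map H e).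
Proof. exact: lin_mapE. Qed.

Variables (b : bimonoid (lin k B)) (L : linearized b).

Lemma decomp0l (T : finType) (I : {set T}) : decomp I set0 I.
Proof. by rewrite /decomp set0U eqxx -setI_eq0 set0I eqxx. Qed.
Lemma decomp0r (T : finType) (I : {set T}) : decomp I I set0.
Proof. by rewrite /decomp setU0 eqxx -setI_eq0 setI0 eqxx. Qed.

Lemma ldelta_counitr (T : finType) (I : {set T}) (d : decomp I I set0) e :
  bcounit b T (basis k (ldelta L d e).2) = 1 :> k /\ (ldelta L d e).1 = e.
Proof.
have := bcounitr b d (basis k e); rewrite (ldeltaE L) tmap2E trunitE => E.
have := congr1 (basis_coord e) E; rewrite linearZ_LR basis_coord1 -[_ *: _]/(_ * _) => E1.
have e1 := basis_coord_eq1 E1; split=> //.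
by rewrite e1 in E1; rewrite -[LHS]mulr1 -[in LHS](basis_coord1 e); exact: E1.
Qed.

Lemma ldelta_counitl (T : finType) (I : {set T}) (d : decomp I set0 I) e :
  (ldelta L d e).2 = e.
Proof.
have := bcounitl b d (basis k e); rewrite (ldeltaE L) tmap2E tlunitE => E.
have := congr1 (basis_coord e) E; rewrite linearZ_LR basis_coord1 -[_ *: _]/(_ * _).
exact: basis_coord_eq1.
Qed.

(** The right counit law gives the value 1 to the counit on the second factor of
    the coproduct of e, and the left one says that this factor is e. *)
Lemma counit_basis (T : finType) (e : B @@s (set0 : {set T})) :
  bcounit b T (basis k e) = 1 :> k.
Proof.
have d := decomp0l (set0 : {set T}).
by have [] := ldelta_counitr d e; rewrite (ldelta_counitl d).
Qed.

Lemma decompE (T : finType) (I S R : {set T}) : decomp I S R -> R = I :\: S.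
Proof.
case/andP=> /eqP <- dSR; rewrite setDUl setDv set0U.
by apply/esym/setDidPl; rewrite disjoint_sym.
Qed.

Lemma restr_irr (T : finType) (I U : {set T}) (H H' : U \subset I) e :
  restr L H e = restr L H' e.
Proof. by rewrite (bool_irrelevance H H'). Qed.

Lemma ldelta1 (T : finType) (I S R : {set T}) (d : decomp I S R) (SI : S \subset I) e :
  (ldelta L d e).1 = restr L SI e.
Proof.
have eR := decompE d; subst R.
by rewrite /restr; congr (ldelta L _ e).1; apply: bool_irrelevance.
Qed.

Lemma restr_id (T : finType) (I : {set T}) (H : I \subset I) e : restr L H e = e.
Proof.
by rewrite -(ldelta1 (decomp0r I)); have [] := ldelta_counitr (decomp0r I) e.
Qed.

(** This is the first tensor factor of coassociativity for the decomposition of I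
    into V, U :\: V and I :\: U. *)
Lemma restr_comp (T : finType) (I U V : {set T}) (VU : V \subset U) (UI : U \subset I)
  (VI : V \subset I) e : restr L VU (restr L UI e) = restr L VI e.
Proof.
have d23 : decomp (I :\: V) (U :\: V) (I :\: U).
  rewrite /decomp -setI_eq0; apply/andP; split; apply/eqP/setP => x; rewrite !inE.
    have /implyP := subsetP VU x; have /implyP := subsetP UI x.
    by case: (x \in V); case: (x \in U); case: (x \in I).
  by case: (x \in V); case: (x \in U); case: (x \in I).
have := bdeltaA b (decomp_setD VU) (decomp_setD UI) d23 (decomp_setD VI) (basis k e).
rewrite (ldeltaE L (decomp_setD UI)) tmap2E (ldeltaE L) tassocE.
rewrite (ldeltaE L (decomp_setD VI)) tmap2E (ldeltaE L d23).
exact: basis3_inj.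
Qed.

Lemma is_bij_setD (T U : finType) (f : T -> option U) I I' V V' :
  is_bij f I I' -> is_bij f V V' -> V \subset I -> is_bij f (I :\: V) (I' :\: V').
Proof.
move=> HI HV VI; have sub := subsetP VI.
apply: is_bijI => [x y|x|y].
- by rewrite !inE => /andP[_ xI] /andP[_ yI]; apply: HI.1.
- rewrite inE => /andP[xV xI]; have [y yI fx] := is_bij_fun HI xI.
  exists y; rewrite // inE yI andbT; apply: contra xV => yV.
  have [x' x'V fx'] := is_bij_surj HV yV.
  by rewrite (HI.1 _ _ xI (sub _ x'V)) // fx fx'.
- rewrite inE => /andP[yV yI]; have [x xI fx] := is_bij_surj HI yI.
  exists x; rewrite // inE xI andbT; apply: contra yV => xV.
  by have [y' y'V] := is_bij_fun HV xV; rewrite fx => -[->].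
Qed.

Lemma restr_nat (T U : finType) (f : T -> option U) (I V : {set T}) (I' V' : {set U})
  (HI : is_bij f I I') (HV : is_bij f V V') (VI : V \subset I) (VI' : V' \subset I') e :
  restr L VI' (ss_map HI e) = ss_map HV (restr L VI e).
Proof.
have HD := is_bij_setD HI HV VI.
have := bdelta_nat b (decomp_setD VI) (decomp_setD VI') HI HV HD (basis k e).
rewrite sp_map_basis !(ldeltaE L) tmap2E !sp_map_basis.
by move/basis2_inj => [].
Qed.

Lemma lmu_nat (T U : finType) (f : T -> option U) (I S R : {set T}) (I' S' R' : {set U})
  (d : decomp I S R) (d' : decomp I' S' R')
  (HI : is_bij f I I') (HS : is_bij f S S') (HR : is_bij f R R') x y :
  ss_map HI (lmu L d (x, y)) = lmu L d' (ss_map HS x, ss_map HR y).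
Proof.
apply: basis_inj; rewrite -sp_map_basis -!lmuE (bmu_nat b d d' HI HS HR).
by rewrite tmap2E !sp_map_basis.
Qed.

(** This is the first tensor factor of the compatibility between the product and
    the coproduct, for the four pieces A, S :\: A, C and R :\: C. *)
Lemma restr_mu (T : finType) (I S R A C W : {set T}) (d : decomp I S R)
  (dW : decomp W A C) (AS : A \subset S) (CR : C \subset R) (WI : W \subset I) x y :
  restr L WI (lmu L d (x, y)) = lmu L dW (restr L AS x, restr L CR y).
Proof.
have dR' : decomp (I :\: W) (S :\: A) (R :\: C).
  have [/eqP <- /pred0P dSR] := andP d; have [/eqP <- _] := andP dW.
  rewrite /decomp -setI_eq0; apply/andP; split; apply/eqP/setP => z; rewrite !inE;
    have /implyP := subsetP AS z; have /implyP := subsetP CR z; have /= := dSR z;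
    by case: (z \in A); case: (z \in C); case: (z \in S); case: (z \in R).
have := bmu_delta b d (decomp_setD WI) (decomp_setD AS) (decomp_setD CR) dW dR'
  (basis k x \ot basis k y).
rewrite (lmuE L) tmap2E !(ldeltaE L) tmidE tmap2E !(lmuE L).
by move/basis2_inj => [].
Qed.
End SetTheoreticRestriction.

(** * The trace on a subset of a decorated partition *)
Section Traces.
Variables (k : fieldType) (B : set_species) (b : bimonoid (lin k B)) (L : linearized b).
Variable p : pos_comonoid k.

Section Def.
Variable T : finType.
Implicit Types (X Y Z : {set {set T}}) (A C D I S R : {set T}).
Local Notation P := (block_space p T).

(** A nonempty D lies in at most one block of a partition; the value 0 is used when
    it lies in none. *)
Definition trace_fam X (a : {set T} -> P) D : p @@ D :=
  if [pick C in X | D \subset C] is Some C then block_comp D (a C) else 0.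

Lemma part_disj X I C C' : partition X I -> C \in X -> C' \in X -> C != C' ->
  C :&: C' = set0.
Proof.
by case/and3P => _ /trivIsetP tX _ CX C'X ne; apply/eqP; rewrite setI_eq0; apply: tX.
Qed.

Lemma part_neq0 X I C : partition X I -> C \in X -> C != set0.
Proof. by case/and3P => _ _ n0 CX; apply: contra n0 => /eqP <-. Qed.

Lemma trace_famE X I a C D : partition X I -> C \in X -> D \subset C -> D != set0 ->
  trace_fam X a D = block_comp D (a C).
Proof.
move=> HX CX DC D0; rewrite /trace_fam; case: pickP => [C' /andP[C'X DC']|/(_ C)]; last first.
  by rewrite CX DC.
have [->//|ne] := eqVneq C' C.
case/negP: D0; rewrite -subset0 -(part_disj HX C'X CX ne).
by apply/subsetIP.
Qed.

Lemma trace_fam_ext X a a' D : {in X, a =1 a'} -> trace_fam X a D = trace_fam X a' D.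
Proof. by move=> aa'; rewrite /trace_fam; case: pickP => // C /andP[CX _]; rewrite aa'. Qed.

(** A block that misses S contributes the scalar part of its entry.  The unit that a
    coproduct puts on the side where a block has no piece is absorbed in this way. *)
Definition off_coef X S (a : {set T} -> P) : k :=
  \prod_(C in X | C :&: S == set0) (block_const (a C) : k).

(** Both factors of every term of a coproduct have this form.  The entry of a block
    C of X is read in p[C :&: S] if C meets S, and in k otherwise. *)
Definition trace_tensor X I S (HX : partition X I) (SI : S \subset I) (e : B @@s X)
    (a : {set T} -> P) : subst (lin k B) p @@ S :=
  off_coef X S a *: subst_inj (trace_partition HX SI)
    (basis k (down L S HX e) \ot ppure (blocks_trace X S) (trace_fam X a)).

Lemma traceP X S D : reflect (exists C, [/\ C \in X, C :&: S != set0 & D = C :&: S])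
  (D \in blocks_trace X S).
Proof.
apply: (iffP imsetP) => [[C]|[C [CX C0 ->]]]; first by rewrite inE => /andP[CX C0] ->; exists C.
by exists C; rewrite // inE CX.
Qed.

Lemma scale_inj_congr S Z (HZ : partition Z S) (c c' : k) v (x x' : forall C, p @@ C) :
  c = c' -> (forall D, D \in Z -> x D = x' D) ->
  c *: subst_inj HZ (v \ot ppure Z x) =
  c' *: subst_inj HZ (v \ot ppure Z x') :> subst (lin k B) p @@ S.
Proof. by move=> -> xx'; rewrite (ppure_ext xx'). Qed.

(** Here Z is any set equal to the trace of X on S, and f any description of the
    bijection C |-> C :&: S onto it: identifications of equal sets of blocks are
    absorbed in the choice of f. *)
Lemma trace_tensor_eq X I S (HX : partition X I) (SI : S \subset I) e a
    Z (HZ : partition Z S) (V : {set {set T}}) (VX : V \subset X)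
    (f : {set T} -> option {set T}) (H : is_bij f V Z) (y : forall C, p @@ C) :
  V = blocks_meet X S -> {in V, forall C, f C = Some (C :&: S)} ->
  (forall C, C \in V -> y (C :&: S) = block_comp (C :&: S) (a C)) ->
  trace_tensor HX SI e a =
  off_coef X S a *: subst_inj HZ (basis k (ss_map H (restr L VX e)) \ot ppure Z y).
Proof.
move=> eV; subst V => fE yE.
have eZ : Z = blocks_trace X S.
  apply/setP => D; apply/idP/imsetP => [DZ|[C CV ->]].
    have [C CV] := is_bij_surj H DZ; rewrite fE // => -[<-]; by exists C.
  by have [D' D'Z] := is_bij_fun H CV; rewrite fE // => -[->].
subst Z; rewrite /trace_tensor (bool_irrelevance (trace_partition HX SI) HZ).
congr (_ *: subst_inj _ (basis _ _ \ot _)).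
  rewrite /down (restr_irr _ _ VX); apply: ss_ext => C CV; by rewrite fE.
apply: ppure_ext => D /traceP[C [CX C0 ->]].
by rewrite yE ?inE ?CX // (trace_famE _ HX CX) // subsetIl.
Qed.

Section Multilin.
Variables (X : {set {set T}}) (I S : {set T}) (HX : partition X I) (SI : S \subset I).
Variable e : B @@s X.

(** The entry of a block that misses S occurs in the scalar only; any other entry
    occurs in the tensor only, as the factor on the trace of its block. *)
Lemma trace_tensor_mlin : mlin X (trace_tensor HX SI e).
Proof.
split=> [a a' aa'|a C0 C0X].
  apply: scale_inj_congr => [|D _]; last exact: trace_fam_ext.
  by apply: eq_bigr => C /andP[CX _]; rewrite aa'.
pose G y : subst (lin k B) p @@ S := subst_injL (lin k B) p (trace_partition HX SI)
  (basis k (down L S HX e) \ot ppure (blocks_trace X S) y).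
have [C00|C00] := eqVneq (C0 :&: S) set0.
  have E u : trace_tensor HX SI e (upd a C0 u) =
      ((block_const u : k) *
       \prod_(C in X | (C :&: S == set0) && (C != C0)) (block_const (a C) : k)) *:
      G (trace_fam X a).
    apply: scale_inj_congr.
      rewrite /off_coef (bigD1 C0) /=; last by rewrite C0X C00 eqxx.
      rewrite {1}/upd eqxx; congr (_ * _); apply: eq_big => C.
        by rewrite andbA.
      by case/andP=> _ ne; rewrite /upd (negbTE ne).
    move=> D /traceP[C [CX C1 ->]].
    rewrite !(trace_famE _ HX CX) ?subsetIl // /upd; case: eqP => // e1.
    by rewrite e1 C00 eqxx in C1.
  by move=> c u v; rewrite !E linearP mulrDl scalerDl -mulrA -scalerA.
have D0 : C0 :&: S \in blocks_trace X S by apply/traceP; exists C0.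
have E u : trace_tensor HX SI e (upd a C0 u) =
    off_coef X S a *: G (upd_fam (trace_fam X a) (block_comp (C0 :&: S) u)).
  apply: scale_inj_congr.
    apply: eq_bigr => C /andP[CX C1]; rewrite /upd; case: eqP => // e1.
    by move: C1; rewrite e1 (negbTE C00).
  move=> D /traceP[C [CX C1 ->]].
  have [->|ne] := eqVneq C C0.
    by rewrite upd_famE (trace_famE _ HX C0X) ?subsetIl // /upd eqxx.
  rewrite upd_fam_neq ?(trace_famE _ HX CX) ?subsetIl // /upd ?(negbTE ne) //.
  apply: contra C1 => /eqP e1; rewrite -subset0 -(part_disj HX CX C0X ne).
  by rewrite subsetI subsetIl e1 subsetIl.
move=> c u v; rewrite !E linearP /G (ppure_pmlin p _).2 // tpure2r linearP.
by rewrite scalerDr !scalerA mulrC.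
Qed.
End Multilin.
End Def.
End Traces.

(** * The coproduct of the substitution *)
Section SubstCoproduct.
Variables (k : fieldType) (B : set_species) (b : bimonoid (lin k B)) (L : linearized b).
Variables (p : pos_comonoid k) (T : finType).
Implicit Types (X Y Z : {set {set T}}) (A C D I S R : {set T}).
Local Notation P := (block_space p T).

Lemma block_delta_in A C D (a : P) : [disjoint A & C] -> D = A :|: C -> D != set0 ->
  block_delta A C (block_in D (block_comp D a)) = block_delta A C a.
Proof.
move=> dAC -> {D}.
have [->|nA] := eqVneq A set0; have [->|nC] := eqVneq C set0; rewrite ?(set0U, setU0).
- by rewrite eqxx.
- by rewrite !block_delta0l // block_comp_in.
- by rewrite !block_delta0r // block_comp_in.
- by move=> _; rewrite !(block_delta_neq0 (decompU dAC) nA nC) block_comp_in.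
Qed.

(** Every block meets I and is its own trace, so the generators of the substitution
    are trace tensors; this is how formulas for traces give formulas for all
    elements. *)
Lemma trace_tensor_full X I (HX : partition X I) (II : I \subset I) e (x : forall C, p @@ C) :
  trace_tensor L HX II e (fun C => block_in C (x C)) = subst_inj HX (basis k e \ot ppure X x).
Proof.
have XI C : C \in X -> C :&: I = C by move=> CX; apply/setIidPl/(partS HX).
rewrite (trace_tensor_eq L HX II e HX (subxx _) (is_bij_id X) (y := x)).
- rewrite ss_id restr_id /off_coef big_pred0 ?scale1r // => C.
  case CX : (C \in X) => //=; rewrite XI // ; apply/negbTE; exact: (part_neq0 HX).
- apply/setP => C; rewrite inE; case CX: (C \in X) => //=.
  by rewrite XI // (part_neq0 HX).
- by move=> C CX; rewrite XI.
- by move=> C CX; rewrite XI // block_comp_in.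
Qed.

Definition untrace (M : Type) S (u : M) (a : {set T} -> M) : {set T} -> M :=
  fun C => if C :&: S == set0 then u else a (C :&: S).

Lemma untrace_pull (M Z : lmodType k) X I S (u : M) (g : ({set T} -> M) -> Z) :
  partition X I -> mlin X g -> mlin (blocks_trace X S) (fun a => g (untrace S u a)).
Proof.
move=> HX [gE gL]; apply: (mlin_pull gE gL) => [a a' aa' C CX|a D /traceP[C0 [C0X C0S ->]]].
  rewrite /untrace; case: eqP => // /eqP C0; apply: aa'.
  by apply/traceP; exists C.
exists C0 => // v C CX; rewrite /untrace /upd; case: (eqVneq C C0) => [->|ne].
  by rewrite (negbTE C0S) eqxx.
case: eqVneq => // C0'; case: eqP => // e.
case/negP: C0'; rewrite -subset0 -(part_disj HX CX C0X ne).
by rewrite subsetI subsetIl e subsetIl.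
Qed.

Lemma off_coef_untrace X I S A (HX : partition X I) (a : {set T} -> P) : A \subset S ->
  off_coef X A (untrace S block_one a) = off_coef (blocks_trace X S) A a.
Proof.
move=> AS; have SA C : C :&: S :&: A = C :&: A by rewrite -setIA (setIidPr AS).
rewrite /off_coef (bigID (fun C => C :&: S == set0)) -[LHS]/(_ * _).
rewrite [X in X * _]big1 ?mul1r; last first.
  by move=> C /andP[_ /eqP C0]; rewrite /untrace C0 eqxx block_const_one.
rewrite /blocks_trace [RHS]big_mkcondr [RHS]big_imset; last first.
  by move=> C D CX DX e; have [+ _] := trace_bij S HX; apply => //; congr Some.
rewrite -big_mkcondr; apply: eq_big => C; first by rewrite inE SA -!andbA [X in _ && X]andbC.
by case/andP => _ /negbTE C0; rewrite /untrace C0.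
Qed.

(** The trace on A of the trace on S is the trace on A, and restriction in b is
    transitive. *)
Lemma trace_tensor_trace X I S A (HX : partition X I) (SI : S \subset I) (AS : A \subset S)
  (AI : A \subset I) e (a : {set T} -> P) :
  trace_tensor L (trace_partition HX SI) AS (down L S HX e) a =
  trace_tensor L HX AI e (untrace S block_one a).
Proof.
pose HXS := trace_partition HX SI.
have SA C : C :&: S :&: A = C :&: A by rewrite -setIA (setIidPr AS).
have meetS C : C \in blocks_meet X A -> C \in blocks_meet X S.
  rewrite !inE => /andP[-> CA] /=; apply: contra CA; rewrite -SA => /eqP ->.
  by rewrite set0I.
have H1 : is_bij (fun C => Some (C :&: S)) (blocks_meet X A) (blocks_meet (blocks_trace X S) A).
  apply: is_bijI => [C D CX DX|C CX|D].
  - by apply: (trace_bij S HX).1; apply: meetS.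
  - exists (C :&: S) => //; rewrite inE SA; move: (CX); rewrite inE => /andP[_ ->].
    by rewrite andbT; apply: imset_f; apply: meetS.
  - rewrite inE => /andP[/traceP[C [CX C0 ->]] CA]; exists C => //.
    by rewrite inE CX -SA.
have sub : blocks_meet X A \subset blocks_meet X S by apply/subsetP => C; apply: meetS.
have H := is_bij_comp H1 (trace_bij A HXS).
rewrite (trace_tensor_eq L HX AI e (trace_partition HXS AS) (blocks_meet_sub X A) H
           (y := trace_fam (blocks_trace X S) a)) //.
- rewrite /trace_tensor (off_coef_untrace HX) // ; congr (_ *: subst_inj _ (basis _ _ \ot _)).
  rewrite /down (restr_nat L (trace_bij S HX) H1 sub).
  by rewrite (restr_comp L _ _ (blocks_meet_sub X A)) (ss_comp H1 (trace_bij A HXS) H).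
- by move=> C _; rewrite /pcomp /= SA.
- move=> C CA; have := meetS C CA; move: CA; rewrite !inE => /andP[CX CA] /andP[_ CS].
  rewrite (trace_famE (C := C :&: S) _ HXS) //.
  + by rewrite /untrace (negbTE CS).
  + by apply/traceP; exists C.
  + by apply: setIS.
Qed.

Section Coproduct.
Variables (I S R : {set T}) (d : decomp I S R).
Let SI := decompl d.
Let RI := decompr d.

Lemma decomp_disjI C : [disjoint C :&: S & C :&: R].
Proof.
have [_ dSR] := andP d.
by apply: disjointWl (disjointWr _ dSR); apply: subsetIr.
Qed.

Definition delta_fam (a : {set T} -> P) : {set T} -> P \ox P :=
  fun C => block_delta (C :&: S) (C :&: R) (a C).

Section Term.
Variables (X : {set {set T}}) (HX : partition X I).

Definition trace_tensor2 (e : B @@s X) :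
  ({set T} -> P \ox P) -> (subst (lin k B) p @@ S) \ox (subst (lin k B) p @@ R) :=
  mten (trace_tensor_mlin L p HX SI e) (trace_tensor_mlin L p HX RI e).

Lemma trace_tensor2_pmlin e :
  pmlin X (fun x => trace_tensor2 e (delta_fam (fun C => block_in C (x C)))).
Proof.
have [mE mL] := mten_mlin (trace_tensor_mlin L p HX SI e) (trace_tensor_mlin L p HX RI e).
split=> [x y xy|x C CX]; first by apply: mE => C CX; rewrite /delta_fam xy.
have E u : trace_tensor2 e (delta_fam (fun D => block_in D (upd_fam x u D))) =
    trace_tensor2 e (upd (delta_fam (fun D => block_in D (x D))) C
                       (block_delta (C :&: S) (C :&: R) (block_in C u))).
  apply: mE => D _; rewrite /delta_fam /upd; case: eqVneq => [->|ne]; first by rewrite upd_famE.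
  by rewrite upd_fam_neq.
by move=> c u v; rewrite !E (linearP (block_in C)) (linearP (block_delta _ _)) /trace_tensor2 mL.
Qed.

Fact subst_delta_term_bilin : bilin (fun (v : lin k B @@ X) (t : ptens p X) =>
  flift (fun e : {classic B @@s X} => ptlift (trace_tensor2_pmlin e) t) v).
Proof.
split=> [t|v]; first by move=> a u w; exact: linearP.
move=> a t t'; move: v; apply: free_ind => [|c u v Hu Hv|e].
- by rewrite !(raddf0 (flift _)) scaler0 addr0.
- by rewrite !(linearP (flift _)) Hu Hv lin_comb.
- by rewrite !fliftE linearP.
Qed.
Definition subst_delta_term : {linear lin k B @@ X \ox ptens p X ->
  (subst (lin k B) p @@ S) \ox (subst (lin k B) p @@ R)} := lift2 subst_delta_term_bilin.

Lemma subst_delta_termE e x : subst_delta_term (basis k e \ot ppure X x) =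
  trace_tensor2 e (delta_fam (fun C => block_in C (x C))).
Proof. by rewrite [LHS]lift2E [LHS]fliftE ptliftE. Qed.
End Term.

Definition subst_delta : {linear subst (lin k B) p @@ I ->
    (subst (lin k B) p @@ S) \ox (subst (lin k B) p @@ R)} :=
  dlift (fun X : parts I => subst_delta_term (valP X)).

Lemma subst_delta_inj X (HX : partition X I) t :
  subst_delta (subst_inj HX t) = subst_delta_term HX t.
Proof.
rewrite [LHS](dliftE _ (i := exist _ X HX)).
by congr (subst_delta_term _ _); apply: bool_irrelevance.
Qed.

End Coproduct.

(** The coproduct of a trace is obtained by cutting the traces of all blocks, which
    turns every law of the coproduct into a law about one block.  On the left the
    family is indexed by the traces on S; pulled back to the blocks of X it only
    differs from the family on the right where a block misses S, by a scalar which
    both sides contain.  Elsewhere [block_delta] reads nothing but the component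
    C :&: S of an entry, the one that the trace on S keeps. *)
Lemma subst_delta_trace X I S A C (HX : partition X I) (SI : S \subset I)
  (AI : A \subset I) (CI : C \subset I) (d : decomp S A C) e (a : {set T} -> P) :
  subst_delta d (trace_tensor L HX SI e a) =
  mten (trace_tensor_mlin L p HX AI e) (trace_tensor_mlin L p HX CI e) (delta_fam A C a).
Proof.
pose HXS := trace_partition HX SI.
have AS := decompl d; have CS := decompr d.
have inS (U : {set T}) D : U \subset S -> D :&: S :&: U = D :&: U.
  by move=> US; rewrite -setIA (setIidPr US).
rewrite /trace_tensor linearZ_LR subst_delta_inj subst_delta_termE /trace_tensor2.
set e' := down L S HX e; set a' := delta_fam _ _ _.
have -> : mten (trace_tensor_mlin L p (trace_partition HX SI) (decompl d) e')
               (trace_tensor_mlin L p (trace_partition HX SI) (decompr d) e') a' =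
    mten (trace_tensor_mlin L p HX AI e) (trace_tensor_mlin L p HX CI e)
      (untrace S (block_one \ot block_one) a').
  move: a'; apply: (mlin_eq (mten_mlin _ _)).
    apply: (untrace_pull _ _ HX
      (mten_mlin (trace_tensor_mlin L p HX AI e) (trace_tensor_mlin L p HX CI e))).
  move=> u v; rewrite mtenE !(trace_tensor_trace HX SI _ _ e).
  rewrite -(mtenE (trace_tensor_mlin L p HX AI e) (trace_tensor_mlin L p HX CI e)); congr mten.
  by apply/funext => D; rewrite /untrace; case: ifP.
(* The scalar of a block that misses S is moved into its entry. *)
pose c D : k := if D :&: S == set0 then (block_const (a D) : k) else 1.
have -> : off_coef X S a = \prod_(D in X) c D by rewrite /off_coef big_mkcondr.
rewrite -(mlin_scale c _
  (mten_mlin (trace_tensor_mlin L p HX AI e) (trace_tensor_mlin L p HX CI e))).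
apply: (mten_mlin _ _).1 => D DX; rewrite /untrace /c.
case: eqVneq => D0.
  rewrite /delta_fam -(inS A) ?decompl // -(inS C) // D0 !set0I block_delta00 //.
rewrite scale1r /a' /delta_fam (inS A) // (inS C) // (trace_famE _ HX DX) ?subsetIl //.
apply: block_delta_in => //; first exact: (decomp_disjI d).
by have [/eqP <- _] := andP d; rewrite setIUr.
Qed.
End SubstCoproduct.

(** * The product of the substitution *)
Section SubstProduct.
Variables (k : fieldType) (h : species k) (b : bimonoid h) (p : species k) (T : finType).
Implicit Types (X Y Z : {set {set T}}) (A C D I S R : {set T}).

Section Term.
Variables (X Y : {set {set T}}) (dXY : decomp (X :|: Y) X Y).
Fact decomp_disj : [disjoint X & Y]. Proof. by case/andP: dXY. Qed.
Definition subst_mu_term : {linear (h @@ X \ox ptens p X) \ox (h @@ Y \ox ptens p Y) ->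
    h @@ (X :|: Y) \ox ptens p (X :|: Y)} :=
  tmap2 (bmu b dXY) (pmul p decomp_disj) \o tmid _ _ _ _.
Lemma subst_mu_termE v w x y : subst_mu_term ((v \ot ppure X x) \ot (w \ot ppure Y y)) =
  bmu b dXY (v \ot w) \ot ppure (X :|: Y) (glue_fam X x y).
Proof.
by rewrite -[LHS]/(tmap2 _ _ (tmid _ _ _ _ _)) tmidE tmap2E pmulE.
Qed.
End Term.

Section Product.
Variables (I S R : {set T}) (d : decomp I S R).

Definition subst_mu_fun (w : subst h p @@ S) (w' : subst h p @@ R) : subst h p @@ I :=
  \sum_(X : parts S) \sum_(Y : parts R)
    subst_injL h p (partition_union d (valP X) (valP Y))
      (subst_mu_term (decomp_union d (valP X) (valP Y))
        ((@dproj k _ (fun X : parts S => subst_term h p (val X)) X w) \ot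
         (@dproj k _ (fun X : parts R => subst_term h p (val X)) Y w'))).

Lemma linear_sum_fun (U V : lmodType k) (J : finType) (F : J -> U -> V) :
  (forall j, linear (F j)) -> linear (fun u => \sum_j F j u).
Proof.
move=> FL a u v; rewrite scaler_sumr -big_split /=; apply: eq_bigr => j _; exact: FL.
Qed.

Fact subst_mu_bilin : bilin subst_mu_fun.
Proof.
split=> w; rewrite /subst_mu_fun; apply: linear_sum_fun => X; apply: linear_sum_fun => Y;
  by prove_linear.
Qed.
Definition subst_mu : {linear (subst h p @@ S) \ox (subst h p @@ R) -> subst h p @@ I} :=
  lift2 subst_mu_bilin.

Lemma big_pick2 (J J' : finType) (V : zmodType) (F : J -> J' -> V) i j :
  (forall i' j', i' != i -> F i' j' = 0) -> (forall j', j' != j -> F i j' = 0) ->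
  \sum_i \sum_j F i j = F i j.
Proof.
move=> Fi Fj; rewrite (bigD1 i) //= [X in _ + X]big1 ?addr0; last first.
  by move=> i' ii'; rewrite big1 // => j' _; apply: Fi.
by rewrite (bigD1 j) //= big1 ?addr0.
Qed.

Lemma subst_mu_inj X Y (HX : partition X S) (HY : partition Y R) s t :
  subst_mu (subst_inj HX s \ot subst_inj HY t) =
  subst_inj (partition_union d HX HY) (subst_mu_term (decomp_union d HX HY) (s \ot t)).
Proof.
rewrite [LHS]lift2E /subst_mu_fun (big_pick2 (i := exist _ X HX) (j := exist _ Y HY)).
- rewrite -[dproj _ _ _]/(subst_inj HX s (exist _ X HX)).
  rewrite -[dproj _ (exist _ Y HY) _]/(subst_inj HY t (exist _ Y HY)) /subst_inj !dinjE.
  rewrite (bool_irrelevance (valP (exist _ X HX)) HX).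
  by rewrite (bool_irrelevance (valP (exist _ Y HY)) HY).
- move=> X' Y' ne; rewrite -[dproj _ X' _]/(subst_inj HX s X') [subst_inj HX s X']dinj_neq //.
  exact: (linear_at0 (linear_comp (subst_injL _ _ _)
    (linear_comp (subst_mu_term _) (linear_otl _ (@linear_id _ _))))).
- move=> Y' ne; rewrite -[dproj _ Y' _]/(subst_inj HY t Y') [subst_inj HY t Y']dinj_neq //.
  exact: (linear_at0 (linear_comp (subst_injL _ _ _)
    (linear_comp (subst_mu_term _) (linear_otr _ (@linear_id _ _))))).
Qed.

(** Z is any set equal to X :|: Y, and z any family that extends x and y: the
    associativity and unit laws of b then apply as they stand. *)
Lemma subst_mu_pure X Y Z (HX : partition X S) (HY : partition Y R) (dZ : decomp Z X Y)
    (HZ : partition Z I) v w x y z :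
  (forall C, C \in X -> z C = x C) -> (forall C, C \in Y -> z C = y C) ->
  subst_mu (subst_inj HX (v \ot ppure X x) \ot subst_inj HY (w \ot ppure Y y)) =
  subst_inj HZ (bmu b dZ (v \ot w) \ot ppure Z z).
Proof.
move=> zx zy; rewrite subst_mu_inj subst_mu_termE.
have [/eqP eZ _] := andP dZ; subst Z.
rewrite (bool_irrelevance (decomp_union d HX HY) dZ).
rewrite (bool_irrelevance (partition_union d HX HY) HZ).
congr (subst_inj _ (_ \ot _)); apply: ppure_ext => C.
by rewrite /glue_fam inE; case: ifP => /= [/zx|_ /zy].
Qed.
End Product.
End SubstProduct.

(** * Transport of the substitution along a bijection *)
Section SubstTransport.
Variables (k : fieldType) (h p : species k) (T U : finType) (f : T -> option U).
Variables (A : {set T}) (A' : {set U}) (Hf : is_bij f A A').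
Implicit Types (X : {set {set T}}) (Y : {set {set U}}).

Lemma pblock_blockbij X Y : partition X A -> is_bij (pblock_map f) X Y -> blockbij f X Y.
Proof. by move=> HX HXY; split=> // C CX; apply: is_bij_sub Hf (partS HX CX). Qed.

Lemma comap_of_bij X Y : partition X A -> is_bij (pblock_map f) X Y -> comap_part f A Y = X.
Proof.
move=> HX HXY; apply/setP => C; rewrite inE; apply/andP/idP => [[CA CY]|CX].
  have [D DX [e]] := is_bij_surj HXY CY.
  by rewrite -(pimset_inj Hf (partS HX DX) CA e).
split; first exact: (partS HX CX).
by have [D DY [->]] := is_bij_fun HXY CX.
Qed.

(** X is the only partition of A whose image is Y, so all other components vanish
    on both sides. *)
Lemma subst_map_inj X Y (HX : partition X A) (HY : partition Y A') (H : blockbij f X Y) t :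
  sp_map (subst h p) Hf (subst_inj HX t) = subst_inj HY (subst_term_map h p H t).
Proof.
apply: functional_extensionality_dep => Y'.
rewrite -[LHS]/(subst_term_map h p (comap_blockbij Hf (valP Y')) (subst_inj HX t (comap Hf Y'))).
have [eY|neY] := eqVneq Y' (exist _ Y HY).
  have e : comap Hf Y' = exist _ X HX by rewrite eY; apply: val_inj; apply: comap_of_bij H.1.
  subst Y'; rewrite [RHS]dinjE.
  rewrite (@subst_term_dep k h p T U A (comap Hf (exist _ Y HY)) (exist _ X HX)
    (subst_inj HX t) Y f f (comap_blockbij Hf _) H e) //.
  by rewrite /subst_inj dinjE.
rewrite /subst_inj [dinj _ (comap _ _)]dinj_neq ?[RHS]dinj_neq ?raddf0 //.
apply: contra neY => /eqP e; apply/eqP/val_inj; have Hb := comap_blockbij Hf (valP Y').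
have eX : comap_part f A (val Y') = X := congr1 val e.
rewrite eX in Hb; apply/setP => D; apply/idP/idP => DY.
  have [C CX [<-]] := is_bij_surj Hb.1 DY.
  by have [D' D'Y [->]] := is_bij_fun H.1 CX.
have [C CX [<-]] := is_bij_surj H.1 DY.
by have [D' D'Y [->]] := is_bij_fun Hb.1 CX.
Qed.

Lemma ptens_map_pure X Y (H : blockbij f X Y) x y :
  (forall C D (HCD : is_bij f C D), C \in X -> D \in Y -> y D = sp_map p HCD (x C)) ->
  ptens_map p H (ppure X x) = ppure Y y.
Proof.
move=> xy; rewrite [LHS]ptens_mapE; congr tpure; apply: functional_extensionality_dep => D.
by rewrite (xy _ _ (blk_bij H D)) //; apply: valP.
Qed.

Lemma subst_map_pure X Y (HX : partition X A) (HY : partition Y A')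
    (HXY : is_bij (pblock_map f) X Y) v x y :
  (forall C D (HCD : is_bij f C D), C \in X -> D \in Y -> y D = sp_map p HCD (x C)) ->
  sp_map (subst h p) Hf (subst_inj HX (v \ot ppure X x)) =
  subst_inj HY (sp_map h HXY v \ot ppure Y y).
Proof.
move=> xy; rewrite (subst_map_inj HX HY (pblock_blockbij HX HXY)).
rewrite /subst_term_map tmap2E (ptens_map_pure _ xy).
by congr (subst_inj _ (_ \ot _)); apply: sp_ext.
Qed.
End SubstTransport.

(** * Traces of products and of transported partitions *)
Section TraceProduct.
Variables (k : fieldType) (B : set_species) (b : bimonoid (lin k B)) (L : linearized b).
Variables (p : pos_comonoid k) (T : finType).
Implicit Types (X Y Z : {set {set T}}) (A C D I S R : {set T}).
Local Notation P := (block_space p T).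

Definition glue (M : Type) X (a a' : {set T} -> M) : {set T} -> M :=
  fun C => if C \in X then a C else a' C.

Section Facts.
Variables (I S R A C W : {set T}) (d : decomp I S R) (dW : decomp W A C).
Hypotheses (AS : A \subset S) (CR : C \subset R).
Variables (X Y Z : {set {set T}}) (HX : partition X S) (HY : partition Y R).
Variable dZ : decomp Z X Y.

Lemma decomp_mem (K : finType) (V V1 V2 : {set K}) x :
  decomp V V1 V2 -> (x \in V) = (x \in V1) || (x \in V2).
Proof. by case/andP => /eqP <- _; rewrite inE. Qed.

Lemma decomp_memF (K : finType) (V V1 V2 : {set K}) x :
  decomp V V1 V2 -> x \in V1 -> x \in V2 -> False.
Proof. by case/andP => _ /pred0P/(_ x) /= H x1 x2; rewrite x1 x2 in H. Qed.

Lemma inter_left D : D \in X -> D :&: W = D :&: A.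
Proof.
move=> DX; apply/setP => x; rewrite !inE (decomp_mem _ dW).
case xD: (x \in D) => //=; case xC: (x \in C); rewrite ?orbF //.
by case: (decomp_memF d (subsetP (partS HX DX) _ xD) (subsetP CR _ xC)).
Qed.

Lemma inter_right D : D \in Y -> D :&: W = D :&: C.
Proof.
move=> DX; apply/setP => x; rewrite !inE (decomp_mem _ dW).
case xD: (x \in D) => //=; case xA: (x \in A) => //=.
by case: (decomp_memF d (subsetP AS _ xA) (subsetP (partS HY DX) _ xD)).
Qed.

Lemma decomp_meet : decomp (blocks_meet Z W) (blocks_meet X A) (blocks_meet Y C).
Proof.
rewrite /decomp -setI_eq0; apply/andP; split; apply/eqP/setP => D; rewrite !inE.
  rewrite (decomp_mem _ dZ).
  have [DX|_] := boolP (D \in X); have [DY|_] := boolP (D \in Y) => //=.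
  - by case: (decomp_memF dZ DX DY).
  - by rewrite inter_left // orbF.
  - by rewrite inter_right.
by apply/negP => /andP[/andP[DX _] /andP[DY _]]; apply: (decomp_memF dZ DX DY).
Qed.

Lemma decomp_trace : decomp (blocks_trace Z W) (blocks_trace X A) (blocks_trace Y C).
Proof.
rewrite /decomp -setI_eq0; apply/andP; split; apply/eqP/setP => D; rewrite inE.
  apply/orP/traceP => [[]/traceP[E [EX E0 ->]]|[E [EZ E0 ->]]].
  - by exists E; rewrite inter_left // (decomp_mem _ dZ) EX.
  - by exists E; rewrite inter_right // (decomp_mem _ dZ) EX orbT.
  - move: EZ; rewrite (decomp_mem _ dZ) => /orP[EX|EY]; [left|right].
      by apply/traceP; exists E; rewrite -inter_left.
    by apply/traceP; exists E; rewrite -inter_right.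
rewrite inE; apply/negP => /andP[/traceP[E [EX E0 ->]] /traceP[F [FY F0 e]]].
case/set0Pn: (E0) => x xE; move: (xE); rewrite {1}e => xF; move: xE xF; rewrite !inE.
move=> /andP[xE _] /andP[xF _].
by case: (decomp_memF d (subsetP (partS HX EX) _ xE) (subsetP (partS HY FY) _ xF)).
Qed.

Lemma off_coef_glue (a a' : {set T} -> P) :
  off_coef Z W (glue X a a') = off_coef X A a * off_coef Y C a'.
Proof.
rewrite /off_coef (bigID (fun D => D \in X)) -[LHS]/(_ * _).
congr (_ * _); apply: eq_big => D; cbv beta.
- rewrite (decomp_mem _ dZ); case DX: (D \in X); last by rewrite andbF.
  by rewrite andbT inter_left.
- by case/andP => _ DX; rewrite /glue DX.
- rewrite (decomp_mem _ dZ); case DX: (D \in X) => /=.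
    by rewrite andbF; apply/esym/negbTE/negP => /andP[DY _]; apply: (decomp_memF dZ DX DY).
  by rewrite andbT; case DY: (D \in Y) => //=; rewrite inter_right.
- by case/andP => _ DX; rewrite /glue (negbTE DX).
Qed.
End Facts.

Lemma is_bij_ext (K K' : finType) (f g : K -> option K') (V : {set K}) (V' : {set K'}) :
  {in V, f =1 g} -> is_bij f V V' -> is_bij g V V'.
Proof.
move=> fg [fI fV]; split=> [x y xV yV|]; first by rewrite -!fg //; apply: fI.
by rewrite -fV; apply: eq_in_imset => x xV; rewrite fg.
Qed.

(** A block of X lies in S, so that it meets W = A |_| C in its trace on A; a block
    of Y meets W in its trace on C.  For b the statement is [restr_mu]. *)
Lemma trace_tensor_mu I S R A C W (d : decomp I S R) (dW : decomp W A C)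
  (AS : A \subset S) (CR : C \subset R) (WI : W \subset I)
  X Y Z (HX : partition X S) (HY : partition Y R) (dZ : decomp Z X Y) (HZ : partition Z I)
  e e' (a a' : {set T} -> P) :
  subst_mu b p dW (trace_tensor L HX AS e a \ot trace_tensor L HY CR e' a') =
  trace_tensor L HZ WI (lmu L dZ (e, e')) (glue X a a').
Proof.
have dV := decomp_meet d dW AS CR HX HY dZ.
have dZt := decomp_trace d dW AS CR HX HY dZ.
have iX := inter_left d dW CR HX; have iY := inter_right d dW AS HY.
rewrite /trace_tensor.
rewrite (linear_atZ _ _ (linear_comp (subst_mu b p dW) (linear_otl _ (@linear_id _ _)))).
rewrite (linear_atZ _ _ (linear_comp (subst_mu b p dW) (linear_otr _ (@linear_id _ _)))).
rewrite scalerA -(off_coef_glue d dW AS CR HX HY dZ).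
rewrite (subst_mu_pure b dW (trace_partition HX AS) (trace_partition HY CR) dZt
   (trace_partition HZ WI) _ _
   (z := trace_fam Z (glue X a a'))).
- rewrite (lmuE L); congr (_ *: subst_inj _ (basis _ _ \ot _)).
  rewrite /down (restr_mu L dZ dV (blocks_meet_sub X A) (blocks_meet_sub Y C)).
  have H1 : is_bij (fun D => Some (D :&: W)) (blocks_meet X A) (blocks_trace X A).
    by apply: (is_bij_ext _ (trace_bij A HX)) => D; rewrite inE => /andP[/iX ->].
  have H2 : is_bij (fun D => Some (D :&: W)) (blocks_meet Y C) (blocks_trace Y C).
    by apply: (is_bij_ext _ (trace_bij C HY)) => D; rewrite inE => /andP[/iY ->].
  rewrite (lmu_nat L dV dZt _ H1 H2); congr (lmu _ _ (_, _)); apply: ss_ext => D.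
    by rewrite inE => /andP[/iX ->].
  by rewrite inE => /andP[/iY ->].
- move=> D /traceP[E [EX E0 ->]]; rewrite (trace_famE _ HX EX) ?subsetIl //.
  by rewrite (trace_famE _ HZ (C := E)) ?subsetIl ?(decomp_mem _ dZ) ?EX // /glue EX.
- move=> D /traceP[E [EY E0 ->]]; rewrite (trace_famE _ HY EY) ?subsetIl //.
  rewrite (trace_famE _ HZ (C := E)) ?subsetIl ?(decomp_mem _ dZ) ?EY ?orbT // /glue.
  by case: ifP => // EX; case: (decomp_memF dZ EX EY).
Qed.
End TraceProduct.

Section TraceTransport.
Variables (k : fieldType) (B : set_species) (b : bimonoid (lin k B)) (L : linearized b).
Variables (p : pos_comonoid k) (T U : finType) (f : T -> option U).
Variables (I S : {set T}) (I' S' : {set U}) (Hf : is_bij f I I') (HS : is_bij f S S').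
Variables (SI : S \subset I) (S'I' : S' \subset I').
Variables (X : {set {set T}}) (Y : {set {set U}}) (HX : partition X I) (HY : partition Y I').
Variable HXY : is_bij (pblock_map f) X Y.

Lemma bij_memY C : C \in X -> pimset f C \in Y.
Proof. by move=> CX; have [D DY [->]] := is_bij_fun HXY CX. Qed.

Lemma pimset_inter C : C \in X -> pimset f (C :&: S) = pimset f C :&: S'.
Proof. by move=> CX; rewrite (bij_pimset HS) (pimsetI Hf) // (partS HX). Qed.

Lemma inter_eq0 C : C \in X -> (pimset f C :&: S' == set0) = (C :&: S == set0).
Proof.
move=> CX; rewrite -pimset_inter // (pimset_eq0 Hf) //.
by apply: subset_trans SI; apply: subsetIr.
Qed.

Lemma bij_meet : is_bij (pblock_map f) (blocks_meet X S) (blocks_meet Y S').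
Proof.
apply: is_bijI => [C D|C|D].
- by rewrite !inE => /andP[CX _] /andP[DX _]; apply: (HXY.1).
- rewrite inE => /andP[CX C0]; exists (pimset f C) => //.
  by rewrite inE bij_memY // inter_eq0.
- rewrite inE => /andP[DY]; have [C CX [<-]] := is_bij_surj HXY DY.
  by rewrite inter_eq0 // => C0; exists C; rewrite // inE CX.
Qed.

Lemma bij_trace : is_bij (pblock_map f) (blocks_trace X S) (blocks_trace Y S').
Proof.
apply: is_bijI => [C D|C|D].
- move=> /traceP[C' [CX _ ->]] /traceP[D' [DX _ ->]] [e].
  by apply: (pimset_inj HS) e; apply: subsetIr.
- move=> /traceP[C' [CX C0 ->]]; exists (pimset f (C' :&: S)) => //.
  by apply/traceP; exists (pimset f C'); rewrite bij_memY // inter_eq0 // pimset_inter.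
- move=> /traceP[D' [DY + ->]]; have [C CX [<-]] := is_bij_surj HXY DY.
  rewrite inter_eq0 // => C0; exists (C :&: S); last by rewrite /pblock_map pimset_inter.
  by apply/traceP; exists C.
Qed.

(** The image of the trace of a block is the trace of its image. *)
Lemma trace_tensor_nat e (a : {set T} -> block_space p T) :
  sp_map (subst (lin k B) p) HS (trace_tensor L HX SI e a) =
  trace_tensor L HY S'I' (ss_map HXY e) (fun D => block_map p Hf (a (preset f I D))).
Proof.
have preK C : C \in X -> preset f I (pimset f C) = C.
  by move=> CX; apply: (pimset_preset Hf); apply: (partS HX).
rewrite /trace_tensor linearZ_LR; set a' := fun D => block_map p Hf _.
rewrite (subst_map_pure HS (trace_partition HX SI) (trace_partition HY S'I') bij_trace _
           (y := trace_fam Y a')); last first.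
  move=> C D HCD /traceP[C' [CX C0 eC]] _.
  have C'S : C' :&: S \subset I by apply: subset_trans SI; apply: subsetIr.
  subst C; have eD := bij_pimset HCD; rewrite (pimset_inter CX) in eD.
  rewrite (trace_famE _ HX CX) ?subsetIl // (trace_famE (C := pimset f C') _ HY) ?bij_memY //.
  + by rewrite /a' preK // (block_comp_map Hf HCD).
  + by rewrite eD subsetIl.
  + by rewrite eD inter_eq0.
have eY : Y = pimset f @: X.
  apply/setP => D; apply/idP/imsetP => [DY|[C CX ->]]; last exact: bij_memY.
  by have [C CX [<-]] := is_bij_surj HXY DY; exists C.
have -> : off_coef Y S' a' = off_coef X S a.
  rewrite /off_coef [in LHS]eY [LHS]big_mkcondr [LHS]big_imset; last first.
    by move=> C D CX DX e'; apply: (HXY.1) => //; rewrite /pblock_map e'.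
  rewrite [RHS]big_mkcondr; apply: eq_bigr => C CX.
  by rewrite inter_eq0 // /a' preK.
rewrite sp_map_basis; congr (_ *: subst_inj _ (basis _ _ \ot _)).
rewrite /down (restr_nat L HXY bij_meet (blocks_meet_sub X S)).
have H1 := is_bij_comp (trace_bij S HX) bij_trace.
have H2 := is_bij_comp bij_meet (trace_bij S' HY).
rewrite -[LHS](ss_comp _ _ H1) -[RHS](ss_comp _ _ H2); apply: ss_ext => C.
by rewrite inE => /andP[CX _]; rewrite /pcomp /= /pblock_map pimset_inter.
Qed.
End TraceTransport.

(** * The bimonoid axioms that involve no coproduct *)
Section Generators.
Variables (k : fieldType) (p : species k) (T : finType).

Lemma subst_eq_pure (h : species k) (A : {set T}) (Z : lmodType k) (F G : subst h p @@ A -> Z) :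
  linear F -> linear G ->
  (forall X (HX : partition X A) v x,
     F (subst_inj HX (v \ot ppure X x)) = G (subst_inj HX (v \ot ppure X x))) ->
  F =1 G.
Proof. by move=> HF HG; apply: (@subst_eq _ _ _ _ _ _ (mklin HF) (mklin HG)). Qed.

Lemma subst_eq_basis (B : set_species) (A : {set T}) (Z : lmodType k)
    (F G : subst (lin k B) p @@ A -> Z) :
  linear F -> linear G ->
  (forall X (HX : partition X A) (e : B @@s X) x,
     F (subst_inj HX (basis k e \ot ppure X x)) = G (subst_inj HX (basis k e \ot ppure X x))) ->
  F =1 G.
Proof.
move=> HF HG FG; apply: subst_eq_pure => // X HX v x.
pose c := fun u : lin k B @@ X => subst_injL (lin k B) p HX (u \ot ppure X x).
have cL : linear c by rewrite /c; prove_linear.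
pose F' := mklin HF; pose G' := mklin HG.
have F'L : linear (fun u => F' (c u)) by apply: linear_comp.
have G'L : linear (fun u => G' (c u)) by apply: linear_comp.
exact: (@lin_eq k B _ X Z (mklin F'L) (mklin G'L) (fun e => FG X HX e x)).
Qed.

Lemma image_bij (U : finType) (f : T -> option U) (A : {set T}) (A' : {set U})
    (X : {set {set T}}) (Hf : is_bij f A A') (HX : partition X A) :
  is_bij (pblock_map f) X (pimset f @: X).
Proof.
apply: is_bijI => [C D CX DX [e]|C CX|_ /imsetP[C CX ->]]; last by exists C.
  by apply: (pimset_inj Hf) e; apply: (partS HX).
by exists (pimset f C) => //; apply: imset_f.
Qed.

Lemma image_partition (U : finType) (f : T -> option U) (A : {set T}) (A' : {set U})
    (X : {set {set T}}) (Hf : is_bij f A A') (HX : partition X A) :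
  partition (pimset f @: X) A'.
Proof.
apply/and3P; split.
- rewrite eqEsubset; apply/andP; split.
    by apply/bigcupsP => _ /imsetP[C CX ->]; apply: (pimset_sub Hf) (partS HX CX).
  apply/subsetP => y yA; have [x xA fx] := is_bij_surj Hf yA.
  have [/eqP cX _ _] := and3P HX; move: xA; rewrite -cX => /bigcupP[C CX xC].
  by apply/bigcupP; exists (pimset f C); [apply: imset_f | apply/pimsetP; exists x].
- apply/trivIsetP => _ _ /imsetP[C CX ->] /imsetP[D DX ->] ne.
  apply: (pimset_disjoint Hf (partS HX CX) (partS HX DX)).
  rewrite -setI_eq0; apply/eqP/(part_disj HX) => //.
  by apply: contra ne => /eqP ->.
- apply/imsetP => -[C CX /esym/eqP]; rewrite (pimset_eq0 Hf) ?(partS HX) //.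
  by apply/negP; apply: (part_neq0 HX).
Qed.
End Generators.

Section ProductAxioms.
Variables (k : fieldType) (h : species k) (b : bimonoid h) (p : pos_comonoid k).

Lemma part_set0 (T : finType) (X : {set {set T}}) : partition X set0 -> X = set0.
Proof.
move=> HX; apply/setP => C; rewrite !inE; apply/negP => CX.
have := part_neq0 HX CX; have := partS HX CX; rewrite subset0 => /eqP ->.
by rewrite eqxx.
Qed.

(** Going through [block_map] makes the transported family total. *)
Definition transport_fam (T U : finType) (f : T -> option U) (I : {set T}) (I' : {set U})
    (Hf : is_bij f I I') (x : forall C : {set T}, p @@ C) (D : {set U}) : p @@ D :=
  block_comp D (block_map p Hf (block_in (preset f I D) (x (preset f I D)))).

Lemma transport_famE (T U : finType) (f : T -> option U) (I : {set T}) (I' : {set U})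
    (Hf : is_bij f I I') x C D (HCD : is_bij f C D) : C \subset I ->
  transport_fam Hf x D = sp_map p HCD (x C).
Proof.
move=> CI; have e : preset f I D = C by rewrite (bij_pimset HCD) (pimset_preset Hf).
by rewrite /transport_fam (block_comp_map Hf HCD) // e block_comp_in.
Qed.

Lemma subst_mu_nat (T U : finType) (f : T -> option U) (I S R : {set T}) (I' S' R' : {set U})
    (d : decomp I S R) (d' : decomp I' S' R')
    (HI : is_bij f I I') (HS : is_bij f S S') (HR : is_bij f R R') t :
  sp_map (subst h p) HI (subst_mu b p d t) =
  subst_mu b p d' (tmap2 (sp_map (subst h p) HS) (sp_map (subst h p) HR) t).
Proof.
move: t; apply: tens2_eq_linear => [||s t]; [by prove_linear | by prove_linear |].
move: s; apply: subst_eq_pure => [||X HX v x]; [by prove_linear | by prove_linear |].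
move: t; apply: subst_eq_pure => [||Y HY w y]; [by prove_linear | by prove_linear |].
have SI := decompl d; have RI := decompr d.
have HX' := image_partition HS HX; have HY' := image_partition HR HY.
have HXX' := image_bij HS HX; have HYY' := image_bij HR HY.
have dZ := decomp_union d HX HY; have HZ := partition_union d HX HY.
have dZ' := decomp_union d' HX' HY'; have HZ' := partition_union d' HX' HY'.
have HZZ' : is_bij (pblock_map f) (X :|: Y) (pimset f @: X :|: pimset f @: Y).
  by rewrite -imsetU; apply: image_bij HI HZ.
pose z := glue_fam X x y.
have zY C : C \in Y -> z C = y C.
  by move=> CY; rewrite /z /glue_fam; case: ifP => // CX; case: (decomp_memF dZ CX CY).
rewrite (subst_mu_pure b d HX HY dZ HZ v w (x := x) (y := y) (z := z)) //; last first.
  by move=> C CX; rewrite /z /glue_fam CX.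
rewrite tmap2E (subst_map_pure HI HZ HZ' HZZ' _ (y := transport_fam HI z)); last first.
  by move=> C D HCD CZ _; apply: transport_famE; apply: (partS HZ).
rewrite (subst_map_pure HS HX HX' HXX' _ (y := transport_fam HI z)); last first.
  move=> C D HCD CX _; rewrite (transport_famE HI z HCD) /z /glue_fam ?CX //.
  exact: subset_trans (partS HX CX) SI.
rewrite (subst_map_pure HR HY HY' HYY' _ (y := transport_fam HI z)); last first.
  move=> C D HCD CY _; rewrite (transport_famE HI z HCD) ?zY //.
  exact: subset_trans (partS HY CY) RI.
rewrite (subst_mu_pure b d' HX' HY' dZ' HZ' _ _ (z := transport_fam HI z)) //.
by rewrite (bmu_nat b dZ dZ' HZZ' HXX' HYY') tmap2E.
Qed.

Lemma subst_muA (T : finType) (I S12 S23 S1 S2 S3 : {set T})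
    (d12 : decomp S12 S1 S2) (d12_3 : decomp I S12 S3)
    (d23 : decomp S23 S2 S3) (d1_23 : decomp I S1 S23) t :
  subst_mu b p d12_3 (tmap2 (subst_mu b p d12) idfun t) =
  subst_mu b p d1_23 (tmap2 idfun (subst_mu b p d23) (tassoc _ _ _ t)).
Proof.
move: t; apply: tens2_eq_linear => [||s t]; [by prove_linear | by prove_linear |].
move: s; apply: tens2_eq_linear => [||r s]; [by prove_linear | by prove_linear |].
move: r; apply: subst_eq_pure => [||X1 H1 v1 x1]; [by prove_linear | by prove_linear |].
move: s; apply: subst_eq_pure => [||X2 H2 v2 x2]; [by prove_linear | by prove_linear |].
move: t; apply: subst_eq_pure => [||X3 H3 v3 x3]; [by prove_linear | by prove_linear |].
have H12 := partition_union d12 H1 H2; have H23 := partition_union d23 H2 H3.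
have e12 := decomp_union d12 H1 H2; have e23 := decomp_union d23 H2 H3.
have e12_3 := decomp_union d12_3 H12 H3; have H := partition_union d12_3 H12 H3.
have e1_23 : decomp (X1 :|: X2 :|: X3) X1 (X2 :|: X3).
  by rewrite -setUA; apply: decomp_union d1_23 H1 H23.
pose z := glue_fam X1 x1 (glue_fam X2 x2 x3).
have z1 C : C \in X1 -> z C = x1 C by move=> C1; rewrite /z /glue_fam C1.
have z2 C : C \in X2 -> z C = x2 C.
  move=> C2; rewrite /z /glue_fam C2; case: ifP => // C1.
  by case: (decomp_memF e12 C1 C2).
have z3 C : C \in X3 -> z C = x3 C.
  move=> C3; rewrite /z /glue_fam; case: ifP => [C1|_].
    by case: (decomp_memF e1_23 C1); rewrite inE C3 orbT.
  by case: ifP => // C2; case: (decomp_memF e23 C2 C3).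
rewrite tassocE !tmap2E.
rewrite (subst_mu_pure b d12 H1 H2 e12 H12 v1 v2 (z := z)) //.
rewrite (subst_mu_pure b d23 H2 H3 e23 H23 v2 v3 (z := z)) //.
rewrite (subst_mu_pure b d12_3 H12 H3 e12_3 H _ _ (z := z)) //.
rewrite (subst_mu_pure b d1_23 H1 H23 e1_23 H _ _ (z := z)) //.
have := bmuA b e12 e12_3 e23 e1_23 ((v1 \ot v2) \ot v3).
by rewrite tassocE !tmap2E => ->.
Qed.

Definition subst_one (T : finType) : subst h p @@ (set0 : {set T}) :=
  subst_inj (partition_set0 T) (bone b {set T} \ot ppure set0 (fun=> 0)).

Arguments subst_one : clear implicits.

Lemma ppure0 (T : finType) (x y : forall C : {set T}, p @@ C) :
  ppure (set0 : {set {set T}}) x = ppure set0 y.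
Proof. by apply: ppure_ext => C; rewrite inE. Qed.

Lemma subst_mu1l (T : finType) (I : {set T}) (d : decomp I set0 I) x :
  subst_mu b p d (subst_one T \ot x) = x.
Proof.
move: x; apply: subst_eq_pure => [||X HX v x]; [by prove_linear | by prove_linear |].
rewrite (subst_mu_pure b d (partition_set0 T) HX (decomp0l X) HX _ _ (z := x)) ?bmu1l //.
by move=> C; rewrite inE.
Qed.

Lemma subst_mu1r (T : finType) (I : {set T}) (d : decomp I I set0) x :
  subst_mu b p d (x \ot subst_one T) = x.
Proof.
move: x; apply: subst_eq_pure => [||X HX v x]; [by prove_linear | by prove_linear |].
rewrite (subst_mu_pure b d HX (partition_set0 T) (decomp0r X) HX _ _ (z := x)) ?bmu1r //.
by move=> C; rewrite inE.
Qed.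

Lemma pblock_map0 (T U : finType) (f : T -> option U) :
  is_bij (pblock_map f) (set0 : {set {set T}}) (set0 : {set {set U}}).
Proof. by apply: is_bijI => [C D|C|C]; rewrite inE. Qed.

Lemma subst_one_nat (T U : finType) (f : T -> option U)
    (H : is_bij f (set0 : {set T}) (set0 : {set U})) :
  sp_map (subst h p) H (subst_one T) = subst_one U.
Proof.
rewrite (subst_map_pure H (partition_set0 T) (partition_set0 U) (pblock_map0 f) _ (y := fun=> 0)).
  by rewrite bone_nat.
by move=> C D HCD; rewrite inE.
Qed.

Definition empty_ptens (T : finType) : {linear ptens p (set0 : {set {set T}}) -> k^o} :=
  @ptlift k p T set0 k^o (fun=> 1) (conj (fun _ _ _ => erefl)
     (fun _ C C0 => False_rect _ (notF (etrans (esym (in_set0 C)) C0)))).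

Definition subst_counit (T : finType) : {linear subst h p @@ (set0 : {set T}) -> k^o} :=
  trunit k^o \o tmap2 (bcounit b {set T}) (empty_ptens T) \o
  @dproj k _ (fun X : parts (set0 : {set T}) => subst_term h p (val X))
    (exist _ set0 (partition_set0 T)).

Lemma subst_counitE (T : finType) (X : {set {set T}}) (HX : partition X set0) v x
    (H : is_bij Some X set0) :
  subst_counit T (subst_inj HX (v \ot ppure X x)) = bcounit b {set T} (sp_map h H v).
Proof.
have e := part_set0 HX; subst X; rewrite sp_id (bool_irrelevance HX (partition_set0 T)).
rewrite -[LHS]/(trunit k^o (tmap2 (bcounit b {set T}) (empty_ptens T)
   (subst_inj (partition_set0 T) (v \ot ppure set0 x) (exist _ set0 (partition_set0 T))))).
rewrite /subst_inj dinjE tmap2E trunitE ptliftE; exact: scale1r.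
Qed.

Lemma subst_counit0 (T : finType) v x :
  subst_counit T (subst_inj (partition_set0 T) (v \ot ppure set0 x)) = bcounit b {set T} v.
Proof. by rewrite (subst_counitE _ _ _ (is_bij_id _)) sp_id. Qed.

(** The empty set has a single partition. *)
Lemma subst_eq0 (T : finType) (Z : lmodType k) (F G : subst h p @@ (set0 : {set T}) -> Z) :
  linear F -> linear G ->
  (forall v, F (subst_inj (partition_set0 T) (v \ot ppure set0 (fun=> 0))) =
             G (subst_inj (partition_set0 T) (v \ot ppure set0 (fun=> 0)))) -> F =1 G.
Proof.
move=> HF HG FG; apply: subst_eq_pure => // X HX v x.
have e := part_set0 HX; subst X; rewrite (bool_irrelevance HX (partition_set0 T)).
by rewrite (ppure0 x (fun=> 0)).
Qed.

Lemma subst_counit_nat (T U : finType) (f : T -> option U)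
    (H : is_bij f (set0 : {set T}) (set0 : {set U})) x :
  subst_counit U (sp_map (subst h p) H x) = subst_counit T x.
Proof.
move: x; apply: subst_eq0 => [||v]; [by prove_linear | by prove_linear |].
rewrite (subst_map_pure H (partition_set0 T) (partition_set0 U) (pblock_map0 f) _ (y := fun=> 0)).
  by rewrite !subst_counit0 bcounit_nat.
by move=> C D HCD; rewrite inE.
Qed.

Lemma subst_counit_mu (T : finType) (d : decomp (set0 : {set T}) set0 set0) x y :
  subst_counit T (subst_mu b p d (x \ot y)) = subst_counit T x * subst_counit T y :> k.
Proof.
suff H : forall x y, subst_counit T (subst_mu b p d (x \ot y)) =
    (subst_counit T x : k) *: subst_counit T y.
  exact: H.
move=> {}x {}y; move: x; apply: subst_eq0 => [||v]; first by prove_linear.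
  by move=> a u w; rewrite linearP scalerDl -scalerA.
move: y; apply: subst_eq0 => [||w]; first by prove_linear.
  by move=> a u w; rewrite linearP scalerDr !scalerA; congr (_ *: _ + _); exact: mulrC.
rewrite (subst_mu_pure b d _ _ (decomp0l _) (partition_set0 T) _ _ (z := fun=> 0)) //.
by rewrite !subst_counit0; exact: (bcounit_mu b (decomp0l _) v w).
Qed.

Lemma subst_counit_one (T : finType) : subst_counit T (subst_one T) = 1 :> k.
Proof. by rewrite subst_counit0 bcounit_one. Qed.
End ProductAxioms.
Arguments subst_one {k h} b p T.
Arguments subst_counit {k h} b p T.

(** * The bimonoid axioms for the coproduct *)
Section CoproductAxioms.
Variables (k : fieldType) (B : set_species) (b : bimonoid (lin k B)) (L : linearized b).
Variable p : pos_comonoid k.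
Local Notation bp := (subst (lin k B) p).

Lemma subst_eq_trace (T : finType) (I : {set T}) (Z : lmodType k) (F G : bp @@ I -> Z) :
  linear F -> linear G ->
  (forall X (HX : partition X I) (e : B @@s X) (x : forall C, p @@ C),
     F (trace_tensor L HX (subxx I) e (fun C => block_in C (x C))) =
     G (trace_tensor L HX (subxx I) e (fun C => block_in C (x C)))) ->
  F =1 G.
Proof.
move=> HF HG FG; apply: subst_eq_basis => // X HX e x.
by rewrite -!(trace_tensor_full L HX (subxx I)).
Qed.

(** Both sides are multilinear in the family of cut blocks, so that they are compared
    on pure tensors, where [trace_tensor_nat] applies; the cuts themselves are
    natural by [block_map_delta]. *)
Lemma subst_delta_nat (T U : finType) (f : T -> option U) (I S R : {set T}) (I' S' R' : {set U})
    (d : decomp I S R) (d' : decomp I' S' R')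
    (HI : is_bij f I I') (HS : is_bij f S S') (HR : is_bij f R R') w :
  subst_delta L p d' (sp_map bp HI w) = tmap2 (sp_map bp HS) (sp_map bp HR) (subst_delta L p d w).
Proof.
move: w; apply: subst_eq_trace => [||X HX e x]; [by prove_linear | by prove_linear |].
have SI := decompl d; have RI := decompr d; have SI' := decompl d'; have RI' := decompr d'.
have HX' := image_partition HI HX; have HXX' := image_bij HI HX.
set a := fun C => block_in C (x C).
rewrite (trace_tensor_nat L HI HI (subxx I) (subxx I') HX HX' HXX').
rewrite (subst_delta_trace L HX _ SI RI d) (subst_delta_trace L HX' _ SI' RI' d').
set e' := ss_map HXX' e.
have preK C : C \in X -> preset f I (pimset f C) = C.
  by move=> CX; apply: (pimset_preset HI); apply: (partS HX).
pose ff := tmap2 (block_map p HI) (block_map p HI).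
have mE := mten_mlin (trace_tensor_mlin L p HX' SI' e') (trace_tensor_mlin L p HX' RI' e').
suff E t : tmap2 (sp_map bp HS) (sp_map bp HR)
     (mten (trace_tensor_mlin L p HX SI e) (trace_tensor_mlin L p HX RI e) t) =
   mten (trace_tensor_mlin L p HX' SI' e') (trace_tensor_mlin L p HX' RI' e')
     (fun D => ff (t (preset f I D))).
  rewrite E; apply: mE.1 => D /imsetP[C CX ->]; rewrite /delta_fam preK //.
  have CI U' : C :&: U' \subset I by apply: subset_trans (partS HX CX); apply: subsetIl.
  rewrite /ff (block_map_delta HI) ?(decomp_disjI d) //.
  by rewrite (pimset_inter HI HS SI HX CX) (pimset_inter HI HR RI HX CX).
move: t; apply: (@mlin_eq _ _ _ _ X).
- by apply: mlin_lin (mten_mlin _ _); prove_linear.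
- have [hE hL] := mlin_comp (fun=> ff) mE.
  apply: (mlin_pull hE hL) => [t t' tt' D /imsetP[C CX ->]|t C CX]; first by rewrite preK ?tt'.
  exists (pimset f C); first exact: imset_f.
  move=> u D /imsetP[C' C'X ->]; rewrite /upd preK //; case: (eqVneq C' C) => [->|ne].
    by rewrite eqxx.
  case: eqP => // /(pimset_inj HI (partS HX C'X) (partS HX CX)) e''.
  by rewrite e'' eqxx in ne.
- move=> u v; rewrite mtenE tmap2E !(trace_tensor_nat L HI _ _ _ HX HX' HXX').
  rewrite -(mtenE (trace_tensor_mlin L p HX' SI' e') (trace_tensor_mlin L p HX' RI' e')).
  congr mten.
  by apply/funext => D; rewrite /ff tmap2E.
Qed.

(** Both sides are the same multilinear function of the families of blocks cut into
    three pieces, and these families agree by [block_deltaA]. *)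
Lemma subst_deltaA (T : finType) (I S12 S23 S1 S2 S3 : {set T})
    (d12 : decomp S12 S1 S2) (d12_3 : decomp I S12 S3)
    (d23 : decomp S23 S2 S3) (d1_23 : decomp I S1 S23) w :
  tassoc _ _ _ (tmap2 (subst_delta L p d12) idfun (subst_delta L p d12_3 w)) =
  tmap2 idfun (subst_delta L p d23) (subst_delta L p d1_23 w).
Proof.
move: w; apply: subst_eq_trace => [||X HX e x]; [by prove_linear | by prove_linear |].
set a := fun C => block_in C (x C).
have I12 := decompl d12_3; have I3 := decompr d12_3.
have I1 := decompl d1_23; have I23 := decompr d1_23.
have I2 : S2 \subset I := subset_trans (decompr d12) I12.
rewrite (subst_delta_trace L HX _ I12 I3 d12_3) (subst_delta_trace L HX _ I1 I23 d1_23).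
pose G1 := trace_tensor_mlin L p HX I1 e; pose G2 := trace_tensor_mlin L p HX I2 e.
pose G3 := trace_tensor_mlin L p HX I3 e.
pose G := mten G1 (mten_mlin G2 G3).
have GX : mlin X G := mten_mlin _ _.
pose P : lmodType k := block_space p T.
pose h12 C : {linear P \ox P -> P \ox (P \ox P)} :=
  tassoc P P P \o tmap2 (block_delta (C :&: S1) (C :&: S2)) idfun.
pose h23 C : {linear P \ox P -> P \ox (P \ox P)} :=
  tmap2 idfun (block_delta (C :&: S2) (C :&: S3)).
have E23 t : tmap2 idfun (subst_delta L p d23) (mten G1 (trace_tensor_mlin L p HX I23 e) t) =
    G (fun C => h23 C (t C)).
  move: t; apply: (@mlin_eq _ _ _ _ X).
  - by apply: mlin_lin (mten_mlin _ _); prove_linear.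
  - exact: (mlin_comp h23 GX).
  - move=> u v; rewrite mtenE tmap2_idl (subst_delta_trace L HX _ I2 I3 d23).
    rewrite -(mtenE G1 (mten_mlin G2 G3)); congr mten.
    by apply/funext => C; rewrite /h23 tmap2_idl.
have E12 t : tassoc _ _ _ (tmap2 (subst_delta L p d12) idfun
    (mten (trace_tensor_mlin L p HX I12 e) G3 t)) = G (fun C => h12 C (t C)).
  move: t; apply: (@mlin_eq _ _ _ _ X).
  - apply: (mlin_lin (h := fun y => tassoc _ _ _ (tmap2 (subst_delta L p d12) idfun y)));
      by [prove_linear | apply: mten_mlin].
  - exact: (mlin_comp h12 GX).
  - move=> u v; rewrite mtenE tmap2_idr (subst_delta_trace L HX _ I1 I2 d12).
    have -> : (fun C => h12 C (u C \ot v C)) =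
        (fun C => tassoc _ _ _ (delta_fam S1 S2 u C \ot v C)).
      apply/funext => C; rewrite -[LHS]/(tassoc _ _ _ (tmap2 _ _ (u C \ot v C))).
      by rewrite tmap2_idr.
    move: (delta_fam S1 S2 u); apply: (@mlin_eq _ _ _ _ X).
    + apply: (mlin_lin (h := fun y => tassoc _ _ _ (y \ot trace_tensor L HX I3 e v)));
        by [prove_linear | apply: mten_mlin].
    + pose hv C : {linear P \ox P -> P \ox (P \ox P)} :=
        mklin (linear_comp (tassoc P P P) (linear_otl (v C) (@linear_id k (P \ox P)))).
      exact: (mlin_comp hv GX).
    + move=> u1 u2; rewrite mtenE tassocE.
      rewrite -(mtenE G2 G3) -(mtenE G1 (mten_mlin G2 G3)); congr mten.
      by apply/funext => C; rewrite tassocE.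
rewrite E12 E23; apply: GX.1 => C CX.
rewrite -[LHS]/(tassoc _ _ _ (tmap2 _ _ (delta_fam S12 S3 a C))) /h23 /delta_fam.
have -> : C :&: S12 = (C :&: S1) :|: (C :&: S2) by case/andP: (d12) => /eqP <- _; rewrite setIUr.
have -> : C :&: S23 = (C :&: S2) :|: (C :&: S3) by case/andP: (d23) => /eqP <- _; rewrite setIUr.
have dS (A A' : {set T}) : [disjoint A & A'] -> [disjoint C :&: A & C :&: A'].
  by move=> dA; apply: disjointWl (disjointWr _ dA); apply: subsetIr.
apply: block_deltaA; apply: dS; first by case/andP: (d12).
  apply: disjointWr (_ : S3 \subset S23) _; first exact: decompr d23.
  by case/andP: (d1_23).
by case/andP: (d23).
Qed.

(** All blocks miss the empty set, so that only the scalar parts of the entries are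
    left. *)
Lemma subst_counit_trace (T : finType) (I : {set T}) (X : {set {set T}}) (HX : partition X I)
    (H0 : set0 \subset I) e a :
  subst_counit b p T (trace_tensor L HX H0 e a) = \prod_(C in X) (block_const (a C) : k) :> k.
Proof.
rewrite /trace_tensor linearZ_LR.
have e0 : blocks_trace X set0 = set0 by apply: (part_set0 (trace_partition HX H0)).
have Hb : is_bij Some (blocks_trace X set0) set0 by rewrite e0; apply: is_bij_id.
rewrite (subst_counitE b (trace_partition HX H0) _ _ Hb) sp_map_basis (counit_basis L).
rewrite -[LHS]/(off_coef X set0 a * 1) mulr1.
by apply: eq_bigl => C; rewrite setI0 eqxx andbT.
Qed.

Lemma subst_counitl (T : finType) (I : {set T}) (d : decomp I set0 I) w :
  tlunit _ (tmap2 (subst_counit b p T) idfun (subst_delta L p d w)) = w.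
Proof.
move: w; apply: subst_eq_trace => [||X HX e x]; [by prove_linear | by prove_linear |].
have H0 := decompl d.
rewrite (subst_delta_trace L HX _ H0 (subxx I) d).
have GX := trace_tensor_mlin L p HX (subxx I) e.
pose P : lmodType k := block_space p T.
pose h : {linear P \ox P -> P} := tlunit P \o tmap2 block_const idfun.
have E t : tlunit _ (tmap2 (subst_counit b p T) idfun
     (mten (trace_tensor_mlin L p HX H0 e) (trace_tensor_mlin L p HX (subxx I) e) t)) =
     trace_tensor L HX (subxx I) e (fun C => h (t C)).
  move: t; apply: (@mlin_eq _ _ _ _ X).
  - apply: (mlin_lin (h := fun y => tlunit _ (tmap2 (subst_counit b p T) idfun y)));
      by [prove_linear | apply: mten_mlin].
  - exact: (mlin_comp (fun=> h) GX).
  - move=> u v; rewrite mtenE tmap2_idr tlunitE subst_counit_trace.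
    rewrite -(mlin_scale _ _ GX); congr trace_tensor.
    apply/funext => C; rewrite -[RHS]/(tlunit _ (tmap2 block_const idfun (u C \ot v C))).
    by rewrite tmap2_idr tlunitE.
rewrite E; apply: GX.1 => C CX.
rewrite -[LHS]/(tlunit _ (tmap2 block_const idfun (delta_fam set0 I _ C))) /delta_fam setI0.
rewrite (setIidPl (partS HX CX)) block_delta0l ?(part_neq0 HX) // tmap2_idr tlunitE.
by rewrite block_const_one scale1r block_comp_in.
Qed.

Lemma subst_counitr (T : finType) (I : {set T}) (d : decomp I I set0) w :
  trunit _ (tmap2 idfun (subst_counit b p T) (subst_delta L p d w)) = w.
Proof.
move: w; apply: subst_eq_trace => [||X HX e x]; [by prove_linear | by prove_linear |].
have H0 := decompr d.
rewrite (subst_delta_trace L HX _ (subxx I) H0 d).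
have GX := trace_tensor_mlin L p HX (subxx I) e.
pose P : lmodType k := block_space p T.
pose h : {linear P \ox P -> P} := trunit P \o tmap2 idfun block_const.
have E t : trunit _ (tmap2 idfun (subst_counit b p T)
     (mten (trace_tensor_mlin L p HX (subxx I) e) (trace_tensor_mlin L p HX H0 e) t)) =
     trace_tensor L HX (subxx I) e (fun C => h (t C)).
  move: t; apply: (@mlin_eq _ _ _ _ X).
  - apply: (mlin_lin (h := fun y => trunit _ (tmap2 idfun (subst_counit b p T) y)));
      by [prove_linear | apply: mten_mlin].
  - exact: (mlin_comp (fun=> h) GX).
  - move=> u v; rewrite mtenE tmap2_idl trunitE subst_counit_trace.
    rewrite -(mlin_scale _ _ GX); congr trace_tensor.
    apply/funext => C; rewrite -[RHS]/(trunit _ (tmap2 idfun block_const (u C \ot v C))).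
    by rewrite tmap2_idl trunitE.
rewrite E; apply: GX.1 => C CX.
rewrite -[LHS]/(trunit _ (tmap2 idfun block_const (delta_fam I set0 _ C))) /delta_fam setI0.
rewrite (setIidPl (partS HX CX)) block_delta0r ?(part_neq0 HX) // tmap2_idl trunitE.
by rewrite block_const_one scale1r block_comp_in.
Qed.

(** A block of X is cut by S' |_| R' in the same way as by A |_| C, and a block of Y
    in the same way as by D |_| E.  Both sides are therefore the same multilinear
    function of the family of cut blocks of X and Y together; on pure tensors this
    is [trace_tensor_mu] for S' and for R'. *)
Lemma subst_mu_delta (T : finType) (I S R S' R' A C D E : {set T})
    (d : decomp I S R) (d' : decomp I S' R')
    (dS : decomp S A C) (dR : decomp R D E)
    (dS' : decomp S' A D) (dR' : decomp R' C E) t :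
  subst_delta L p d' (subst_mu b p d t) =
  tmap2 (subst_mu b p dS') (subst_mu b p dR')
    (tmid _ _ _ _ (tmap2 (subst_delta L p dS) (subst_delta L p dR) t)).
Proof.
move: t; apply: tens2_eq_linear => [||s t]; [by prove_linear | by prove_linear |].
move: s; apply: subst_eq_trace => [||X HX e x]; [by prove_linear | by prove_linear |].
move: t; apply: subst_eq_trace => [||Y HY e' y]; [by prove_linear | by prove_linear |].
have dZ := decomp_union d HX HY; have HZ := partition_union d HX HY.
have AS := decompl dS; have CS := decompr dS; have DR := decompl dR; have ER := decompr dR.
have SI := decompl d'; have RI := decompr d'.
set a := fun F => block_in F (x F); set a' := fun F => block_in F (y F).
rewrite (trace_tensor_mu L d d (subxx S) (subxx R) (subxx I) HX HY dZ HZ).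
rewrite (subst_delta_trace L HZ _ SI RI d') tmap2E.
rewrite (subst_delta_trace L HX _ AS CS dS) (subst_delta_trace L HY _ DR ER dR).
set e'' := lmu L dZ (e, e').
pose G := mten (trace_tensor_mlin L p HZ SI e'') (trace_tensor_mlin L p HZ RI e'').
have [GE GL] : mlin (X :|: Y) G := mten_mlin _ _.
have glueE (M : Type) (u u' v v' : {set T} -> M) : {in X, u =1 u'} -> {in Y, v =1 v'} ->
    {in X :|: Y, glue X u v =1 glue X u' v'}.
  move=> uu' vv' F; rewrite inE /glue; case: ifP => [FX _|_]; [exact: uu'|exact: vv'].
have H s t : tmap2 (subst_mu b p dS') (subst_mu b p dR') (tmid _ _ _ _
      (mten (trace_tensor_mlin L p HX AS e) (trace_tensor_mlin L p HX CS e) s \ot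
       mten (trace_tensor_mlin L p HY DR e') (trace_tensor_mlin L p HY ER e') t)) =
    G (glue X s t).
  move: s; apply: (@mlin_eq _ _ _ _ X).
  - pose ht := mten (trace_tensor_mlin L p HY DR e') (trace_tensor_mlin L p HY ER e') t.
    apply: (mlin_lin (h := fun y =>
        tmap2 (subst_mu b p dS') (subst_mu b p dR') (tmid _ _ _ _ (y \ot ht))));
      by [prove_linear | apply: mten_mlin].
  - apply: (mlin_pull GE GL) => [s s' ss'|s F FX]; first exact: glueE.
    exists F => [|u F' _]; first by rewrite inE FX.
    by rewrite /glue /upd; case: eqVneq => // ->; rewrite FX.
  move=> u v; move: t; apply: (@mlin_eq _ _ _ _ Y).
  - pose hs := mten (trace_tensor_mlin L p HX AS e) (trace_tensor_mlin L p HX CS e)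
      (fun i => u i \ot v i).
    apply: (mlin_lin (h := fun y =>
        tmap2 (subst_mu b p dS') (subst_mu b p dR') (tmid _ _ _ _ (hs \ot y))));
      by [prove_linear | apply: mten_mlin].
  - apply: (mlin_pull GE GL) => [t t' tt'|t F FY]; first exact: glueE.
    exists F => [|w F' _]; first by rewrite inE FY orbT.
    rewrite /glue /upd; case: (eqVneq F' F) => // ->; case: ifP => // FX.
    by case: (decomp_memF dZ FX FY).
  move=> u' v'; rewrite !mtenE tmidE tmap2E.
  rewrite (trace_tensor_mu L d dS' AS DR SI HX HY dZ HZ).
  rewrite (trace_tensor_mu L d dR' CS ER RI HX HY dZ HZ).
  rewrite -(mtenE (trace_tensor_mlin L p HZ SI e'') (trace_tensor_mlin L p HZ RI e'')) /G.
  congr mten.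
  by apply/funext => F; rewrite /glue; case: ifP.
rewrite H; apply: GE => F; rewrite inE /glue /delta_fam; case: ifP => [FX _|_ FY].
  by rewrite (inter_left d dS' DR HX FX) (inter_left d dR' ER HX FX).
by rewrite (inter_right d dS' AS HY FY) (inter_right d dR' CS HY FY).
Qed.

Lemma trace_tensor_set0 (T : finType) (H0 : set0 \subset (set0 : {set T})) e a x :
  trace_tensor L (partition_set0 T) H0 e a =
  subst_inj (partition_set0 T) (basis k e \ot ppure set0 x) :> bp @@ (set0 : {set T}).
Proof.
rewrite -(trace_tensor_full L (partition_set0 T) H0 e x).
by apply: (trace_tensor_mlin L p (partition_set0 T) H0 e).1 => C; rewrite inE.
Qed.

(** The unit comes from the unit of b, for which the law holds.  The coproduct is
    only known on basis elements; as those on the empty set satisfy e |-> e (x) e,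
    it agrees there with the coproduct of b. *)
Lemma subst_delta_one (T : finType) (d : decomp (set0 : {set T}) set0 set0) :
  subst_delta L p d (subst_one b p T) = subst_one b p T \ot subst_one b p T.
Proof.
pose j : {linear lin k B @@ (set0 : {set {set T}}) -> bp @@ (set0 : {set T})} :=
  subst_injL (lin k B) p (partition_set0 T) \o mklin (tpure2l (ppure set0 (fun=> 0))).
have d0 := decomp0l (set0 : {set {set T}}).
rewrite -![subst_one b p T]/(j (bone b {set T})).
have -> : j (bone b {set T}) \ot j (bone b {set T}) =
    tmap2 j j (bdelta b d0 (bone b {set T})) by rewrite bdelta_one tmap2E.
move: (bone b {set T}) => v.
pose F := subst_delta L p d \o j; pose G := tmap2 j j \o bdelta b d0.
apply: (@lin_eq k B _ _ _ F G) => e.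
rewrite -[LHS]/(subst_delta L p d (j (basis k e))) -[RHS]/(tmap2 j j (bdelta b d0 (basis k e))).
rewrite (ldeltaE L) tmap2E (ldelta_counitl L d0) (ldelta_counitr L d0 e).2.
have jE : j (basis k e) = trace_tensor L (partition_set0 T) (subxx _) e (fun=> block_one).
  by rewrite (trace_tensor_set0 _ _ _ (fun=> 0)).
rewrite jE (subst_delta_trace L _ _ (subxx _) (subxx _) d).
pose GX := trace_tensor_mlin L p (partition_set0 T) (subxx (set0 : {set T})) e.
rewrite -(mtenE GX GX).
by apply: (mten_mlin _ _).1 => C; rewrite inE.
Qed.

Definition subst_bimonoid : bimonoid bp :=
  @Bimonoid k bp (@subst_mu _ _ b p) (@subst_delta _ _ b L p) (subst_one b p) (subst_counit b p)
    (@subst_mu_nat _ _ b p) subst_delta_nat (@subst_one_nat _ _ b p) (@subst_counit_nat _ _ b p)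
    (@subst_muA _ _ b p) (@subst_mu1l _ _ b p) (@subst_mu1r _ _ b p)
    subst_deltaA subst_counitl subst_counitr
    subst_mu_delta subst_delta_one (@subst_counit_mu _ _ b p) (@subst_counit_one _ _ b p).
End CoproductAxioms.

(** * The coproduct in Sweedler notation *)
Section SweedlerFormula.
Variable k : fieldType.

Lemma mlin_sum_on (K J : finType) (P Z : lmodType k) (X : {set K}) (g : (K -> P) -> Z)
    (F : K -> J -> P) : mlin X g ->
  g (fun i => \sum_j F i j) =
  \sum_(phi : {ffun {i : K | i \in X} -> J})
     g (fun i => oapp (fun i' => F i (phi i')) 0 (insub i)).
Proof.
move=> [gE gL]; pose g' (t : {i : K | i \in X} -> P) := g (fun i => oapp t 0 (insub i)).
have g'X : mlin [set: {i : K | i \in X}] g'.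
  split=> [t t' tt'|t i _].
    by apply: gE => i iX; case: insubP => // i' _ _ /=; apply: tt'; rewrite inE.
  apply: (linear_eq (gL (fun i => oapp t 0 (insub i)) (val i) (valP i))) => u.
  apply: gE => j jX; rewrite /upd; case: insubP => [j' _ <- /=|]; last by rewrite jX.
  by rewrite (inj_eq val_inj).
transitivity (g' (fun i => \sum_j F (val i) j)).
  by apply: gE => i iX; case: insubP => [i' _ <- //|]; rewrite iX.
rewrite (mlin_sum (fun i j => F (val i) j) g'X); apply: eq_bigr => phi _.
by apply: gE => i iX; case: insubP => [i' _ <- //|]; rewrite iX.
Qed.

Lemma oapp_insub (K : choiceType) (M : Type) (Q : pred K) (f : {i : K | Q i} -> M) m i
    (Qi : Q i) :
  oapp f m (insub i) = f (exist _ i Qi).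
Proof. by rewrite insubT. Qed.

Variables (B : set_species) (b : bimonoid (lin k B)) (L : linearized b).
Variables (p : pos_comonoid k) (T : finType).
Variables (X : {set {set T}}) (J : finType).

Definition block_factor (D : {set T}) (y : p @@ D) : block_space p T :=
  if D == set0 then block_one else block_in D y.

Definition sweedler_fam (S : {set T}) (u : forall C : {set T}, J -> p @@ C)
    (phi : {ffun {C : {set T} | C \in X} -> J}) (C : {set T}) : block_space p T :=
  oapp (fun C' => block_factor (u (C :&: S) (phi C'))) 0 (insub C).

Lemma trace_tensor_sweedler (I S : {set T}) (HX : partition X I) (SI : S \subset I) e u phi :
  trace_tensor L HX SI e (sweedler_fam S u phi) =
  subst_inj (trace_partition HX SI)
    (basis k (down L S HX e) \ot ppure (blocks_trace X S) (sweedler_pick u phi)).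
Proof.
rewrite -[RHS]scale1r; apply: scale_inj_congr => [|D /traceP[C [CX C0 ->]]].
  apply: big1 => C /andP[CX C0].
  by rewrite /sweedler_fam (oapp_insub _ _ CX) /block_factor C0 block_const_one.
rewrite (trace_famE _ HX CX) ?subsetIl // /sweedler_fam (oapp_insub _ _ CX).
rewrite /block_factor (negbTE C0) block_comp_in.
rewrite /sweedler_pick; case: pickP => [C' CC'|/(_ (exist _ C CX))]; last by rewrite subsetIl.
congr (u _ (phi _)); apply: val_inj => /=; apply/eqP; apply: contraNT C0 => ne.
rewrite -subset0 -(part_disj HX CX (valP C')); first by rewrite subsetI subsetIl.
by rewrite ne.
Qed.

(** The three clauses of [sweedler] are the three ways to cut a block: into two
    pieces, or with everything on one side. *)
Lemma block_delta_sweedler (I S R : {set T}) (d : decomp I S R) (HX : partition X I) x u v C :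
  sweedler S R X x u v -> C \in X ->
  block_delta (C :&: S) (C :&: R) (block_in C (x C)) =
  \sum_(j : J) block_factor (u (C :&: S) j) \ot block_factor (v (C :&: R) j).
Proof.
move=> uv CX; have [xD xS xR] := uv C CX; rewrite /block_factor.
have CI := partS HX CX; have C0 := part_neq0 HX CX.
have eC : C :&: S :|: C :&: R = C.
  by have [/eqP eI _] := andP d; rewrite -setIUr eI; apply/setIidPl.
have dC := decomp_disjI d C.
have [CS0|CS0] := eqVneq (C :&: S) set0; have [CR0|CR0] := eqVneq (C :&: R) set0.
- by move: C0; rewrite -eC CS0 CR0 setU0 eqxx.
- have eR : C :&: R = C by rewrite -[RHS]eC CS0 set0U.
  rewrite CS0 eR block_delta0l // block_comp_in xR; last by apply/setIidPl.
  by rewrite raddf_sum -(linear_big_sum _ _ _ (@tpure2r k _ _ block_one)).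
- have eS : C :&: S = C by rewrite -[RHS]eC CR0 setU0.
  rewrite CR0 eS block_delta0r // block_comp_in xS; last by apply/setIidPl.
  by rewrite raddf_sum (linear_big_sum _ _ _ (@tpure2l k _ _ block_one)).
have dd : decomp C (C :&: S) (C :&: R) by rewrite /decomp eC eqxx.
rewrite (block_delta_neq0 dd CS0 CR0) block_comp_in xD raddf_sum.
by apply: eq_bigr => j _; exact: tmap2E.
Qed.

(** The cut blocks being sums of pure tensors, this is the expansion of a multilinear
    function of sums. *)
Lemma subst_delta_sweedler (I S R : {set T}) (d : decomp I S R) (HX : partition X I)
    (e : B @@s X) (x : forall C : {set T}, p @@ C) (u v : forall C : {set T}, J -> p @@ C) :
  sweedler S R X x u v ->
  subst_delta L p d (subst_inj HX (basis k e \ot ppure X x)) =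
  \sum_(phi : {ffun {C : {set T} | C \in X} -> J})
    subst_inj (trace_partition HX (decompl d))
      (basis k (down L S HX e) \ot ppure (blocks_trace X S) (sweedler_pick u phi)) \ot
    subst_inj (trace_partition HX (decompr d))
      (basis k (down L R HX e) \ot ppure (blocks_trace X R) (sweedler_pick v phi)).
Proof.
move=> uv; rewrite -(trace_tensor_full L HX (subxx I)).
rewrite (subst_delta_trace L HX _ (decompl d) (decompr d) d).
have G := mten_mlin (trace_tensor_mlin L p HX (decompl d) e)
                    (trace_tensor_mlin L p HX (decompr d) e).
rewrite (G.1 _ _ (fun C CX => block_delta_sweedler d HX uv CX)) (mlin_sum_on _ G).
apply: eq_bigr => phi _; rewrite -!trace_tensor_sweedler.
rewrite -(mtenE (trace_tensor_mlin L p HX (decompl d) e)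
                (trace_tensor_mlin L p HX (decompr d) e)).
apply: G.1 => C CX.
by rewrite (oapp_insub _ _ CX) /sweedler_fam !(oapp_insub _ _ CX).
Qed.
End SweedlerFormula.

Theorem theorem1 (k : fieldType) (B : set_species) (b : bimonoid (lin k B))
    (L : linearized b) (hconn : connected (lin k B)) (hcoc : cocommutative b)
    (p : pos_comonoid k) :
  exists H : bimonoid (subst (lin k B) p),
  [/\ forall (T : finType) (I S R : {set T}) (d : decomp I S R)
        (X Y : {set {set T}}) (HX : partition X S) (HY : partition Y R)
        (v : lin k B @@ X) (w : lin k B @@ Y) (x : forall C : {set T}, p @@ C),
        bmu H d (subst_inj HX (v \ot ppure X x) \ot
                 subst_inj HY (w \ot ppure Y x)) =
        subst_inj (partition_union d HX HY)
          (bmu b (decomp_union d HX HY) (v \ot w) \ot ppure (X :|: Y) x),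
      forall (T : finType) (I S R : {set T}) (d : decomp I S R)
        (X : {set {set T}}) (HX : partition X I)
        (e : B @@s X) (x : forall C : {set T}, p @@ C)
        (J : finType) (u v : forall C : {set T}, J -> p @@ C),
        sweedler S R X x u v ->
        bdelta H d (subst_inj HX (basis k e \ot ppure X x)) =
        \sum_(phi : {ffun {C : {set T} | C \in X} -> J})
          subst_inj (trace_partition HX (decompl d))
            (basis k (down L S HX e) \ot
             ppure (blocks_trace X S) (sweedler_pick u phi)) \ot
          subst_inj (trace_partition HX (decompr d))
            (basis k (down L R HX e) \ot
             ppure (blocks_trace X R) (sweedler_pick v phi)),
      forall (T : finType) (x : forall C : {set T}, p @@ C),
        bone H T = subst_inj (partition_set0 T) (bone b {set T} \ot ppure set0 x)
    & forall (T : finType) (v : lin k B @@ (set0 : {set {set T}}))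
        (x : forall C : {set T}, p @@ C),
        bcounit H T (subst_inj (partition_set0 T) (v \ot ppure set0 x)) =
        bcounit b {set T} v].
Proof.
exists (subst_bimonoid L p); split.
- move=> T I S R d X Y HX HY v w x.
  exact: (subst_mu_pure b d HX HY (decomp_union d HX HY) (partition_union d HX HY) v w (z := x)).
- move=> T I S R d X HX e x J u v; exact: subst_delta_sweedler.
- by move=> T x; rewrite -(ppure0 (fun=> 0) x).
- by move=> T v x; apply: subst_counit0.
Qed.
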